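(* Let $K$ be an algebraically closed field of characteristic $2$ and $G=\mathrm{GL}_2(K)$. Let $V$ be the $G$-module with $$V^*=\left(\langle X^2,Y^2\rangle\otimes\langle E\rangle\right)\oplus\bigoplus_{i=1}^{2}\left(\langle X_i,Y_i\rangle\oplus\langle X_i^*,Y_i^*\rangle\right)\cong\left(\langle X^2,Y^2\rangle\otimes\langle E\rangle\right)\oplus\bigoplus_{i=1}^{2}\left(\langle X_i,Y_i\rangle\oplus(\langle X_i,Y_i\rangle\otimes\langle E\rangle)\right).$$ Then $\dim V=10$ and the invariant ring $K[V]^{\mathrm{GL}_2(K)}$ is not Cohen-Macaulay. There is a $1$-cocycle of $G$, nontrivial in $H^1(G,K[V])$, with values in the first summand $\langle X^2,Y^2\rangle\otimes\langle E\rangle\subseteq K[V]_1$ (so in degree $1$), and a partial homogeneous system of parameters of degree $2$ invariants annihilating it is given by $$X_1X_1^*+Y_1Y_1^*,\quad X_2X_2^*+Y_2Y_2^*,\quad X_1X_2^*+Y_1Y_2^*.$$ The summands $\langle X_i,Y_i\rangle\oplus\langle X_i^*,Y_i^*\rangle$ are self-dual.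
   Context: Write $\sigma=\begin{pmatrix}a&b\\c&d\end{pmatrix}\in G$ and $e=(ad-bc)^{-1}$. Each $\langle X_i,Y_i\rangle$ is a copy of the natural $G$-module: $\sigma X_i=aX_i+cY_i$, $\sigma Y_i=bX_i+dY_i$; $\langle X_i^*,Y_i^*\rangle$ is its dual with the dual basis. $\langle X^2,Y^2\rangle$ is the submodule of $S^2(\langle X,Y\rangle)$ ($\langle X,Y\rangle$ natural) with $\sigma X^2=a^2X^2+c^2Y^2$, $\sigma Y^2=b^2X^2+d^2Y^2$. $\langle E\rangle$ is the one-dimensional $G$-module with $\sigma E=eE=(ad-bc)^{-1}E$. As summands of $V^*$, all basis elements are variables of degree $1$ in the polynomial ring $K[V]$. For a $G$-module $V$ (finite-dimensional, with linear algebraic action), $K[V]=S(V^* )=\bigoplus_{d\ge0}S^d(V^* )$ with induced $G$-action, $K[V]_d=S^d(V^* )$. A $1$-cocycle with values in a $G$-module $M$ is a morphism $g:G\to M$, $\sigma\mapsto g_\sigma$, with $g_{\sigma\tau}=\sigma(g_\tau)+g_\sigma$; it is a coboundary if $g_\sigma=(\sigma-1)v$ for a fixed $v\in M$; $H^1$ is cocycles modulo coboundaries (likewise for $K[V]$). An invariant $f\in K[V]^G$ annihilates $g$ if $\sigma\mapsto f g_\sigma$ is a coboundary in $K[V]$. For a noetherian connected graded commutative domain $R$ over $K$, a homogeneous system of parameters (hsop) is a set of homogeneous algebraically independent elements over whose generated subalgebra $R$ is a finitely generated module; a partial hsop is a set extendable to an hsop. $R$ is Cohen-Macaulay if it is free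 over the subalgebra generated by one (equivalently every) hsop. *)

(* Defs.v *)
(* MathComp *)
From HB Require Import structures.
From mathcomp Require Import all_boot all_order all_fingroup all_algebra.
From mathcomp Require Import mxtens mpoly.

Set Implicit Arguments.
Unset Strict Implicit.
Unset Printing Implicit Defensive.

Import GRing.Theory.
Local Open Scope ring_scope.

(* The group GL_2(K).  MathComp's {'GL_n[R]} requires a finite ring.      *)

Section GL2.
Variable K : fieldType.

Record GL2 := MkGL2 { GL2val :> 'M[K]_2; GL2P : GL2val \in unitmx }.

HB.instance Definition _ := [isSub for GL2val].
HB.instance Definition _ := [Choice of GL2 by <:].

Definition GL2_mul (s t : GL2) : GL2 :=
  MkGL2 (etrans (unitmx_mul s t) (introT andP (conj (GL2P s) (GL2P t)))).
Definition GL2_one : GL2 := MkGL2 (unitmx1 K 2).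
Definition GL2_inv (s : GL2) : GL2 :=
  MkGL2 (etrans (unitmx_inv s) (GL2P s)).

Fact GL2_mulA : associative GL2_mul.
Proof. by move=> r s t; apply: val_inj; exact: mulmxA. Qed.
Fact GL2_mul1 : left_id GL2_one GL2_mul.
Proof. by move=> s; apply: val_inj; exact: mul1mx. Qed.
Fact GL2_1mul : right_id GL2_one GL2_mul.
Proof. by move=> s; apply: val_inj; exact: mulmx1. Qed.
Fact GL2_mulV : left_inverse GL2_one GL2_inv GL2_mul.
Proof. by move=> s; apply: val_inj; exact: mulVmx (GL2P s). Qed.
Fact GL2_Vmul : right_inverse GL2_one GL2_inv GL2_mul.
Proof. by move=> s; apply: val_inj; exact: mulmxV (GL2P s). Qed.

HB.instance Definition _ :=
  isGroup.Build GL2 GL2_mulA GL2_mul1 GL2_1mul GL2_mulV GL2_Vmul.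

Lemma GL2valM (s t : GL2) : GL2val (s * t)%g = GL2val s *m GL2val t. Proof. by []. Qed.
Lemma GL2val1 : GL2val 1%g = 1%:M. Proof. by []. Qed.
Lemma GL2valV (s : GL2) : GL2val (s^-1)%g = invmx (GL2val s). Proof. by []. Qed.

(* The coordinate ring of the affine variety GL_2: polynomials in the     *)
(* four matrix entries, divided by a power of the determinant.            *)
Definition regular (f : GL2 -> K) : Prop :=
  exists (P : {mpoly K[2 * 2]}) (k : nat),
    forall s : GL2, f s = P.@[fun i => mxvec s 0 i] / (\det s) ^+ k.

(* Morphisms from GL_2 to a possibly infinite-dimensional vector space:   *)
(* the image spans a finite-dimensional subspace, on which the            *)
(* coordinates are regular.                                               *)
Definition regular_map (U : lmodType K) (g : GL2 -> U) : Prop :=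
  exists (m : nat) (u : 'I_m -> U) (f : 'I_m -> GL2 -> K),
    (forall i, regular (f i)) /\ (forall s, g s = \sum_(i < m) f i s *: u i).

Lemma GL2det_neq0 (s : GL2) : \det s != 0.
Proof. by rewrite -unitfE -unitmxE GL2P. Qed.

Lemma eq_regular f g : f =1 g -> regular f -> regular g.
Proof. by move=> e [P [k h]]; exists P, k => s; rewrite -e h. Qed.

Lemma regular_cst c : regular (fun => c).
Proof. by exists c%:MP, 0%N => s; rewrite mevalC divr1. Qed.

Lemma regular_entry i j : regular (fun s => GL2val s i j).
Proof.
exists 'X_(mxvec_index i j), 0%N => s.
by rewrite mevalXU mxvecE divr1.
Qed.

Lemma regular_detV : regular (fun s => (\det s)^-1).
Proof. by exists 1, 1%N => s; rewrite meval1 mul1r expr1. Qed.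

Lemma regularM f g :
  regular f -> regular g -> regular (fun s => f s * g s).
Proof.
move=> [P [k h]] [Q [l h']]; exists (P * Q), (k + l)%N => s.
by rewrite h h' mevalM exprD invfM mulrACA.
Qed.

Lemma det_poly : exists D : {mpoly K[2 * 2]},
  forall s : GL2, D.@[fun i => mxvec s 0 i] = \det s.
Proof.
exists (\det (\matrix_(i < 2, j < 2) 'X_(mxvec_index i j))) => s.
rewrite -det_map_mx; congr (\det _); apply/matrixP => i j.
rewrite mxE mxE; transitivity (mxvec (GL2val s) 0 (mxvec_index i j)).
  by rewrite /= mevalXU.
by rewrite mxvecE.
Qed.

Lemma regularD f g :
  regular f -> regular g -> regular (fun s => f s + g s).
Proof.
have [D hD] := det_poly.
move=> [P [k h]] [Q [l h']]; exists (P * D ^+ l + Q * D ^+ k), (k + l)%N => s.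
have d0 := GL2det_neq0 s.
rewrite h h' mevalD !mevalM !rmorphXn /= hD exprD.
by rewrite addf_div ?expf_neq0.
Qed.

Lemma regular_sum (I : Type) (r : seq I) (F : I -> GL2 -> K) :
  (forall i, regular (F i)) -> regular (fun s => \sum_(i <- r) F i s).
Proof.
move=> h; elim: r => [|i r ih].
  by apply: eq_regular (regular_cst 0) => s; rewrite big_nil.
by apply: eq_regular (regularD (h i) ih) => s; rewrite big_cons.
Qed.

Lemma regular_inv_entry i j : regular (fun s => (s^-1)%g i j).
Proof.
have e (s : GL2) : (s^-1)%g i j = (\det s)^-1 * \adj s i j.
  by rewrite GL2valV /invmx GL2P mxE.
apply: (@eq_regular (fun s => (\det s)^-1 * \adj s i j)) => [s|]; first by rewrite e.
apply: regularM; first exact: regular_detV.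
have e' (s : GL2) : \adj s i j = (-1) ^+ (j + i) * GL2val s (lift j ord0) (lift i ord0).
  by rewrite mxE /cofactor det_mx11 !mxE.
apply: (@eq_regular (fun s => (-1) ^+ (j + i) * GL2val s (lift j ord0) (lift i ord0))).
  by move=> s; rewrite e'.
by apply: regularM; [exact: regular_cst | exact: regular_entry].
Qed.

Lemma regular_comp_poly n (Q : {mpoly K[n]}) (f : 'I_n -> GL2 -> K) :
  (forall i, regular (f i)) -> regular (fun s => Q.@[fun i => f i s]).
Proof.
move=> h; have hX (F : GL2 -> K) k : regular F -> regular (fun s => F s ^+ k).
  move=> hF; elim: k => [|k ih].
    by apply: eq_regular (regular_cst 1) => s; rewrite expr0.
  by apply: eq_regular (regularM hF ih) => s; rewrite exprS.
have hP (r : seq 'I_n) (F : 'I_n -> GL2 -> K) :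
    (forall i, regular (F i)) -> regular (fun s => \prod_(i <- r) F i s).
  move=> hF; elim: r => [|i r ih].
    by apply: eq_regular (regular_cst 1) => s; rewrite big_nil.
  by apply: eq_regular (regularM (hF i) ih) => s; rewrite big_cons.
apply: (@eq_regular (fun s => \sum_(m <- msupp Q) Q@_m * \prod_i f i s ^+ m i)).
  by move=> s; rewrite mevalE.
apply: regular_sum => m; apply: regularM; first exact: regular_cst.
by apply: hP => i; apply: hX.
Qed.

Lemma regular_inv f : regular f -> regular (fun s => f (s^-1)%g).
Proof.
have [D hD] := det_poly.
have hi: forall i, regular (fun s => mxvec (GL2val (s^-1)%g) 0 i).
  move=> i; case/mxvec_indexP: i => i j.
  by apply: eq_regular (regular_inv_entry i j) => s; rewrite mxvecE.
move=> [P [k h]].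
apply: (@eq_regular (fun s => P.@[fun i => mxvec (GL2val (s^-1)%g) 0 i] *
                              (D ^+ k).@[fun i => mxvec (GL2val s) 0 i])).
  move=> s; rewrite h rmorphXn /= hD; congr (_ * _).
  by rewrite det_inv -exprVn invrK.
apply: regularM; first exact: (regular_comp_poly P hi).
by exists (D ^+ k), 0%N => s; rewrite divr1.
Qed.

(* Finite-dimensional G-modules with linear algebraic action, given in a  *)
(* basis b_0, ..., b_(n-1):  s b_j = \sum_i (gmat s i j) b_i.             *)

Record gmodule := GModule {
  gdim : nat;
  gmat : GL2 -> 'M[K]_gdim;
  gmat1 : gmat 1%g = 1%:M;
  gmatM : forall s t, gmat (s * t)%g = gmat s *m gmat t;
  gmat_reg : forall i j, regular (fun s => gmat s i j) }.

Definition giso (M N : gmodule) : Prop :=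
  exists (A : 'M[K]_(gdim N, gdim M)) (B : 'M[K]_(gdim M, gdim N)),
    [/\ A *m B = 1%:M, B *m A = 1%:M &
        forall s, A *m gmat M s = gmat N s *m A].

Definition gvec (M : gmodule) (s : GL2) (v : 'cV[K]_(gdim M)) :
  'cV[K]_(gdim M) := gmat M s *m v.

Definition gnat : gmodule.
Proof.
refine (@GModule 2 (fun s => GL2val s) GL2val1 GL2valM _).
exact: regular_entry.
Defined.

Definition gdetV : gmodule.
Proof.
refine (@GModule 1 (fun s => ((\det s)^-1)%:M) _ _ _).
- by rewrite det1 invr1.
- by move=> s t; rewrite det_mulmx invfM -scalar_mxM.
- move=> i j; apply: eq_regular regular_detV => s.
  by rewrite !ord1 mxE eqxx.
Defined.

Definition gdual (M : gmodule) : gmodule.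
Proof.
refine (@GModule (gdim M) (fun s => (gmat M (s^-1)%g)^T) _ _ _).
- by rewrite invg1 gmat1 trmx1.
- by move=> s t; rewrite invMg gmatM trmx_mul.
- move=> i j.
  by apply: eq_regular (regular_inv (gmat_reg j i)) => s; rewrite mxE.
Defined.

Definition gsum (M N : gmodule) : gmodule.
Proof.
refine (@GModule (gdim M + gdim N)
  (fun s => block_mx (gmat M s) 0 0 (gmat N s)) _ _ _).
- by rewrite !gmat1 -scalar_mx_block.
- by move=> s t; rewrite !gmatM mulmx_block !(mulmx0, mul0mx, addr0, add0r).
- move=> i j; have h0 := regular_cst 0.
  case: (split_ordP i) => i' ->; case: (split_ordP j) => j' ->.
  + by apply: eq_regular (gmat_reg i' j') => s; rewrite block_mxEul.
  + by apply: eq_regular h0 => s; rewrite block_mxEur mxE.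
  + by apply: eq_regular h0 => s; rewrite block_mxEdl mxE.
  + by apply: eq_regular (gmat_reg i' j') => s; rewrite block_mxEdr.
Defined.

(* Basis b_i (x) c_j, in lexicographic order. *)
Definition gtens (M N : gmodule) : gmodule.
Proof.
refine (@GModule (gdim M * gdim N) (fun s => gmat M s *t gmat N s) _ _ _).
- apply/matrixP => i j.
  rewrite -(mxtens_unindexK i) -(mxtens_unindexK j).
  case: (mxtens_unindex i) (mxtens_unindex j) => [i1 i2] [j1 j2].
  rewrite tensmxE !gmat1 !mxE (can_eq (@mxtens_indexK _ _)) xpair_eqE.
  by rewrite -natrM mulnb.
- by move=> s t; rewrite !gmatM tensmx_mul.
- move=> i j.
  rewrite -(mxtens_unindexK i) -(mxtens_unindexK j).
  case: (mxtens_unindex i) (mxtens_unindex j) => [i1 i2] [j1 j2].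
  apply: eq_regular (regularM (gmat_reg i1 j1) (gmat_reg i2 j2)) => s.
  by rewrite tensmxE.
Defined.

(* The span of the squares of the basis vectors of the natural module,    *)
(* inside its symmetric square; see gsqE below.                           *)
Definition gsq (hK : 2%N \in [pchar K]) : gmodule.
Proof.
refine (@GModule 2 (fun s => map_mx (fun x : K => x ^+ 2) (GL2val s)) _ _ _).
- by apply/matrixP => i j; rewrite !mxE; case: eqP; rewrite ?expr1n ?expr0n.
- move=> s t; apply/matrixP => i j; rewrite !mxE.
  rewrite -(pFrobenius_autE hK) rmorph_sum; apply: eq_bigr => k _.
  by rewrite !mxE /= pFrobenius_autE exprMn.
- move=> i j.
  apply: eq_regular (regularM (regular_entry i j) (regular_entry i j)) => s.
  by rewrite mxE expr2.
Defined.

(* S(M) is the polynomial ring on the basis of M, with G acting by        *)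
(* algebra automorphisms.                                                 *)

Definition glin (M : gmodule) (v : 'cV[K]_(gdim M)) : {mpoly K[gdim M]} :=
  \sum_(i < gdim M) v i 0 *: 'X_i.

Definition sym_act (M : gmodule) (s : GL2) (p : {mpoly K[gdim M]}) :
  {mpoly K[gdim M]} :=
  p \mPo [tuple glin (col j (gmat M s)) | j < gdim M].

(* K[V] = S(V^* ) with the induced action. *)
Definition coord_act (V : gmodule) :
  GL2 -> {mpoly K[gdim (gdual V)]} -> {mpoly K[gdim (gdual V)]} :=
  @sym_act (gdual V).

Definition invariant_ring (V : gmodule) (f : {mpoly K[gdim (gdual V)]}) : Prop :=
  forall s, coord_act s f = f.

Lemma gdualK (M : gmodule) s : gmat (gdual (gdual M)) s = gmat M s.
Proof. by rewrite /= trmxK invgK. Qed.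

Lemma glin_act (M : gmodule) s (v : 'cV[K]_(gdim M)) :
  sym_act s (glin v) = glin (gvec s v).
Proof.
rewrite /sym_act /glin raddf_sum /=.
under eq_bigr => j _.
  rewrite comp_mpolyZ comp_mpolyXU -tnth_nth tnth_mktuple scaler_sumr.
  under eq_bigr => i _ do rewrite scalerA mxE mulrC.
  over.
rewrite exchange_big /=; apply: eq_bigr => i _.
by rewrite -scaler_suml mxE.
Qed.

Lemma gsqE (hK : 2%N \in [pchar K]) s (j : 'I_2) :
  sym_act (M := gnat) s ('X_j ^+ 2) =
  \sum_(i < 2) gmat (gsq hK) s i j *: 'X_i ^+ 2.
Proof.
rewrite /sym_act rmorphXn /= comp_mpolyXU -tnth_nth tnth_mktuple /glin /=.
have hM : 2%N \in [pchar {mpoly K[2]}].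
  by rewrite inE /= -mpolyC_nat (pcharf0 hK) mpolyC0 eqxx.
rewrite -(pFrobenius_autE hM) rmorph_sum; apply: eq_bigr => i _.
by rewrite /= pFrobenius_autE exprZn !mxE.
Qed.

Section Cohomology.
Variables (U : lmodType K) (act : GL2 -> U -> U).

Definition cocycle (g : GL2 -> U) : Prop :=
  regular_map g /\ forall s t, g (s * t)%g = act s (g t) + g s.

Definition coboundary (g : GL2 -> U) : Prop :=
  exists v, forall s, g s = act s v - v.

Definition H1_nontrivial (g : GL2 -> U) : Prop :=
  cocycle g /\ ~ coboundary g.

End Cohomology.

Definition annihilates (V : gmodule) (f : {mpoly K[gdim (gdual V)]})
    (g : GL2 -> {mpoly K[gdim (gdual V)]}) : Prop :=
  coboundary (@coord_act V) (fun s => f * g s).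

End GL2.

Arguments giso {K} M N.
Arguments invariant_ring {K} V f.

(* Graded subalgebras R of a polynomial ring, as predicates.  A finite    *)
(* set of elements of R is given by a sequence enumerating it.            *)

Section Graded.
Variables (K : fieldType) (n : nat).
Implicit Types (R : {mpoly K[n]} -> Prop) (s t : seq {mpoly K[n]}).

(* Algebraic independence excludes the constants, so homogeneous          *)
(* elements of an hsop automatically have positive degree.                *)
Definition alg_independent s : Prop :=
  forall P : {mpoly K[size s]}, P \mPo in_tuple s = 0 -> P = 0.

Definition generated s (f : {mpoly K[n]}) : Prop :=
  exists P : {mpoly K[size s]}, f = P \mPo in_tuple s.

(* f is the combination of the b_i with coefficients c_i in K[s]. *)
Definition combination_of s k (b c : 'I_k -> {mpoly K[n]}) f : Prop :=
  (forall i, generated s (c i)) /\ f = \sum_(i < k) c i * b i.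

Definition finite_over R s : Prop :=
  exists (k : nat) (b : 'I_k -> {mpoly K[n]}),
    (forall i, R (b i)) /\
    (forall f, R f -> exists c, combination_of s b c f).

(* R has a (possibly infinite) basis B as a module over K[s]. *)
Definition free_over R s : Prop :=
  exists B : {mpoly K[n]} -> Prop,
    [/\ forall f, B f -> R f,
        forall f, R f -> exists (k : nat) (b c : 'I_k -> {mpoly K[n]}),
          (forall i, B (b i)) /\ combination_of s b c f &
        forall (k : nat) (b c : 'I_k -> {mpoly K[n]}),
          injective b -> (forall i, B (b i)) -> combination_of s b c 0 ->
          forall i, c i = 0].

Definition hsop R s : Prop :=
  [/\ forall f, f \in s -> R f /\ exists d : nat, f \is d.-homog,
      alg_independent s & finite_over R s].

Definition partial_hsop R s : Prop := exists t, hsop R (s ++ t).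

Definition Cohen_Macaulay R : Prop := exists s, hsop R s /\ free_over R s.

End Graded.

Section Example.
Variables (K : fieldType) (hK : 2%N \in [pchar K]).

Definition W0 : gmodule K := gtens (gsq hK) (gdetV K).
Definition Wi : gmodule K := gsum (gnat K) (gdual (gnat K)).
Definition Wi' : gmodule K := gsum (gnat K) (gtens (gnat K) (gdetV K)).

Definition Vstar : gmodule K := gsum W0 (gsum Wi Wi).
Definition Vstar' : gmodule K := gsum W0 (gsum Wi' Wi').

(* gdual V is Vstar by gdualK. *)
Definition V : gmodule K := gdual Vstar.

(* The inclusion of the first summand of Vstar in K[V]_1. *)
Definition in_W0 (v : 'cV[K]_(gdim W0)) : {mpoly K[gdim (gdual V)]} :=
  glin (M := gdual V) (col_mx v (0 : 'cV_(gdim (gsum Wi Wi)))).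

(* Position in the basis of Vstar of the k-th basis vector of the i-th    *)
(* copy of Wi; the copies are numbered 0 and 1.                           *)
Definition pos (i : 'I_2) (k : 'I_(gdim Wi)) : 'I_(gdim (gdual V)) :=
  rshift (gdim W0)
    (if i == 0 then lshift (gdim Wi) k else rshift (gdim Wi) k).

Definition varX (i : 'I_2) : {mpoly K[gdim (gdual V)]} :=
  'X_(pos i (lshift 2 (0 : 'I_2))).
Definition varY (i : 'I_2) : {mpoly K[gdim (gdual V)]} :=
  'X_(pos i (lshift 2 (1 : 'I_2))).
Definition varXs (i : 'I_2) : {mpoly K[gdim (gdual V)]} :=
  'X_(pos i (rshift 2 (0 : 'I_2))).
Definition varYs (i : 'I_2) : {mpoly K[gdim (gdual V)]} :=
  'X_(pos i (rshift 2 (1 : 'I_2))).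

End Example.

(* Main.v *)
From HB Require Import structures.
Require Import Defs.
From mathcomp Require Import all_boot all_order all_fingroup all_algebra.
From mathcomp Require Import mxtens mpoly ring zify.
From Stdlib Require Import Classical.
Import GRing.Theory.
Local Open Scope ring_scope.
Set Implicit Arguments.
Unset Strict Implicit.
Unset Printing Implicit Defensive.

(** Write [v0], [v1] for the vectors [(X_i, Y_i)], and [w0], [w1] for the
    vectors obtained from the dual ones by the rotation that makes the pairing
    [q i j = X_i X_j^* + Y_i Y_j^*] the bracket of [v_i] and [w_j].  Let
    [Z = (Z0, Z1)] be the variables of the first summand.

    The cocycle is [s |-> (s - 1) theta], where [theta] is the product [XY] of
    the second symmetric power, twisted by the inverse of the determinant; this
    product lies outside the span of the squares, and in characteristic 2 it is
    fixed modulo that span.  Modelling [theta] by a square root of [Z0 Z1], the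
    elements [N i j = U i j + q i j theta] are invariant for
    [U i j = Z0 Y_i X_j^* + Z1 X_i Y_j^*], so that [U i j] is a primitive of
    [q i j] times the cocycle: every [q i j] annihilates it ([U_cocycle]).  It
    is not itself a coboundary ([cocycle_g_nontrivial]).

    The invariant ring [R] is controlled by the algebra [C] generated by the
    [q i j] and [N i j].  Square roots of [Z0], [Z1] form a fifth vector, and
    [N i j] is the product of its brackets with [v_i] and [w_j].  The first
    fundamental theorem for SL_2, proved for five vectors by letting two vectors
    coincide ([sl2_first_fundamental]), and the action of the scalar matrices
    show that [R] lies in [C] ([invariant_inC]).

    The relations [N00 N11 = N01 N10] and
    [q00 N11 + q11 N00 + q01 N10 + q10 N01 = 0] make [C] integral over the
    subalgebra generated by [q00], [q11], [q01] and three elements of degree 6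
    ([C_finite]).  By Hilbert's basis theorem [R] is then a finite module over
    it ([invariants_finite]).  As [C] has dimension at least six
    ([six_indepP]), these six elements are independent by Noether
    normalization: they form a homogeneous system of parameters that begins
    with the three given invariants ([hsop6_hsop]).

    Suppose that [R] is free over a polynomial algebra [P] on a homogeneous
    system of parameters.  Then [P] has at least six variables.  Let [J] be the
    ideal of [R] generated by the [q i j].  Modulo the [q i j] the algebra [C]
    becomes that of a quadric cone, of dimension three; since the square of an
    element of [C] is an invariant, any four elements of [R] satisfy a
    polynomial relation modulo [J] ([dependent_mod_ideal]).  Hence [J] meets [P]
    in an ideal that contains a regular sequence [f1], [f2], [f3] of [P]
    ([regular_triple]), which is regular on [R] by freeness.  Let [u_k] be
    primitives of [f_k] times the cocycle.  The invariants
    [f_k u_l - f_l u_k] satisfy the Koszul relation, so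
    [f1 u2 - f2 u1 = f1 h2 - f2 h1] for some invariants [h1], [h2].  The same
    quotient [(u1 - h1) / f1] is then, up to invariants, a quotient of [U i j] by
    [q i j] for all [i], [j]; as [q00] and [q11] have no common factor
    ([quadric_dvd]), it is a polynomial.  It is a primitive of the cocycle, a
    contradiction ([not_free]). *)

(** Substitution of a family of polynomials indexed by a function instead of
    the tuple of [comp_mpoly]. *)
Local Notation psub y := (mmap (@mpolyC _ _) y).

(** * Polynomials as functions *)


Lemma mpoly_ring_ind n (R : comNzRingType) (P : {mpoly R[n]} -> Prop) :
  (forall c, P c%:MP) -> (forall i, P 'X_i) ->
  (forall p q, P p -> P q -> P (p + q)) ->
  (forall p q, P p -> P q -> P (p * q)) -> forall p, P p.
Proof.
move=> hC hX hD hM; elim/mpolyind => [|c m p _ _ hp]; first exact: (hC 0).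
apply: hD hp; rewrite -mul_mpolyC; apply: (hM) => //; rewrite mpolyXE_id.
apply: big_ind; [exact: (hC 1) | by move=> *; apply: (hM) | move=> i _].
elim: (m i) => [|k ih]; first exact: (hC 1).
by rewrite exprS; apply: hM.
Qed.

Lemma mpoly_rmorph_ext n (R : comNzRingType) (S : nzRingType)
    (f g : {rmorphism {mpoly R[n]} -> S}) :
  (forall c, f c%:MP = g c%:MP) -> (forall i, f 'X_i = g 'X_i) -> f =1 g.
Proof.
move=> hC hX; elim/mpoly_ring_ind => // p q hp hq.
- by rewrite !rmorphD hp hq.
- by rewrite !rmorphM hp hq.
Qed.

Lemma mmapXU n (R S : comNzRingType) (f : {rmorphism R -> S}) (h : 'I_n -> S) i :
  mmap f h 'X_i = h i.
Proof. by rewrite mmapX mmap1U. Qed.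

Section Substitution.
Variable K : fieldType.

Lemma psub_eq n k (y z : 'I_n -> {mpoly K[k]}) : y =1 z -> psub y =1 psub z.
Proof.
move=> e; apply: mpoly_rmorph_ext => [c|i] /=; first by rewrite !mmapC.
by rewrite !mmapXU.
Qed.

Lemma psub_comp n k l (y : 'I_n -> {mpoly K[k]}) (z : 'I_k -> {mpoly K[l]}) P :
  psub z (psub y P) = psub (fun i => psub z (y i)) P.
Proof.
elim/mpoly_ring_ind: P => [c|i|p q hp hq|p q hp hq]; rewrite ?mmapC ?mmapXU //.
- by rewrite !rmorphD /= hp hq.
- by rewrite !rmorphM /= hp hq.
Qed.

Lemma meval_psub n k (y : 'I_n -> {mpoly K[k]}) P (v : 'I_k -> K) :
  (psub y P).@[v] = P.@[fun i => (y i).@[v]].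
Proof.
elim/mpoly_ring_ind: P => [c|i|p q hp hq|p q hp hq].
- by rewrite mmapC !mevalC.
- by rewrite mmapXU mevalXU.
- by rewrite !mevalD -hp -hq rmorphD /= mevalD.
- by rewrite !mevalM -hp -hq rmorphM /= mevalM.
Qed.

Lemma comp_psub n k (lq : n.-tuple {mpoly K[k]}) P :
  P \mPo lq = psub (tnth lq) P.
Proof. by []. Qed.

Lemma psub_id n (P : {mpoly K[n]}) : psub (fun i => 'X_i) P = P.
Proof.
elim/mpoly_ring_ind: P => [c|i|p q hp hq|p q hp hq]; rewrite ?mmapC ?mmapXU //.
- by rewrite rmorphD /= hp hq.
- by rewrite rmorphM /= hp hq.
Qed.

(** Gives access to limits at [t = 0] through polynomials in one variable. *)
Lemma line_poly n (f : {mpoly K[n]}) (u v : 'I_n -> K) :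
  exists p : {poly K}, forall t, p.[t] = f.@[fun i => u i + t * v i].
Proof.
elim/mpoly_ring_ind: f => [c|i|f g [p hp] [q hq]|f g [p hp] [q hq]].
- by exists c%:P => t; rewrite hornerC mevalC.
- exists ((u i)%:P + (v i)%:P * 'X) => t.
  by rewrite mevalXU !hornerE mulrC.
- by exists (p + q) => t; rewrite hornerD mevalD hp hq.
- by exists (p * q) => t; rewrite hornerM mevalM hp hq.
Qed.

Definition first_var n : {mpoly K[n.+1]} -> {poly {mpoly K[n]}} :=
  mmap (polyC \o @mpolyC n K)
    (fun i => if unlift ord0 i is Some j then ('X_j)%:P else 'X).
HB.instance Definition _ n := GRing.RMorphism.on (@first_var n).

Definition unfirst_var n : {poly {mpoly K[n]}} -> {mpoly K[n.+1]} :=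
  horner_eval 'X_ord0 \o map_poly (psub (fun j => 'X_(lift ord0 j))).
HB.instance Definition _ n := GRing.RMorphism.on (@unfirst_var n).

Lemma first_varK n : cancel (@first_var n) (@unfirst_var n).
Proof.
move=> f; pose h := unfirst_var (n := n) \o first_var (n := n).
rewrite -[RHS]/(idfun f) -[LHS]/(h f).
move: f; apply: mpoly_rmorph_ext => [c|i] /=; rewrite /h /= /unfirst_var /first_var /=.
  by rewrite mmapC /= map_polyC /= mmapC horner_evalE hornerC.
rewrite mmapXU; case: unliftP => [j ->|->]; rewrite horner_evalE.
  by rewrite map_polyC /= mmapXU hornerC.
by rewrite map_polyX hornerX.
Qed.

Lemma unfirst_varK n : cancel (@unfirst_var n) (@first_var n).
Proof.
have XC (P : {mpoly K[n]}) : first_var (psub (fun j => 'X_(lift ord0 j)) P) = P%:P.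
  elim/mpoly_ring_ind: P => [c|i|p q hp hq|p q hp hq].
  - by rewrite mmapC /first_var mmapC.
  - by rewrite mmapXU /first_var mmapXU liftK.
  - by rewrite rmorphD /= rmorphD /= hp hq rmorphD.
  - by rewrite rmorphM /= rmorphM /= hp hq rmorphM.
elim/poly_ind => [|p c ih]; first by rewrite !rmorph0.
rewrite rmorphD rmorphM rmorphD rmorphM /= ih; congr (_ * _ + _).
  by rewrite /unfirst_var /= map_polyX horner_evalE hornerX /first_var mmapXU unlift_none.
by rewrite /unfirst_var /= map_polyC horner_evalE hornerC XC.
Qed.

Lemma meval_first_var n (f : {mpoly K[n.+1]}) (v : 'I_n.+1 -> K) :
  f.@[v] = (map_poly (meval (fun j => v (lift ord0 j))) (first_var f)).[v ord0].
Proof.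
elim/mpoly_ring_ind: f => [c|i|p q hp hq|p q hp hq].
- by rewrite /first_var mmapC /= map_polyC /= hornerC !mevalC.
- rewrite mevalXU /first_var mmapXU; case: unliftP => [j ->|->].
    by rewrite map_polyC /= hornerC mevalXU.
  by rewrite map_polyX hornerX.
- by rewrite mevalD hp hq (rmorphD (@first_var n)) rmorphD hornerD.
- by rewrite mevalM hp hq (rmorphM (@first_var n)) rmorphM hornerM.
Qed.

End Substitution.

Section Infinite.
Variable K : closedFieldType.

(** An algebraically closed field is infinite, so a nonzero polynomial is
    nonzero somewhere. *)
Lemma mpoly_nonroot n (f : {mpoly K[n]}) : f != 0 -> exists v, f.@[v] != 0.
Proof.
elim: n f => [|n ih] f nz.
  exists (fun=> 0); apply: contra nz => /eqP h.
  have e : f = (f@_0)%:MP.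
    by apply/mpolyP => m; rewrite mcoeffC [m](_ : _ = 0%MM) ?eqxx ?mulr1 //; apply/mnmP; case.
  by rewrite e in h *; rewrite mevalC in h; rewrite h.
have nz' : first_var f != 0.
  by rewrite -(inj_eq (can_inj (@first_varK K n))) rmorph0 in nz.
have [w hw] : exists w, (lead_coef (first_var f)).@[w] != 0.
  by apply: ih; rewrite lead_coef_eq0.
have nz2 : map_poly (meval w) (first_var f) != 0.
  apply: contra hw => /eqP /(congr1 (fun p : {poly K} => p`_(size (first_var f)).-1)).
  by rewrite coef_map coef0 /= => <-.
have /closed_nonrootP [x hx] := nz2.
exists (fun i => if unlift ord0 i is Some j then w j else x).
rewrite meval_first_var unlift_none.
rewrite (_ : map_poly _ _ = map_poly (meval w) (first_var f)) //.
apply/polyP => i; rewrite !coef_map; apply: meval_eq => j.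
by rewrite /= liftK.
Qed.

Lemma mpoly_fun0 n (f : {mpoly K[n]}) : (forall v, f.@[v] = 0) -> f = 0.
Proof.
move=> h; apply/eqP; apply: contraT => /mpoly_nonroot [v].
by rewrite h eqxx.
Qed.

Lemma mpoly_fun_inj n (f g : {mpoly K[n]}) : (forall v, f.@[v] = g.@[v]) -> f = g.
Proof.
by move=> h; apply/eqP; rewrite -subr_eq0; apply/eqP/mpoly_fun0 => v; rewrite mevalB h subrr.
Qed.

(** The product of [f - g] by [D] vanishes everywhere. *)
Lemma mpoly_fun_dense n (D f g : {mpoly K[n]}) : D != 0 ->
  (forall v, D.@[v] != 0 -> f.@[v] = g.@[v]) -> f = g.
Proof.
move=> nz h; apply: (mulfI nz); apply: mpoly_fun_inj => v; rewrite !mevalM.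
by have [->|/h ->] := eqVneq D.@[v] 0; rewrite ?mul0r.
Qed.

Lemma poly_nz_const (p : {poly K}) c : (forall t, t != 0 -> p.[t] = c) -> p.[0] = c.
Proof.
move=> h; have : 'X * (p - c%:P) = 0.
  apply/eqP; apply: contraT => /closed_nonrootP [x].
  rewrite rootE !hornerE; have [->|/h ->] := eqVneq x 0; rewrite ?mul0r ?eqxx //.
  by rewrite subrr mulr0 eqxx.
move/eqP; rewrite mulf_eq0 polyX_eq0 /= subr_eq0 => /eqP ->.
by rewrite hornerC.
Qed.

End Infinite.

(** * Finitely generated modules *)

Section Span.
Variables (A T : comNzRingType) (phi : {rmorphism A -> T}).

(** Recursion on the list of generators gives the closure properties by
    induction; [aspanE] is the usual form. *)
Fixpoint aspan (b : seq T) (f : T) : Prop :=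
  if b is x :: b' then exists p, aspan b' (f - phi p * x) else f = 0.

Lemma aspan0 b : aspan b 0.
Proof. by elim: b => //= x b ih; exists 0; rewrite rmorph0 mul0r subrr. Qed.

Lemma aspanD b f g : aspan b f -> aspan b g -> aspan b (f + g).
Proof.
elim: b f g => [|x b ih] f g /=; first by move=> -> ->; rewrite addr0.
move=> [p hp] [q hq]; exists (p + q); rewrite rmorphD /= mulrDl opprD addrACA.
exact: ih.
Qed.

Lemma aspanZ b a f : aspan b f -> aspan b (phi a * f).
Proof.
elim: b f => [|x b ih] f /=; first by move=> ->; rewrite mulr0.
by move=> [p hp]; exists (a * p); rewrite rmorphM -mulrA -mulrBr; apply: ih.
Qed.

Lemma aspanB b f g : aspan b f -> aspan b g -> aspan b (f - g).
Proof.
by move=> hf hg; apply: aspanD hf _; rewrite -mulN1r -(rmorph1 phi) -rmorphN; apply: aspanZ.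
Qed.

Lemma aspan_mem b f : f \in b -> aspan b f.
Proof.
elim: b f => //= x b ih f; rewrite inE => /orP[/eqP->|h].
  by exists 1; rewrite rmorph1 mul1r subrr; apply: aspan0.
by exists 0; rewrite rmorph0 mul0r subr0; apply: ih.
Qed.

Lemma aspan_sum (I : eqType) (r : seq I) b (F : I -> T) :
  (forall i, i \in r -> aspan b (F i)) -> aspan b (\sum_(i <- r) F i).
Proof.
elim: r => [|i r ih] h; first by rewrite big_nil; apply: aspan0.
rewrite big_cons; apply: aspanD; first by apply: h; rewrite mem_head.
by apply: ih => j hj; apply: h; rewrite inE hj orbT.
Qed.

Lemma aspanE b f : aspan b f <->
  exists c : 'I_(size b) -> A, f = \sum_(i < size b) phi (c i) * b`_i.
Proof.
split.
  elim: b f => [|x b ih] f /=; first by move=> ->; exists (fun=> 0); rewrite big_ord0.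
  move=> [p /ih [c e]].
  exists (fun i => if unlift ord0 i is Some j then c j else p).
  rewrite big_ord_recl unlift_none /= -(subrK (phi p * x) f) addrC e; congr (_ + _).
  by apply: eq_bigr => i _; rewrite liftK.
move=> [c ->]; apply: aspan_sum => i _; apply: aspanZ.
by apply: aspan_mem; apply: mem_nth.
Qed.

Lemma aspan_trans b b' f :
  aspan b f -> (forall x, x \in b -> aspan b' x) -> aspan b' f.
Proof.
move/aspanE => [c ->] h; apply: aspan_sum => i _; apply: aspanZ.
by apply: h; apply: mem_nth.
Qed.

Definition submodule (M : T -> Prop) :=
  [/\ M 0, forall f g, M f -> M g -> M (f + g) & forall a f, M f -> M (phi a * f)].

Definition fin_gen (M : T -> Prop) :=
  exists L : seq T, (forall x, x \in L -> M x) /\ forall f, M f -> aspan L f.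

Lemma submoduleB M f g : submodule M -> M f -> M g -> M (f - g).
Proof.
by case=> _ hD hZ hf hg; apply: hD hf _; rewrite -mulN1r -(rmorph1 phi) -rmorphN; apply: hZ.
Qed.

End Span.

Definition noetherian (A : comNzRingType) :=
  forall M, submodule (idfun : {rmorphism A -> A}) M -> fin_gen (idfun : {rmorphism A -> A}) M.

Lemma list_choice (S T : eqType) (r : seq S) (P : S -> T -> Prop) :
  (forall x, x \in r -> exists y, P x y) ->
  exists L : seq T, (forall y, y \in L -> exists2 x, x \in r & P x y) /\
    forall x, x \in r -> exists2 y, y \in L & P x y.
Proof.
elim: r => [|x r ih] h; first by exists [::].
have [|L [h1 h2]] := ih; first by move=> z hz; apply: h; rewrite inE hz orbT.
have [y hy] := h x (mem_head _ _); exists (y :: L); split.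
  move=> z; rewrite inE => /orP[/eqP->|/h1 [w hw hz]]; first by exists x; rewrite ?mem_head.
  by exists w; rewrite ?inE ?hw ?orbT.
move=> z; rewrite inE => /orP[/eqP->|/h2 [w hw hz]]; first by exists y; rewrite ?mem_head.
by exists w; rewrite ?inE ?hw ?orbT.
Qed.

(** Generators of the ideal of coefficients along the first
    generator of the ambient module, lifted to the submodule, and generators
    of the part of the submodule that does not involve it. *)
Lemma noetherian_submodule (A T : comNzRingType) (phi : {rmorphism A -> T})
    (b : seq T) (M : T -> Prop) :
  noetherian A -> submodule phi M -> (forall f, M f -> aspan phi b f) ->
  fin_gen phi M.
Proof.
move=> hA; elim: b M => [|x b ih] M hM hb.
  by exists [::]; split=> // f /hb.
pose J p := exists2 f, M f & aspan phi b (f - phi p * x).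
have [h0 hD hZ] := hM.
have hJ : submodule (idfun : {rmorphism A -> A}) J.
  split.
  - by exists 0 => //; rewrite rmorph0 mul0r subrr; apply: aspan0.
  - move=> p q [f hf ef] [g hg eg]; exists (f + g); first exact: hD.
    by rewrite rmorphD mulrDl opprD addrACA; apply: aspanD.
  - move=> a p [f hf ef]; exists (phi a * f); first exact: hZ.
    by rewrite rmorphM /= -mulrA -mulrBr; apply: aspanZ.
have [P [hP1 hP2]] := hA _ hJ.
have [F [hF1 hF2]] := list_choice (P := fun p f => M f /\ aspan phi b (f - phi p * x))
  (fun p hp => let: ex_intro2 f h1 h2 := hP1 p hp in ex_intro _ f (conj h1 h2)).
have [||L [hL1 hL2]] := ih (fun f => M f /\ aspan phi b f).
- split; first by split=> //; apply: aspan0.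
    by move=> f g [? ?] [? ?]; split; [apply: hD | apply: aspanD].
  by move=> a f [? ?]; split; [apply: hZ | apply: aspanZ].
- by move=> f [].
have sL g : aspan phi L g -> aspan phi (F ++ L) g.
  by move/aspan_trans; apply=> y hy; apply: aspan_mem; rewrite mem_cat hy orbT.
have sF y : y \in F -> aspan phi (F ++ L) y.
  by move=> hy; apply: aspan_mem; rewrite mem_cat hy.
have F_M y : y \in F -> M y by move=> /hF1 [p _ []].
exists (F ++ L); split.
  by move=> y; rewrite mem_cat => /orP[/F_M | /hL1 []].
move=> f hf; have [p hp] := hb f hf.
have {}hp' : J p by exists f.
have /aspanE [c ec] := hP2 _ hp'.
suff [g [hg1 hg2 hg3]] : exists g, [/\ M g, aspan phi (F ++ L) g & aspan phi b (g - phi p * x)].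
  rewrite -(subrK g f); apply: aspanD hg2; apply/sL/hL2; split; first exact: submoduleB hM hf hg1.
  have -> : f - g = (f - phi p * x) - (g - phi p * x) by rewrite opprB addrA subrK.
  exact: aspanB.
rewrite {hp hp'}ec; apply: (big_ind (fun p => exists g, [/\ M g, aspan phi (F ++ L) g & aspan phi b (g - phi p * x)])).
- by exists 0; rewrite rmorph0 mul0r subrr; split=> //; apply: aspan0.
- move=> p1 p2 [g1 [? ? ?]] [g2 [? ? ?]]; exists (g1 + g2); split; [exact: hD|exact: aspanD|].
  by rewrite rmorphD mulrDl opprD addrACA; apply: aspanD.
- move=> i _; have [g hg [h1 h2]] := hF2 _ (mem_nth 0 (ltn_ord i)).
  exists (phi (c i) * g); split; [exact: hZ | by apply/aspanZ/sF |].
  by rewrite rmorphM /= -mulrA -mulrBr; apply: aspanZ.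
Qed.

(** Induction on the number of coordinates that vary: an exponent that is not
    above a given [m0] has a coordinate among finitely many values. *)
Lemma dickson n (P : 'X_{1..n} -> Prop) : exists L : seq 'X_{1..n},
  (forall l, l \in L -> P l) /\ forall m, P m -> exists2 l, l \in L & (l <= m)%MM.
Proof.
pose good (P : 'X_{1..n} -> Prop) := exists L : seq 'X_{1..n},
  (forall l, l \in L -> P l) /\ forall m, P m -> exists2 l, l \in L & (l <= m)%MM.
have good_union (S : eqType) (r : seq S) (Q : S -> 'X_{1..n} -> Prop) :
    (forall t, t \in r -> good (Q t)) -> good (fun m => exists2 t, t \in r & Q t m).
  elim: r => [|t r ih] h; first by exists [::]; split=> // m [].
  have [L1 [h1 h1']] := h t (mem_head _ _).
  have [|L2 [h2 h2']] := ih; first by move=> u hu; apply: h; rewrite inE hu orbT.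
  exists (L1 ++ L2); split=> [l|m [u]].
    rewrite mem_cat => /orP[/h1 ?|/h2 [u hu ?]]; first by exists t; rewrite ?mem_head.
    by exists u; rewrite // inE hu orbT.
  rewrite inE => /orP[/eqP->|hu] hm.
    by have [l hl le] := h1' _ hm; exists l; rewrite // mem_cat hl.
  by have [|l hl le] := h2' m; [exists u | exists l; rewrite // mem_cat hl orbT].
suff : forall k (F : {set 'I_n}) (Q : 'X_{1..n} -> Prop), (#|~: F| <= k)%N ->
    (forall m m', Q m -> Q m' -> forall i, i \in F -> m i = m' i) -> good Q.
  move=> main; refine (main n set0 P _ _) => [|m m' _ _ i]; last by rewrite inE.
  by rewrite -[leqRHS]card_ord max_card.
elim=> [|k ih] F Q hk hQ.
  have [[m0 h0]|no] := classic (exists m, Q m); last first.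
    by exists [::]; split=> // m hm; case: no; exists m.
  exists [:: m0]; split=> [l|m hm]; first by rewrite inE => /eqP->.
  exists m0; first by rewrite mem_head.
  apply/mnm_lepP => i; rewrite (hQ m0 m) //.
  by move: hk; rewrite leqn0 cards_eq0 => /eqP e; apply: contraT; rewrite -in_setC e inE.
have [[m0 h0]|no] := classic (exists m, Q m); last first.
  by exists [::]; split=> // m hm; case: no; exists m.
pose r := [seq (i, v) | i <- enum 'I_n, v <- iota 0 (mdeg m0)].
have [|L [h1 h2]] := good_union _ r (fun t m => [/\ Q m, t.1 \notin F & m t.1 = t.2]).
  move=> [i v] _ /=; have [iF|iF] := boolP (i \in F).
    by exists [::]; split=> // m [].
  apply: (ih (i |: F)).
    rewrite setCU -ltnS; apply: leq_trans hk.
    by apply: proper_card; rewrite setIC; apply/properP; split; [apply: subsetIl | exists i; rewrite !inE ?eqxx ?andbF].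
  by move=> m m' [hm _ <-] [hm' _ e] j; rewrite !inE => /orP[/eqP->|]; [rewrite e | apply: hQ].
exists (m0 :: L); split=> [l|m hm]; first by rewrite inE => /orP[/eqP->//|/h1 [t _ []]].
have [le|/negP] := boolP (m0 <= m)%MM; first by exists m0; rewrite ?mem_head.
move=> nle; have [i hi] : exists i, (m i < m0 i)%N.
  apply/existsP; apply: contraT => /existsPn h; case: nle.
  by apply/mnm_lepP => i; rewrite leqNgt.
have [|l hl le] := h2 m; last by exists l; rewrite // inE hl orbT.
exists (i, m i); first by apply: allpairs_f; rewrite ?mem_enum // mem_iota /= add0n
  (leq_trans hi) // mdegE (bigD1 i) //= leq_addr.
split=> //; apply/negP => iF; by rewrite (hQ m m0) // ltnn in hi.
Qed.

(** Hilbert's basis theorem: by Dickson's lemma, finitely many leading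
    monomials of the ideal divide all the others. *)
Lemma mpoly_noetherian n (K : fieldType) : noetherian {mpoly K[n]}.
Proof.
move=> J hJ; have [h0 hD hZ] := hJ.
have [L0 [h1 h2]] := dickson (fun m => exists f, [/\ J f, f != 0 & mlead f = m]).
have [L [hL1 hL2]] := list_choice (P := fun m f => [/\ J f, f != 0 & mlead f = m]) h1.
exists L; split=> [x /hL1 [m _ []] //|].
elim/mleadrect => f ih hf; have [->|nz] := eqVneq f 0; first exact: aspan0.
have [|l hl le] := h2 (mlead f); first by exists f.
have [g hg [Jg nzg eg]] := hL2 _ hl.
pose c := (mleadc f / mleadc g) *: 'X_[mlead f - l] : {mpoly K[n]}.
have nzc : mleadc f / mleadc g != 0 by rewrite mulf_neq0 ?invr_eq0 ?mleadc_eq0.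
have nzX : ('X_[mlead f - l] : {mpoly K[n]}) != 0.
  by rewrite -mleadc_eq0 mleadXm mcoeffX eqxx oner_eq0.
have lc : mlead (c * g) = mlead f.
  by rewrite -scalerAl mleadZ // mleadM // mleadXm eg submK.
have cc : (c * g)@_(mlead f) = mleadc f.
  rewrite -{1}lc -scalerAl mleadcZE mleadM // mleadcM mleadXm mcoeffX eqxx mul1r.
  by rewrite divfK // mleadc_eq0.
rewrite -(subrK (c * g) f); apply: aspanD; last by apply: (@aspanZ _ _ idfun); apply: aspan_mem.
have [->|nz'] := eqVneq (f - c * g) 0; first exact: aspan0.
apply: ih; last by apply: (@submoduleB _ _ idfun) => //; apply: hZ.
rewrite Order.POrderTheory.lt_neqAle; apply/andP; split.
  apply/eqP => e; have := mlead_supp nz'; rewrite e mcoeff_msupp.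
  by rewrite mcoeffB cc subrr eqxx.
by apply: Order.POrderTheory.le_trans (mleadB_le _ _) _; rewrite lc Order.JoinTheory.joinxx.
Qed.

(** * Algebraic dependence by counting *)

Lemma fewer_equations (K : fieldType) (I J : finType) (A : I -> J -> K) :
  (#|J| < #|I|)%N ->
  exists v : I -> K, (exists i, v i != 0) /\ forall j, \sum_i v i * A i j = 0.
Proof.
move=> lt; pose M := \matrix_(i < #|I|, j < #|J|) A (enum_val i) (enum_val j).
have : kermx M != 0.
  rewrite kermx_eq0 /row_free; apply: contraTneq lt => <-.
  by rewrite -leqNgt rank_leq_col.
case/rowV0Pn => u /sub_kermxP uM nz.
exists (fun i => u 0 (enum_rank i)); split.
  have [i hi] : exists i, u 0 i != 0.
    apply/existsP; apply: contraT => /existsPn h; case/eqP: nz.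
    by apply/rowP => i; rewrite mxE; apply/eqP; move: (h i); rewrite negbK.
  by exists (enum_val i); rewrite enum_valK.
move=> j; have := congr1 (fun B : 'rV_ _ => B 0 (enum_rank j)) uM; rewrite !mxE => e0.
apply: etrans e0; rewrite (reindex _ (onW_bij _ (enum_val_bij I))).
by apply: eq_bigr => i _; rewrite mxE !enum_rankK enum_valK.
Qed.

Lemma card_bmultinom n d : (#|{: 'X_{1..n < d}}| <= d ^ n)%N.
Proof.
case: d => [|d].
  by rewrite eq_card0 // => m; have := bmdeg m; rewrite ltn0.
have <- : #|{: {ffun 'I_n -> 'I_d.+1}}| = (d.+1 ^ n)%N by rewrite card_ffun !card_ord.
apply: (@leq_card _ _ (fun m : 'X_{1..n < d.+1} => [ffun i => inord (m i)])).
move=> m m' /ffunP e; apply/val_inj/mnmP => i.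
have lt (u : 'X_{1..n < d.+1}) : (u i < d.+1)%N.
  by apply: leq_ltn_trans (bmdeg u); rewrite mdegE (bigD1 i) //= leq_addr.
by have := congr1 val (e i); rewrite !ffunE /= !inordK.
Qed.

Section Counting.
Variables (K : fieldType) (N n : nat) (t : 'I_n -> {mpoly K[N]}).
Local Notation T := {mpoly K[N]}.

Definition bounded_span k (b : 'I_k -> T) D (f : T) :=
  exists c : 'I_k -> {mpoly K[n]},
    (forall l, msize (c l) <= D)%N /\ f = \sum_l psub t (c l) * b l.

Lemma bounded_spanM k (b : 'I_k -> T) L D y f :
  (forall i, bounded_span b L (y * b i)) ->
  bounded_span b D f -> bounded_span b (D + L) (y * f).
Proof.
move=> hy [c [hc ->]].
have [Y hY] := fin_all_exists hy.
exists (fun l => \sum_i c i * Y i l); split=> [l|].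
  apply: leq_trans (msize_sum _ _ _) _; apply/bigmax_leqP => i _.
  have [->|nzc] := eqVneq (c i) 0; first by rewrite mul0r msize0.
  have [->|nzY] := eqVneq (Y i l) 0; first by rewrite mulr0 msize0.
  rewrite msizeM //; apply: leq_trans (leq_pred _) _; apply: leq_add; first exact: hc.
  by have [h _] := hY i; apply: h.
rewrite mulr_sumr.
under eq_bigr => i _.
  have [_ e] := hY i; rewrite mulrCA e mulr_sumr.
  over.
rewrite exchange_big /=; apply: eq_bigr => l _.
rewrite rmorph_sum /= mulr_suml; apply: eq_bigr => i _.
by rewrite rmorphM mulrA.
Qed.

Lemma bounded_span_monomial k (b : 'I_k -> T) m (y : 'I_m -> T) L :
  (forall j i, bounded_span b L (y j * b i)) -> bounded_span b L 1 ->
  forall (r : seq 'I_m) (e : 'I_m -> nat),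
  bounded_span b (L + (\sum_(j <- r) e j) * L) (\prod_(j <- r) y j ^+ e j).
Proof.
move=> hy h1; elim=> [|j r ih] e; first by rewrite !big_nil mul0n addn0.
rewrite !big_cons mulnDl addnCA; elim: (e j) => [|d IH]; first by rewrite expr0 mul1r mul0n add0n; exact: ih.
by rewrite exprS -mulrA mulSn -addnA [(L + _)%N]addnC; exact: bounded_spanM (hy j) IH.
Qed.

End Counting.

(** Let [T] be generated by [k] elements over the [n] elements [t].  There are
    [e ^ m] monomials in [y] with exponents below [e]; they lie in a space of
    dimension bounded by [k] times a polynomial of degree [n] in [e], so for
    [m > n] they cannot stay independent. *)
Lemma dependent_over_fewer (K : fieldType) N n m (t : 'I_n -> {mpoly K[N]})
    (b : seq {mpoly K[N]}) (y : 'I_m -> {mpoly K[N]}) :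
  (n < m)%N -> aspan (psub t) b 1 ->
  (forall j x, x \in b -> aspan (psub t) b (y j * x)) ->
  exists2 P : {mpoly K[m]}, P != 0 & psub y P = 0.
Proof.
move=> nm /aspanE [c1 e1] hy; set k := size b in c1 e1 *.
pose bb (i : 'I_k) := b`_i.
have hy' (ji : 'I_m * 'I_k) : exists c : 'I_k -> {mpoly K[n]},
    y ji.1 * bb ji.2 = \sum_(l < k) psub t (c l) * bb l.
  by apply/aspanE/hy/mem_nth.
have [Y hY] := fin_all_exists hy'.
pose L := maxn (\max_l msize (c1 l)) (\max_ji \max_l msize (Y ji l)).
have b1 : bounded_span t bb L 1.
  exists c1; split=> // l; rewrite leq_max; apply/orP; left.
  exact: (leq_bigmax (F := fun l => msize (c1 l))).
have bY j i : bounded_span t bb L (y j * bb i).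
  exists (Y (j, i)); split; last exact: (hY (j, i)).
  move=> l; rewrite leq_max; apply/orP; right.
  apply: leq_trans (leq_bigmax (F := fun ji => \max_l msize (Y ji l)) (j, i)).
  exact: (leq_bigmax (F := fun l => msize (Y (j, i) l))).
pose e := (k * (L + m * L).+1 ^ n).+1.
pose D := ((L + m * L).+1 * e)%N.
have bf (f : {ffun 'I_m -> 'I_e}) : exists c : 'I_k -> {mpoly K[n]},
    (forall l, msize (c l) <= D)%N /\ \prod_j y j ^+ f j = \sum_l psub t (c l) * bb l.
  have [c [hc ->]] := bounded_span_monomial bY b1 (index_enum _) (fun j => f j : nat).
  exists c; split=> // l; apply: leq_trans (hc l) _.
  rewrite /D mulSn mulnDl; apply: leq_trans (leq_addl _ _).
  apply: leq_add; first by rewrite leq_pmulr.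
  rewrite mulnAC leq_mul2r; apply/orP; right.
  rewrite -[X in (_ <= X * _)%N]card_ord -sum_nat_const; apply: leq_sum => j _.
  exact: ltnW.
have [C hC] := fin_all_exists bf.
have lt : (#|{: 'I_k * 'X_{1..n < D}}| < #|{: {ffun 'I_m -> 'I_e}}|)%N.
  rewrite card_prod card_ord card_ffun !card_ord.
  apply: leq_ltn_trans (leq_mul (leqnn k) (card_bmultinom n D)) _.
  rewrite expnMn mulnA; apply: (@leq_trans (e * e ^ n)); last first.
    by rewrite -expnS leq_pexp2l.
  by rewrite ltn_mul2r expn_gt0 /= /e ltnS.
have [v [[f0 nz] hv]] := fewer_equations
  (fun (f : {ffun 'I_m -> 'I_e}) (u : 'I_k * 'X_{1..n < D}) => (C f u.1)@_u.2) lt.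
pose mon (f : {ffun 'I_m -> 'I_e}) : 'X_{1..m} := [multinom (f i : nat) | i < m].
exists (\sum_f v f *: 'X_[mon f]).
  apply: contra nz => /eqP /(congr1 (mcoeff (mon f0))); rewrite mcoeff0 linear_sum /=.
  rewrite (bigD1 f0) //= mcoeffZ mcoeffX eqxx mulr1 big1 ?addr0 => [->//|f nf].
  rewrite mcoeffZ mcoeffX; case: eqP => [E|]; last by rewrite mulr0.
  case/eqP: nf; apply/ffunP => i; apply/val_inj.
  by have /mnmP /(_ i) := E; rewrite !mnmE.
rewrite rmorph_sum /=.
have step f : psub y (v f *: 'X_[mon f]) =
    \sum_(u : 'I_k * 'X_{1..n < D}) (v f * (C f u.1)@_u.2) *: (bb u.1 * psub t 'X_[u.2]).
  rewrite mmapZ mmapX (_ : mmap1 y _ = \prod_j y j ^+ f j); last first.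
    by apply: eq_bigr => j _; rewrite mnmE.
  have [hs ->] := hC f.
  rewrite mul_mpolyC -(pair_bigA _ (fun (l : 'I_k) (u : 'X_{1..n < D}) => (v f * (C f l)@_u) *: (bb l * psub t 'X_[u]))) /=.
  rewrite scaler_sumr; apply: eq_bigr => l _.
  rewrite {1}(mpolywE (hs l)) rmorph_sum /= mulr_suml scaler_sumr.
  apply: eq_bigr => u _.
  by rewrite mmapZ mul_mpolyC -scalerAl scalerA [_ * bb l]mulrC.
under eq_bigr => f _ do rewrite step.
rewrite exchange_big big1 //= => u _.
by rewrite -scaler_suml hv scale0r.
Qed.

(** * Noether normalization *)

Section Noether.
Variable K : closedFieldType.

Lemma top_coefM (A : comNzRingType) d e (p q : {poly A}) :
  (size p <= d.+1)%N -> (size q <= e.+1)%N ->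
  (size (p * q)%R <= (d + e).+1)%N /\ (p * q)`_(d + e) = p`_d * q`_e.
Proof.
move=> hp hq; split.
  by apply: leq_trans (size_polyMleq _ _) _; move: hp hq; lia.
rewrite coefM (bigD1 (inord d)) //= inordK; last by lia.
rewrite addKn big1 ?addr0 // => i ni.
have [lt|ge] := ltnP i d.
  by rewrite [X in _ * X]nth_default ?mulr0 //; apply: leq_trans hq _; lia.
rewrite [X in X * _]nth_default ?mul0r //; apply: leq_trans hp _.
have : (i != d :> nat) by apply: contra ni => /eqP e'; apply/eqP/val_inj; rewrite /= inordK; lia.
by lia.
Qed.

Lemma top_coefX (A : comNzRingType) (h a : A) k :
  (size ((h%:P + a *: 'X) ^+ k)%R <= k.+1)%N /\ ((h%:P + a *: 'X) ^+ k)`_k = a ^+ k.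
Proof.
elim: k => [|k [ih1 ih2]]; first by rewrite !expr0 size_poly1 coef1.
have h1 : (size (h%:P + a *: 'X)%R <= 2)%N.
  rewrite (leq_trans (size_polyD _ _)) // geq_max (leq_trans (size_polyC_leq1 _)) //.
  by rewrite (leq_trans (size_scale_leq _ _)) // size_polyX.
have [s1 s2] := top_coefM h1 ih1; rewrite exprS -add1n; split=> //.
by rewrite s2 ih2 coefD coefC coefZ coefX /= add0r mulr1 exprS.
Qed.

(** After the linear change of variables adapted to a point [v] where the top
    homogeneous part of [F] does not vanish, [F] becomes monic, up to a
    constant, in the first variable. *)
Lemma noether_change n (F : {mpoly K[n.+1]}) : F != 0 ->
  exists (Psi : {rmorphism {mpoly K[n.+1]} -> {poly {mpoly K[n]}}})
         (Theta : {rmorphism {poly {mpoly K[n]}} -> {mpoly K[n.+1]}}) (c : K),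
  [/\ cancel Psi Theta, cancel Theta Psi, forall a, Psi a%:MP = (a%:MP)%:P, c != 0 &
      Psi (c%:MP * F) \is monic].
Proof.
move=> nz; pose d := mdeg (mlead F).
pose G := \sum_(m <- msupp F | mdeg m == d) F@_m *: 'X_[m].
have nzG : G != 0.
  apply: contra (nz) => /eqP /(congr1 (mcoeff (mlead F))).
  rewrite mcoeff0 /G linear_sum /= big_mkcond (bigD1_seq (mlead F)) ?msupp_uniq ?(mlead_supp nz) //=.
  rewrite eqxx mcoeffZ mcoeffX eqxx mulr1 big1 ?addr0 => [/eqP|m /negbTE nm].
    by rewrite mleadc_eq0.
  by case: ifP => // _; rewrite mcoeffZ mcoeffX nm mulr0.
have nzX : ('X_ord0 : {mpoly K[n.+1]}) != 0.
  by apply/eqP => /(congr1 (meval (fun=> 1))); rewrite mevalXU meval0 => /eqP; rewrite oner_eq0.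
have [v] := mpoly_nonroot (mulf_neq0 nzG nzX).
rewrite mevalM mevalXU mulf_eq0 negb_or => /andP[Gv v0].
pose tau (i : 'I_n.+1) : {mpoly K[n.+1]} :=
  if unlift ord0 i is Some j then 'X_i + (v i)%:MP * 'X_ord0 else (v ord0)%:MP * 'X_ord0.
pose tau' (i : 'I_n.+1) : {mpoly K[n.+1]} :=
  if unlift ord0 i is Some j then 'X_i - (v i / v ord0)%:MP * 'X_ord0
  else (v ord0)^-1%:MP * 'X_ord0.
have tau'K P : psub tau' (psub tau P) = P.
  rewrite psub_comp -[RHS]psub_id; apply: psub_eq => i.
  have t0 : tau' ord0 = (v ord0)^-1%:MP * 'X_ord0 by rewrite /tau' unlift_none.
  rewrite {1}/tau; case: unliftP => [j ->|->].
    rewrite rmorphD rmorphM /= mmapC !mmapXU t0 mulrA -mpolyCM.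
    by rewrite /tau' liftK subrK.
  by rewrite rmorphM /= mmapC mmapXU t0 mulrA -mpolyCM divff // mul1r.
have tauK P : psub tau (psub tau' P) = P.
  rewrite psub_comp -[RHS]psub_id; apply: psub_eq => i.
  have t0 : tau ord0 = (v ord0)%:MP * 'X_ord0 by rewrite /tau unlift_none.
  rewrite {1}/tau'; case: unliftP => [j ->|->].
    rewrite rmorphB rmorphM /= mmapC !mmapXU t0 mulrA -mpolyCM divfK //.
    by rewrite /tau liftK addrK.
  by rewrite rmorphM /= mmapC mmapXU t0 mulrA -mpolyCM mulVf // mul1r.
pose h (i : 'I_n.+1) : {mpoly K[n]} := if unlift ord0 i is Some j then 'X_j else 0.
have [Psi [Theta [PsiK ThetaK PsiC PsiX]]] :
    exists (Psi : {rmorphism {mpoly K[n.+1]} -> {poly {mpoly K[n]}}})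
           (Theta : {rmorphism {poly {mpoly K[n]}} -> {mpoly K[n.+1]}}),
    [/\ cancel Psi Theta, cancel Theta Psi, forall a, Psi a%:MP = (a%:MP)%:P &
        forall i, Psi 'X_i = (h i)%:P + (v i)%:MP *: 'X].
  pose Psi : {rmorphism {mpoly K[n.+1]} -> {poly {mpoly K[n]}}} := @first_var K n \o psub tau.
  pose Theta : {rmorphism {poly {mpoly K[n]}} -> {mpoly K[n.+1]}} := psub tau' \o @unfirst_var K n.
  have PsiC a : Psi a%:MP = (a%:MP)%:P.
    by rewrite /Psi /= mmapC /first_var mmapC.
  have PsiX i : Psi 'X_i = (h i)%:P + (v i)%:MP *: 'X.
    rewrite /Psi /= mmapXU /tau /h; case: unliftP => [j ->|->].
      rewrite rmorphD rmorphM /= /first_var !mmapC !mmapXU liftK unlift_none.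
      by rewrite mul_polyC.
    by rewrite rmorphM /= /first_var mmapC mmapXU unlift_none mul_polyC polyC0 add0r.
  exists Psi, Theta; split=> // P.
    by rewrite /Psi /Theta /= first_varK tau'K.
  by rewrite /Psi /Theta /= tauK; apply: unfirst_varK.
have topX m : (size (Psi 'X_[m]) <= (mdeg m).+1)%N /\
    (Psi 'X_[m])`_(mdeg m) = (\prod_i v i ^+ m i)%:MP.
  rewrite mpolyXE_id (rmorph_prod Psi) mdegE.
  elim: (index_enum _) => [|i r [ih1 ih2]].
    by rewrite !big_nil size_poly1 coef1.
  rewrite !big_cons (rmorphXn Psi) PsiX.
  have [s1 s2] := top_coefX (h i) (v i)%:MP (m i).
  have [t1 t2] := top_coefM s1 ih1; split=> //.
  by rewrite t2 s2 ih2 mpolyCM (rmorphXn (@mpolyC n K)).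
have dm m : m \in msupp F -> (mdeg m <= d)%N.
  by move=> /msize_mdeg_lt; rewrite -mlead_deg.
have PsiZ a P : Psi (a *: P) = (a%:MP)%:P * Psi P by rewrite -mul_mpolyC (rmorphM Psi) PsiC.
have sF : (size (Psi F) <= d.+1)%N.
  rewrite [F]mpolyE (rmorph_sum Psi).
  apply: leq_trans (size_sum _ _ _) _; apply/bigmax_leqP_seq => m hm _.
  rewrite PsiZ mul_polyC (leq_trans (size_scale_leq _ _)) //.
  by have [s _] := topX m; apply: leq_trans s _; apply: dm.
have cF : (Psi F)`_d = (G.@[v])%:MP.
  rewrite {1}[F]mpolyE /G (rmorph_sum Psi) coef_sum (rmorph_sum (meval v)) (rmorph_sum (@mpolyC n K)) [RHS]big_mkcond /=.
  rewrite [LHS]big_seq [RHS]big_seq; apply: eq_bigr => m hm.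
  rewrite PsiZ coefCM; have [s e] := topX m.
  have [<-|ne] := eqVneq (mdeg m) d; first by rewrite e mevalZ mevalX mpolyCM.
  rewrite nth_default ?mulr0 //; apply: leq_trans s _.
  by rewrite ltn_neqAle ne dm.
exists Psi, Theta, (G.@[v])^-1; split=> //; first by rewrite invr_eq0.
have e1 : (Psi ((G.@[v])^-1%:MP * F))`_d = 1.
  by rewrite (rmorphM Psi) PsiC coefCM cF -mpolyCM mulVf.
have s1 : (size (Psi ((G.@[v])^-1%:MP * F)%R) <= d.+1)%N.
  by rewrite (rmorphM Psi) PsiC mul_polyC (leq_trans (size_scale_leq _ _)).
rewrite monicE lead_coefE; suff -> : size (Psi ((G.@[v])^-1%:MP * F)) = d.+1 by rewrite e1.
apply/eqP; rewrite eqn_leq s1 ltnNge; apply/negP => /(nth_default 0).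
by rewrite e1 => /eqP; rewrite oner_eq0.
Qed.
End Noether.

(** * Regular sequences in a polynomial ring *)

Section RegularPoly.
Variable B : idomainType.
Implicit Types P a b c : {poly B}.

Lemma monic_mul_small P a b : P \is monic -> a = P * b -> (size a < size P)%N -> a = 0.
Proof.
move=> mP ->; have [->|nz] := eqVneq b 0; first by rewrite mulr0.
rewrite size_monicM //; have := size_poly_gt0 b; rewrite nz; lia.
Qed.

Lemma size_polyCM_lt (g : B) P a : (size a < size P)%N -> (size (g%:P * a)%R < size P)%N.
Proof. by rewrite mul_polyC; apply: leq_ltn_trans (size_scale_leq _ _). Qed.

Lemma monic_div P a : P \is monic -> exists u r, a = P * u + r /\ (size r < size P)%N.
Proof.
move=> mP; exists (Pdiv.Ring.rdivp a P), (Pdiv.Ring.rmodp a P).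
split; first by rewrite mulrC; apply: Pdiv.RingMonic.rdivp_eq.
by rewrite Pdiv.Ring.ltn_rmodp monic_neq0.
Qed.

Lemma monic_const_regular P (g : B) a b : P \is monic -> g != 0 ->
  P * a = g%:P * b -> exists e, b = P * e.
Proof.
move=> mP g0; have [u [r [-> lt]]] := monic_div b mP => e.
have /(monic_mul_small mP) : g%:P * r = P * (a - g%:P * u).
  by rewrite mulrBr e; ring.
move=> /(_ (size_polyCM_lt g lt))/eqP; rewrite mulf_eq0 polyC_eq0 (negbTE g0) /= => /eqP ->.
by exists u; rewrite addr0.
Qed.

Lemma const_monic_regular P (h : B) a b : P \is monic -> h != 0 ->
  h%:P * a = P * b -> exists e, a = P * e.
Proof. by move=> mP h0 e; apply: (@monic_const_regular P h b a) => //. Qed.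

Lemma regular_adjoin P (g h : B) :
  P \is monic -> g != 0 -> (forall x y : B, h * x = g * y -> exists e, x = g * e) ->
  forall c a b, h%:P * c = P * a + g%:P * b -> exists u w, c = P * u + g%:P * w.
Proof.
move=> mP g0 gh c a b.
have [c1 [r [-> ltr]]] := monic_div c mP.
have [b1 [s [-> lts]]] := monic_div b mP => e.
have /(monic_mul_small mP) e0 : h%:P * r - g%:P * s = P * (a + g%:P * b1 - h%:P * c1).
  by apply/eqP; rewrite -subr_eq0; apply/eqP; move/eqP: e; rewrite -subr_eq0 => /eqP e; rewrite -e; ring.
have /eqP : h%:P * r - g%:P * s = 0.
  apply: e0; apply: leq_ltn_trans (size_polyD _ _) _.
  by rewrite size_polyN gtn_max !size_polyCM_lt.
rewrite subr_eq0 => /eqP e1.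
have /fin_all_exists [E hE] (k : 'I_(size r)) : exists x, r`_k = g * x.
  by apply: (gh _ s`_k); rewrite -!coefCM e1.
exists c1, (\poly_(k < size r) (if insub k is Some k' then E k' else 0)).
congr (_ + _); apply/polyP => k; rewrite coefCM coef_poly.
case: ltnP => lt; last by rewrite nth_default ?mulr0.
by rewrite insubT -hE.
Qed.

End RegularPoly.

(** If an ideal of a polynomial ring meets every subalgebra generated by at
    least four elements, it contains a regular sequence of length three: make
    a first element monic in one variable, a second one, which does not involve
    that variable, monic in another one, and take the third one free of both. *)
Lemma regular_triple (K : closedFieldType) m (J : {mpoly K[m.+2]} -> Prop) :
  (forall F a, J F -> J (a * F)) ->
  (forall r (z : 'I_r -> {mpoly K[m.+2]}), (4 <= r)%N ->
     exists2 F : {mpoly K[r]}, F != 0 & J (psub z F)) ->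
  (4 <= m)%N ->
  exists F1 F2 F3, [/\ [/\ J F1, J F2 & J F3], F1 != 0,
    forall a b, F1 * a = F2 * b -> exists e, b = F1 * e &
    forall c a b, F3 * c = F1 * a + F2 * b -> exists u w, c = F1 * u + F2 * w].
Proof.
move=> hJ hz hm.
have [|F nzF] := hz _ (fun i => 'X_i); first by lia.
rewrite psub_id => JF.
have [Psi1 [Th1 [c1 [K1 K1' C1 nz1 mon1]]]] := noether_change nzF.
have [|G nzG JG] := hz _ (fun i => Th1 ('X_i : {mpoly K[m.+1]})%:P); first by lia.
have [Psi2 [Th2 [c2 [K2 K2' C2 nz2 mon2]]]] := noether_change nzG.
have [|H nzH JH] := hz _ (fun i => Th1 (Th2 ('X_i : {mpoly K[m]})%:P)%:P); first by lia.
have Th1C a : Th1 (a%:MP)%:P = a%:MP by rewrite -C1 K1.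
have Th2C a : Th2 (a%:MP)%:P = a%:MP by rewrite -C2 K2.
have Th1s (Q : {mpoly K[m.+1]}) : psub (fun i => Th1 ('X_i)%:P) Q = Th1 Q%:P.
  elim/mpoly_ring_ind: Q => [c|i|p q hp hq|p q hp hq].
  - by rewrite mmapC Th1C.
  - by rewrite mmapXU.
  - by rewrite rmorphD /= hp hq !rmorphD.
  - by rewrite rmorphM /= hp hq !rmorphM.
have Th2s (Q : {mpoly K[m]}) : psub (fun i => Th1 (Th2 ('X_i)%:P)%:P) Q = Th1 (Th2 Q%:P)%:P.
  elim/mpoly_ring_ind: Q => [c|i|p q hp hq|p q hp hq].
  - by rewrite mmapC Th2C Th1C.
  - by rewrite mmapXU.
  - by rewrite rmorphD /= hp hq !rmorphD.
  - by rewrite rmorphM /= hp hq !rmorphM.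
rewrite Th1s in JG; rewrite Th2s in JH.
pose g := c2%:MP * G; pose h := Th2 H%:P.
have gh c b : h * c = g * b -> exists e, c = g * e.
  move=> /(congr1 Psi2); rewrite (rmorphM Psi2 h) (rmorphM Psi2 g) /h K2'.
  move/(const_monic_regular mon2 nzH) => [e he].
  by exists (Th2 e); rewrite -[c]K2 he (rmorphM Th2) K2.
have g0 : g != 0.
  by rewrite mulf_neq0 // mpolyC_eq0.
pose f := c1%:MP * F; have Jf : J f by exact: hJ.
have f0 : f != 0 by rewrite mulf_neq0 // mpolyC_eq0.
have Jg : J (Th1 g%:P) 
  by rewrite /g polyCM (rmorphM Th1 (c2%:MP)%:P G%:P) Th1C; apply: hJ.
have Jh : J (Th1 h%:P) := JH.
rewrite -/f in mon1; clearbody f g h.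
exists f, (Th1 g%:P), (Th1 h%:P); split=> //.
- move=> a b /(congr1 Psi1); rewrite (rmorphM Psi1 f a) (rmorphM Psi1 (Th1 g%:P) b) (K1' g%:P).
  move/(monic_const_regular mon1 g0) => [e he].
  by exists (Th1 e); rewrite -[b]K1 he (rmorphM Th1) K1.
- move=> c a b /(congr1 Psi1) e.
  have e1 : Psi1 (Th1 h%:P * c) = h%:P * Psi1 c by rewrite (rmorphM Psi1) K1'.
  have e2 : Psi1 (Th1 g%:P * b) = g%:P * Psi1 b by rewrite (rmorphM Psi1) K1'.
  have e3 := etrans (rmorphD Psi1 (f * a) (Th1 g%:P * b)) (congr2 +%R (rmorphM Psi1 f a) e2).
  have [u [w he]] := regular_adjoin mon1 g0 gh (etrans (esym e1) (etrans e e3)).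
  by exists (Th1 u), (Th1 w); rewrite -[c]K1 he (rmorphD Th1) !(rmorphM Th1) K1.
Qed.

(** * Divisibility by a quadric *)

Section Quadric.
Variables (K : closedFieldType) (N : nat).
Implicit Types (f g h r : {mpoly K[N]}) (a b c d : 'I_N).

Definition indep b r :=
  forall u v : 'I_N -> K, (forall l, l != b -> u l = v l) -> r.@[u] = r.@[v].

Lemma indepC b k : indep b k%:MP.
Proof. by move=> u v _; rewrite !mevalC. Qed.
Lemma indepX b i : i != b -> indep b 'X_i.
Proof. by move=> ib u v h; rewrite !mevalXU h. Qed.
Lemma indepD b f g : indep b f -> indep b g -> indep b (f + g).
Proof. by move=> hf hg u v h; rewrite !mevalD (hf u v) // (hg u v). Qed.
Lemma indepM b f g : indep b f -> indep b g -> indep b (f * g).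
Proof. by move=> hf hg u v h; rewrite !mevalM (hf u v) // (hg u v). Qed.
Lemma indepXn b f k : indep b f -> indep b (f ^+ k).
Proof. by move=> hf u v h; rewrite !rmorphXn /= (hf u v). Qed.

Definition upd (v : 'I_N -> K) b x : 'I_N -> K := fun l => if l == b then x else v l.

Lemma split_var a f : exists h r, f = 'X_a * h + r /\ indep a r.
Proof.
elim/mpoly_ring_ind: f => [k|i|f g [h [r [-> hr]]] [h' [r' [-> hr']]]|f g [h [r [-> hr]]] [h' [r' [-> hr']]]].
- by exists 0, k%:MP; rewrite mulr0 add0r; split=> //; apply: indepC.
- have [->|ia] := eqVneq i a.
    by exists 1, 0; rewrite mulr1 addr0; split=> //; rewrite -(mpolyC0 N K); apply: indepC.
  by exists 0, 'X_i; rewrite mulr0 add0r; split=> //; apply: indepX.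
- by exists (h + h'), (r + r'); split; [ring | apply: indepD].
- exists (h * ('X_a * h' + r') + r * h'), (r * r'); split; [ring | exact: indepM].
Qed.

Lemma mpolyXU_neq0 a : ('X_a : {mpoly K[N]}) != 0.
Proof.
by apply/eqP => /(congr1 (meval (fun=> 1))); rewrite mevalXU meval0 => /eqP; rewrite oner_eq0.
Qed.

(** Pseudo-division by [X_a X_b - X_c X_d], which is of degree one in [X_b]. *)
Lemma pseudo_div a b c d f : a != b -> c != b -> d != b ->
  exists k h r, 'X_a ^+ k * f = ('X_a * 'X_b - 'X_c * 'X_d) * h + r /\ indep b r.
Proof.
move=> ab cb db.
elim/mpoly_ring_ind: f => [u|i|f g [k [h [r [e hr]]]] [k' [h' [r' [e' hr']]]]|f g [k [h [r [e hr]]]] [k' [h' [r' [e' hr']]]]].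
- by exists 0%N, 0, u%:MP; rewrite mulr0 add0r mul1r; split=> //; apply: indepC.
- have [->|ib] := eqVneq i b.
    exists 1%N, 1, ('X_c * 'X_d); rewrite mulr1 subrK; split=> //.
    by apply: indepM; apply: indepX.
  by exists 0%N, 0, 'X_i; rewrite mulr0 add0r mul1r; split=> //; apply: indepX.
- exists (k + k')%N, ('X_a ^+ k' * h + 'X_a ^+ k * h'), ('X_a ^+ k' * r + 'X_a ^+ k * r'); split.
    transitivity ('X_a ^+ k' * ('X_a ^+ k * f) + 'X_a ^+ k * ('X_a ^+ k' * g)); first by rewrite exprD; ring.
    by rewrite e e'; ring.
  by apply: indepD; apply: indepM => //; apply/indepXn/indepX.
- exists (k + k')%N, (h * (('X_a * 'X_b - 'X_c * 'X_d) * h' + r') + r * h'), (r * r'); split.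
    transitivity (('X_a ^+ k * f) * ('X_a ^+ k' * g)); first by rewrite exprD; ring.
    by rewrite e e'; ring.
  exact: indepM.
Qed.

(** The quadric [X_a X_b = X_c X_d] is irreducible, so it is enough that [f]
    vanishes on its open part where [X_a] and [D] do not.  The remainder of the
    pseudo-division does not involve [X_b], which is determined by the other
    coordinates on that part, so this remainder is zero; the power of [X_a]
    then cancels because the equation of the quadric is prime to [X_a]. *)
Lemma quadric_dvd a b c d f D : a != b -> c != b -> d != b -> c != a -> d != a ->
  D != 0 -> indep b D ->
  (forall v, v a != 0 -> v a * v b = v c * v d -> D.@[v] != 0 -> f.@[v] = 0) ->
  exists h, f = ('X_a * 'X_b - 'X_c * 'X_d) * h.
Proof.
move=> ab cb db ca da nzD iD hf; set p := _ - _.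
have [k [h [r [e hr]]]] := pseudo_div f ab cb db.
have r0 : r = 0.
  apply: (@mpoly_fun_dense _ _ ('X_a * D)); first by rewrite mulf_neq0 ?mpolyXU_neq0.
  move=> v; rewrite mevalM mevalXU mulf_eq0 negb_or meval0 => /andP[va Dv].
  pose w := upd v b (v c * v d / v a).
  have wE l : l != b -> w l = v l by rewrite /w /upd => /negbTE ->.
  have wb : w b = v c * v d / v a by rewrite /w /upd eqxx.
  have vw l : l != b -> v l = w l by move/wE.
  have pw : p.@[w] = 0.
    by rewrite mevalB !mevalM !mevalXU (wE a) // (wE c) // (wE d) // wb mulrC divfK // subrr.
  have fw : f.@[w] = 0.
    apply: hf; rewrite ?(wE a) ?(wE c) ?(wE d) -?(iD _ _ vw) //.
    by rewrite wb mulrC divfK.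
  rewrite (hr _ _ vw); move/(congr1 (meval w)): e.
  by rewrite mevalM fw mulr0 mevalD mevalM pw mul0r add0r.
rewrite r0 addr0 in e; elim: k h e => [|k ih] h e.
  by exists h; rewrite -e mul1r.
have [h' eh] : exists h', h = 'X_a * h'.
  have [h1 [r1 [e1 hr1]]] := split_var a h; exists h1; rewrite e1.
  suff -> : r1 = 0 by rewrite addr0.
  apply: (@mpoly_fun_dense _ _ ('X_c * 'X_d)); first by rewrite mulf_neq0 ?mpolyXU_neq0.
  move=> v; rewrite mevalM !mevalXU meval0 => nz.
  pose w := upd v a 0.
  have wE l : l != a -> w l = v l by rewrite /w /upd => /negbTE ->.
  have wa : w a = 0 by rewrite /w /upd eqxx.
  have vw l : l != a -> v l = w l by move/wE.
  rewrite (hr1 _ _ vw); move/(congr1 (meval w)): e.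
  rewrite exprS -mulrA mevalM mevalXU wa mul0r mevalM mevalB !mevalM !mevalXU wa mul0r sub0r.
  rewrite e1 mevalD mevalM mevalXU wa mul0r add0r (wE c) // (wE d) // => /esym/eqP.
  by rewrite mulf_eq0 oppr_eq0 (negbTE nz) => /eqP.
apply: (ih h'); apply: (mulfI (mpolyXU_neq0 a)).
by rewrite mulrA -exprS e eh; ring.
Qed.

End Quadric.

(** * Invariants of vectors under SL_2 *)

Section FFT.
Variables (K : closedFieldType) (n : nat).
Local Notation S := {mpoly K[n + n]}.
Implicit Types (f g h : S) (x y t : 'I_n -> K) (d : 'X_{1..n}) (i j k l : 'I_n).

Definition vX i : 'I_(n + n) := lshift n i.
Definition vY i : 'I_(n + n) := rshift n i.

Definition pt x y : 'I_(n + n) -> K := fun u => match split u with inl i => x i | inr i => y i end.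

Lemma ptX x y i : pt x y (vX i) = x i.
Proof. by rewrite /pt /vX -[lshift n i]/(unsplit (inl i)) unsplitK. Qed.
Lemma ptY x y i : pt x y (vY i) = y i.
Proof. by rewrite /pt /vY -[rshift n i]/(unsplit (inr i)) unsplitK. Qed.

Definition ev f x y := f.@[pt x y].

Lemma evD f g x y : ev (f + g) x y = ev f x y + ev g x y. Proof. exact: mevalD. Qed.
Lemma evB f g x y : ev (f - g) x y = ev f x y - ev g x y. Proof. exact: mevalB. Qed.
Lemma evM f g x y : ev (f * g) x y = ev f x y * ev g x y. Proof. exact: mevalM. Qed.
Lemma evZ c f x y : ev (c *: f) x y = c * ev f x y. Proof. exact: mevalZ. Qed.
Lemma evX i x y : ev 'X_(vX i) x y = x i. Proof. by rewrite /ev mevalXU ptX. Qed.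
Lemma evY i x y : ev 'X_(vY i) x y = y i. Proof. by rewrite /ev mevalXU ptY. Qed.

Lemma ev_ext f x y x' y' : x =1 x' -> y =1 y' -> ev f x y = ev f x' y'.
Proof. by move=> ex ey; apply: meval_eq => u; rewrite /pt; case: split. Qed.

Lemma pt_surj (v : 'I_(n + n) -> K) : v =1 pt (fun i => v (vX i)) (fun i => v (vY i)).
Proof. by move=> u; case: (split_ordP u) => i ->; rewrite ?(ptX, ptY). Qed.

Lemma ev_pt f (v : 'I_(n + n) -> K) : f.@[v] = ev f (fun i => v (vX i)) (fun i => v (vY i)).
Proof. by apply: meval_eq; apply: pt_surj. Qed.

Lemma ev_inj f g : (forall x y, ev f x y = ev g x y) -> f = g.
Proof. by move=> h; apply: mpoly_fun_inj => v; rewrite !ev_pt. Qed.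

Lemma ev_dense D f g : D != 0 ->
  (forall x y, ev D x y != 0 -> ev f x y = ev g x y) -> f = g.
Proof.
by move=> nz h; apply: (mpoly_fun_dense nz) => v; rewrite !ev_pt; apply: h.
Qed.

Definition bracket i j : S := 'X_(vX i) * 'X_(vY j) - 'X_(vX j) * 'X_(vY i).

Lemma ev_bracket i j x y : ev (bracket i j) x y = x i * y j - x j * y i.
Proof. by rewrite evB !evM !evX !evY. Qed.

Definition multihomog d f := forall t x y, (forall i, t i != 0) ->
  ev f (fun i => t i * x i) (fun i => t i * y i) = (\prod_i t i ^+ d i) * ev f x y.

Definition sl2_inv f := forall a b c e : K, a * e - b * c = 1 -> forall x y,
  ev f (fun i => a * x i + c * y i) (fun i => b * x i + e * y i) = ev f x y.

Definition bmon (s : seq ('I_n * 'I_n)) : S := \prod_(e <- s) bracket e.1 e.2.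
Definition bdeg (s : seq ('I_n * 'I_n)) : 'X_{1..n} := (\sum_(e <- s) (U_(e.1) + U_(e.2)))%MM.

Inductive bspan d : S -> Prop :=
| bspan0 : bspan d 0
| bspan_cons s c f : bdeg s = d -> bspan d f -> bspan d (c *: bmon s + f).

Lemma bspanD d f g : bspan d f -> bspan d g -> bspan d (f + g).
Proof.
by elim=> [|s c {}f hs _ ih] hg; rewrite ?add0r // -addrA; apply: bspan_cons (ih hg).
Qed.

Lemma bspanM d i j f : bspan d f -> bspan (U_(i) + U_(j) + d) (bracket i j * f).
Proof.
elim=> [|s c {}f hs _ ih]; first by rewrite mulr0; apply: bspan0.
rewrite mulrDr -scalerAr (_ : _ * bmon s = bmon ((i, j) :: s)); last by rewrite /bmon big_cons.
by apply: bspan_cons ih; rewrite /bdeg big_cons -hs.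
Qed.

Lemma sl2_inv_bracket i j : sl2_inv (bracket i j).
Proof.
move=> a b c d e x y; rewrite !ev_bracket.
transitivity ((a * d - b * c) * (x i * y j - x j * y i)); first by ring.
by rewrite e mul1r.
Qed.

Lemma sl2_invM f g : sl2_inv f -> sl2_inv g -> sl2_inv (f * g).
Proof. by move=> hf hg a b c d e x y; rewrite !evM hf // hg. Qed.

Lemma sl2_inv_bspan d f : bspan d f -> sl2_inv f.
Proof.
elim=> [|s c {}f _ _ ih] a b' c' d' e x y; first by rewrite /ev !meval0.
rewrite !evD !evZ ih //; congr (_ * _ + _).
move: a b' c' d' e x y; rewrite -/(sl2_inv (bmon s)) /bmon.
apply: big_ind => [a b c' d' e x y | f1 f2| e _]; first by rewrite /ev !meval1.
  exact: sl2_invM.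
exact: sl2_inv_bracket.
Qed.

Lemma prod_exp_U t i : \prod_k t k ^+ (U_(i)%MM k) = t i.
Proof.
rewrite (bigD1 i) //= mnm1E eqxx big1 ?mulr1 // => k /negbTE ki.
by rewrite mnm1E eq_sym ki.
Qed.

Lemma prod_exp_D t d d' :
  \prod_k t k ^+ ((d + d')%MM k) = (\prod_k t k ^+ d k) * \prod_k t k ^+ d' k.
Proof. by rewrite -big_split; apply: eq_bigr => k _; rewrite mnmDE exprD. Qed.

Lemma ev_bmon_scale s t x y :
  ev (bmon s) (fun i => t i * x i) (fun i => t i * y i) = (\prod_i t i ^+ bdeg s i) * ev (bmon s) x y.
Proof.
rewrite /bmon /bdeg; elim: s => [|[i j] s ih].
  by rewrite !big_nil /ev !meval1 big1 ?mulr1 // => i _; rewrite mnm0E expr0.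
rewrite !big_cons !evM ih !prod_exp_D !prod_exp_U !ev_bracket /=; ring.
Qed.

Lemma multihomog_bspan d f : bspan d f -> multihomog d f.
Proof.
elim=> [|s c {}f hs _ ih] t x y ht; first by rewrite /ev !meval0 mulr0.
rewrite !evD !evZ ih // ev_bmon_scale hs; ring.
Qed.

Lemma multihomogB d f g : multihomog d f -> multihomog d g -> multihomog d (f - g).
Proof. by move=> hf hg t x y ht; rewrite !evB hf // hg // mulrBr. Qed.

Lemma bracket_neq0 i j : i != j -> bracket i j != 0.
Proof.
move=> ij; apply/eqP => /(congr1 (fun f => ev f (fun k => (k == i)%:R) (fun k => (k == j)%:R))).
rewrite ev_bracket !eqxx [j == i]eq_sym (negbTE ij) mul0r subr0 mulr1 /ev meval0 => /eqP.
by rewrite oner_eq0.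
Qed.

Lemma bmon_replace i j s : bdeg s i != 0%N -> exists s',
  (bdeg s' + U_(i) = bdeg s + U_(j))%MM /\
  forall x y, x i = x j -> y i = y j -> ev (bmon s') x y = ev (bmon s) x y.
Proof.
elim: s => [|[k l] s ih]; first by rewrite /bdeg big_nil mnm0E.
have bcons u v s' : bdeg ((u, v) :: s') = (U_(u) + U_(v) + bdeg s')%MM by rewrite /bdeg big_cons.
have mcons u v s' : bmon ((u, v) :: s') = bracket u v * bmon s' by rewrite /bmon big_cons.
have [->|ki] := eqVneq k i.
  move=> _; exists ((j, l) :: s); split; last by move=> x y ex ey; rewrite !mcons !evM !ev_bracket ex ey.
  by rewrite !bcons; apply/mnmP => u; rewrite !mnmDE; lia.
have [->|li] := eqVneq l i.
  move=> _; exists ((k, j) :: s); split; last by move=> x y ex ey; rewrite !mcons !evM !ev_bracket ex ey.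
  by rewrite !bcons; apply/mnmP => u; rewrite !mnmDE; lia.
rewrite bcons !mnmDE !mnm1E (negbTE ki) (negbTE li) => /ih [s' [e1 e2]].
exists ((k, l) :: s'); split; last by move=> x y ex ey; rewrite !mcons !evM e2.
rewrite !bcons; apply/mnmP => u; move/mnmP/(_ u): e1; rewrite !mnmDE; lia.
Qed.

Lemma bmon_replace_many i j m s : i != j -> (m <= bdeg s i)%N -> exists s',
  (bdeg s' + U_(i) *+ m = bdeg s + U_(j) *+ m)%MM /\
  forall x y, x i = x j -> y i = y j -> ev (bmon s') x y = ev (bmon s) x y.
Proof.
move=> ij; elim: m => [|m ih] hm; first by exists s; split=> //; rewrite !mulm0n.
have [s1 [e1 e2]] := ih (ltnW hm).
have [|s2 [e3 e4]] := @bmon_replace i j s1.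
  move/mnmP/(_ i): e1; rewrite !mnmDE !mulmnE !mnm1E eqxx eq_sym (negbTE ij); lia.
exists s2; split; last by move=> x y ex ey; rewrite e4 // e2.
apply/mnmP => u; move/mnmP/(_ u): e1; move/mnmP/(_ u): e3.
rewrite !mnmDE !mulmnE; lia.
Qed.


Definition merge i j f : S :=
  psub (fun u => match split u with
                 | inl k => 'X_(vX (if k == j then i else k))
                 | inr k => 'X_(vY (if k == j then i else k)) end) f.

Lemma ev_merge i j f x y : ev (merge i j f) x y =
  ev f (fun k => x (if k == j then i else k)) (fun k => y (if k == j then i else k)).
Proof.
rewrite /ev meval_psub; apply: meval_eq => u; rewrite /pt.
by case: (split u) => k; rewrite mevalXU -/(pt x y _) ?(ptX, ptY).
Qed.

Definition dmerge i j d : 'X_{1..n} :=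
  [multinom (if k == j then 0 else if k == i then d i + d j else d k)%N | k < n].

Lemma multihomog_merge i j d f : i != j -> multihomog d f -> multihomog (dmerge i j d) (merge i j f).
Proof.
move=> ij hf t x y ht; rewrite !ev_merge.
rewrite (hf (fun k => t (if k == j then i else k))) //; congr (_ * _).
rewrite (bigD1 j) //= [RHS](bigD1 j) //= (bigD1 i) //= [X in _ = _ * X](bigD1 i) //=.
rewrite !mnmE eqxx (negbTE ij) eqxx expr0 mul1r exprD mulrA [t i ^+ d j * _]mulrC.
congr (_ * _); apply: eq_bigr => k /andP[/negbTE kj /negbTE ki].
by rewrite mnmE kj ki.
Qed.

Lemma sl2_inv_merge i j f : sl2_inv f -> sl2_inv (merge i j f).
Proof. by move=> hf a b c e h x y; rewrite !ev_merge hf. Qed.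

Lemma mdeg_dmerge i j d : i != j -> mdeg (dmerge i j d) = mdeg d.
Proof.
move=> ij; rewrite !mdegE (bigD1 j) //= [RHS](bigD1 j) //= (bigD1 i) //= [X in _ = (_ + X)%N](bigD1 i) //=.
rewrite !mnmE eqxx (negbTE ij) eqxx add0n addnA [(d i + _)%N]addnC; congr (_ + _)%N.
by apply: eq_bigr => k /andP[/negbTE kj /negbTE ki]; rewrite mnmE kj ki.
Qed.

(** A product of brackets of the merged degree has enough occurrences of [i] to
    turn [d j] of them into [j]. *)
Lemma bspan_unmerge i j d f : i != j -> bspan (dmerge i j d) f ->
  exists g, bspan d g /\ forall x y, x i = x j -> y i = y j -> ev g x y = ev f x y.
Proof.
move=> ij; elim=> [|s c {}f hs _ [g [hg eg]]]; first by exists 0; split=> //; apply: bspan0.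
have [|s' [e1 e2]] := @bmon_replace_many i j (d j) s ij.
  by rewrite hs mnmE (negbTE ij) eqxx leq_addl.
exists (c *: bmon s' + g); split.
  apply: bspan_cons hg; apply/mnmP => k; move/mnmP/(_ k): e1; rewrite hs !mnmDE !mulmnE !mnm1E mnmE.
  have [->|kj] := eqVneq k j; first by rewrite (negbTE ij); lia.
  by have [->|ki] := eqVneq k i; lia.
by move=> x y ex ey; rewrite !evD !evZ e2 // eg.
Qed.

(** The function is constant along the rescalings of the vectors in which it
    has degree zero, so these vectors may be replaced by their limit zero. *)
Lemma ev_support d f x y : multihomog d f ->
  ev f x y = ev f (fun k => if d k == 0%N then 0 else x k) (fun k => if d k == 0%N then 0 else y k).
Proof.
move=> hf; pose on z : 'I_n -> K := fun k => if d k == 0%N then 0 else z k.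
pose off z : 'I_n -> K := fun k => if d k == 0%N then z k else 0.
have [p hp] := line_poly f (pt (on x) (on y)) (pt (off x) (off y)).
have eP (t : K) : p.[t] = ev f (fun k => (if d k == 0%N then t else 1) * x k)
                         (fun k => (if d k == 0%N then t else 1) * y k).
  rewrite hp; apply: meval_eq => u; rewrite /pt.
  by case: (split u) => k; rewrite /on /off; case: ifP; rewrite ?add0r ?mulr0 ?addr0 ?mul1r.
have eq1 (t : K) : t != 0 -> p.[t] = ev f x y.
  move=> t0; rewrite eP hf => [|k]; last by case: ifP; rewrite ?oner_neq0.
  rewrite big1 ?mul1r // => k _.
  by case: ifP => [/eqP ->|_]; rewrite ?expr0 ?expr1n.
rewrite -(poly_nz_const eq1) eP; apply: ev_ext => k /=; case: ifP; by rewrite ?mul0r ?mul1r.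
Qed.

Lemma sl2_inv_const f : multihomog 0%MM f -> f = (ev f (fun=> 0) (fun=> 0))%:MP.
Proof.
move=> hf; apply: ev_inj => x y; rewrite [RHS]mevalC (ev_support x y hf).
by apply: ev_ext => k; rewrite mnm0E.
Qed.

Lemma pow_neq1 m : (0 < m)%N -> exists t : K, t != 0 /\ t ^+ m != 1.
Proof.
move=> m0; have : 'X * ('X^m - 1) != 0 :> {poly K}.
  by rewrite mulf_neq0 ?polyX_eq0 // -size_poly_eq0 size_XnsubC.
case/closed_nonrootP => t; rewrite rootE !hornerE mulf_eq0 negb_or subr_eq0 => /andP[t0 t1].
by exists t.
Qed.

(** A single vector has no nonconstant invariants: its coordinates can be
    rescaled freely. *)
Lemma sl2_inv_one_vector i d f : multihomog d f -> sl2_inv f ->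
  d i != 0%N -> (forall k, k != i -> d k = 0%N) -> f = 0.
Proof.
move=> hf fi di dk; apply: (@ev_dense 'X_(vX i)); first exact: mpolyXU_neq0.
move=> x y; rewrite evX => xi; rewrite [RHS]/ev meval0.
have [t [t0 t1]] : exists t : K, t != 0 /\ t ^+ d i != 1 by apply: pow_neq1; rewrite lt0n.
pose e (u : K) : 'I_n -> K := fun k => if k == i then u else 0.
have supp : ev f x y = ev f (e (x i)) (e (y i)).
  rewrite (ev_support x y hf); apply: ev_ext => k; rewrite /e.
    by have [->|/dk ->] := eqVneq k i; rewrite ?(negbTE di).
  by have [->|/dk ->] := eqVneq k i; rewrite ?(negbTE di).
have ax : ev f x y = ev f (e (x i)) (e 0).
  rewrite supp -(fi 1 (- (y i / x i)) 0 1) ?mulr1 ?mulr0 ?subr0 //.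
  apply: ev_ext => k; rewrite /e; case: eqP => _; rewrite ?mul1r ?mulr0 ?mul0r ?addr0 //.
  by rewrite mulNr divfK // addNr.
have e1 : ev f (e (t * x i)) (e 0) = ev f (e (x i)) (e 0).
  rewrite -[RHS](fi t 0 0 t^-1) ?divff ?mul0r ?subr0 //.
  by apply: ev_ext => k; rewrite /e; case: eqP => _; rewrite ?mulr0 ?mul0r ?addr0.
have e2 : ev f (e (t * x i)) (e 0) = t ^+ d i * ev f (e (x i)) (e 0).
  have := hf (fun k => if k == i then t else 1) (e (x i)) (e 0).
  rewrite (bigD1 i) //= eqxx big1 ?mulr1 => [<-|k /negbTE ->]; last by rewrite expr1n.
    by apply: ev_ext => k; rewrite /e; case: eqP => _; rewrite ?mulr0.
  by move=> k; case: ifP => _; rewrite ?oner_neq0.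
rewrite ax; move/eqP: e2; rewrite e1 -subr_eq0 -{1}[ev f _ _]mul1r -mulrBl mulf_eq0.
by rewrite subr_eq0 eq_sym (negbTE t1) => /eqP.
Qed.

Lemma multihomog_quot i j d f h : i != j -> d i != 0%N -> d j != 0%N ->
  f = bracket i j * h -> multihomog d f -> multihomog (d - U_(i) - U_(j))%MM h.
Proof.
move=> ij di dj e hf t x y ht.
pose sc f' : S := psub (fun u => match split u with
   inl k => (t k)%:MP * 'X_(vX k) | inr k => (t k)%:MP * 'X_(vY k) end) f'.
have evsc f' x' y' : ev (sc f') x' y' = ev f' (fun k => t k * x' k) (fun k => t k * y' k).
  rewrite /ev meval_psub; apply: meval_eq => u; rewrite /pt; case: (split u) => k.
    by rewrite mevalM mevalC -[X in _ * X]/(ev 'X_(vX k) x' y') evX.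
  by rewrite mevalM mevalC -[X in _ * X]/(ev 'X_(vY k) x' y') evY.
rewrite -evsc -evZ; congr (ev _ x y); apply: (ev_dense (bracket_neq0 ij)) => {}x {}y nz.
rewrite evsc evZ; have := hf t x y ht; rewrite e !evM.
have -> : d = (U_(i) + U_(j) + (d - U_(i) - U_(j)))%MM.
  apply/mnmP => k; rewrite !mnmDE !mnmBE !mnm1E.
  have [<-|ki] := eqVneq i k; first by rewrite [j == i]eq_sym (negbTE ij); move: di; lia.
  by have [<-|kj] := eqVneq j k; move: dj; lia.
rewrite !prod_exp_D !prod_exp_U.
have -> : (U_(i) + U_(j) + (d - U_(i) - U_(j)) - U_(i) - U_(j))%MM = (d - U_(i) - U_(j))%MM.
  by apply/mnmP => k; rewrite !mnmBE !mnmDE !mnmBE; lia.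
have -> : ev (bracket i j) (fun k => t k * x k) (fun k => t k * y k) = t i * t j * ev (bracket i j) x y.
  by rewrite !ev_bracket; ring.
move=> E; apply: (mulfI (mulf_neq0 (mulf_neq0 (ht i) (ht j)) nz)).
by rewrite E; ring.
Qed.

Lemma sl2_inv_quot i j f h : i != j -> f = bracket i j * h -> sl2_inv f -> sl2_inv h.
Proof.
move=> ij e hf a b c w det x y.
pose sc f' : S := psub (fun u => match split u with
   inl k => a%:MP * 'X_(vX k) + c%:MP * 'X_(vY k)
 | inr k => b%:MP * 'X_(vX k) + w%:MP * 'X_(vY k) end) f'.
have evsc f' x' y' : ev (sc f') x' y' =
    ev f' (fun k => a * x' k + c * y' k) (fun k => b * x' k + w * y' k).
  rewrite /ev meval_psub; apply: meval_eq => u; rewrite /pt; case: (split u) => k.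
    by rewrite mevalD !mevalM !mevalC -!/(ev _ x' y') evX evY.
  by rewrite mevalD !mevalM !mevalC -!/(ev _ x' y') evX evY.
rewrite -evsc; congr (ev _ x y); apply: (ev_dense (bracket_neq0 ij)) => {}x {}y nz.
have := hf _ _ _ _ det x y; rewrite e !evM (sl2_inv_bracket i j det) -evsc.
by move/(mulfI nz).
Qed.

(** The first fundamental theorem for SL_2, in any characteristic.  Setting a
    vector [j] equal to a vector [i] gives an invariant of fewer vectors;
    distributing the occurrences of [i] in an expression for it among [i] and
    [j] gives an invariant which differs from the original one by a multiple of
    the bracket of [i] and [j]. *)
Theorem sl2_first_fundamental d f : multihomog d f -> sl2_inv f -> bspan d f.
Proof.
have [m] := ubnP (mdeg d); elim: m d f => // m IHm d f.
have [q] := ubnP #|[set k | d k != 0%N]|; elim: q d f => // q IHq d f hq hm hf fi.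
have [[i [j [ij di dj]]]|no] := classic (exists i j, [/\ i != j, d i != 0%N & d j != 0%N]); last first.
  have [[i di]|no1] := classic (exists i, d i != 0%N).
    rewrite (@sl2_inv_one_vector i d f) //; first exact: bspan0.
    move=> k ki; apply/eqP; apply: contraT => dk; case: no.
    by exists i, k; rewrite eq_sym.
  have d0 : d = 0%MM.
    apply/mnmP => k; rewrite mnm0E; apply/eqP; apply: contraT => dk; case: no1; by exists k.
  rewrite d0 in hf *; rewrite (sl2_inv_const hf) -[_%:MP]addr0.
  have -> c : c%:MP = c *: bmon [::] :> S by rewrite /bmon big_nil -mul_mpolyC mulr1.
  by apply: bspan_cons (bspan0 _); rewrite /bdeg big_nil.
have [|||g [hg eg]] := bspan_unmerge ij (IHq (dmerge i j d) (merge i j f) _ _ _ (sl2_inv_merge _ _ fi)).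
- move: hq; rewrite ltnS; apply: leq_trans; apply: proper_card; apply/properP; split.
    apply/subsetP => k; rewrite !inE mnmE; have [->|_] := eqVneq k j; first by rewrite eqxx.
    by have [->|_] := eqVneq k i; rewrite ?di.
  by exists j; rewrite !inE ?mnmE ?eqxx.
- by rewrite mdeg_dmerge.
- exact: multihomog_merge.
have hfg : multihomog d (f - g) := multihomogB hf (multihomog_bspan hg).
have XY u v : vX u != vY v by rewrite /vX /vY eq_lrshift.
have YX u v : vY u != vX v by rewrite eq_sym.
have XX : vX j != vX i by rewrite /vX eq_lshift eq_sym.
have YY : vY i != vY j by rewrite /vY eq_rshift.
have [v vi e vj|h eh] := @quadric_dvd K _ (vX i) (vY j) (vX j) (vY i) (f - g) 'X_(vX j)
  (XY i j) (XY j j) YY XX (YX i i) (mpolyXU_neq0 _ _) (indepX (XY j j)).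
  rewrite mevalXU in vj; rewrite ev_pt; set x := fun k => _; set y := fun k => _.
  have xi : x i != 0 by []; have xj : x j != 0 by [].
  have ey : y j = x j / x i * y i.
    by apply: (mulfI xi); rewrite [LHS]e mulrA [x i * _]mulrC divfK.
  pose x' k := x (if k == j then i else k); pose y' k := y (if k == j then i else k).
  have := hfg (fun k => if k == j then x j / x i else 1) x' y'.
  have -> : ev (f - g) x' y' = 0.
    rewrite evB (eg x' y') /x' /y' ?eqxx ?(negbTE ij) // ev_merge.
    by apply/eqP; rewrite subr_eq0; apply/eqP; apply: ev_ext => k /=; case: (eqVneq k j) => [|/negbTE ->//]; rewrite (negbTE ij).
  rewrite mulr0 => <-.
    apply: ev_ext => k; rewrite /x' /y'; case: eqP => [->|_]; rewrite ?mul1r ?divfK //.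
  by move=> k; case: ifP => _; rewrite ?oner_neq0 // mulf_neq0 // invr_neq0.
have hh := multihomog_quot ij di dj eh hfg.
have hi := sl2_inv_quot ij eh (fun a b c w det x y =>
  etrans (evB _ _ _ _) (etrans (congr2 (fun u v => u - v) (fi _ _ _ _ det x y)
    (sl2_inv_bspan hg det x y)) (esym (evB _ _ _ _)))).
have dE : d = (U_(i) + U_(j) + (d - U_(i) - U_(j)))%MM.
  apply/mnmP => k; rewrite !mnmDE !mnmBE !mnm1E.
  have [<-|ki] := eqVneq i k; first by rewrite [j == i]eq_sym (negbTE ij); move: di; lia.
  by have [<-|kj] := eqVneq j k; move: dj; lia.
rewrite -(subrK g f); apply: bspanD hg; rewrite eh dE; apply: bspanM.
apply: IHm hh hi; move: hm; rewrite {1}dE !mdegD !mdeg1; lia.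
Qed.

(** * Multihomogeneous components *)

Definition mweight (m : 'X_{1..n + n}) : 'X_{1..n} := [multinom (m (vX i) + m (vY i))%N | i < n].

Definition component d f : S := \sum_(m <- msupp f | mweight m == d) f@_m *: 'X_[m].

Lemma ev_monomial_scale m t x y : ev 'X_[m] (fun i => t i * x i) (fun i => t i * y i) =
  (\prod_i t i ^+ mweight m i) * ev 'X_[m] x y.
Proof.
rewrite /ev !mevalX !big_split_ord /=.
under eq_bigr => i _ do rewrite -/(vX i) ptX exprMn.
under [X in _ * X = _]eq_bigr => i _ do rewrite -/(vY i) ptY exprMn.
under [X in _ = _ * (X * _)]eq_bigr => i _ do rewrite -/(vX i) ptX.
under [X in _ = _ * (_ * X)]eq_bigr => i _ do rewrite -/(vY i) ptY.
under [X in _ = X * _]eq_bigr => i _ do rewrite mnmE exprD.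
by rewrite !big_split /=; ring.
Qed.

Lemma multihomog_component d f : multihomog d (component d f).
Proof.
move=> t x y _; rewrite /component /ev !rmorph_sum /= mulr_sumr.
apply: eq_bigr => m /eqP <-.
by rewrite !mevalZ -!/(ev _ _ _) ev_monomial_scale mulrCA.
Qed.

Lemma component_sum f : f = \sum_(d <- undup (map mweight (msupp f))) component d f.
Proof.
rewrite {1}[f]mpolyE /component (exchange_big_dep xpredT) //=.
rewrite [LHS]big_seq [RHS]big_seq; apply: eq_bigr => m hm.
rewrite big_mkcond (bigD1_seq (mweight m)) ?undup_uniq ?mem_undup ?map_f //=.
rewrite eqxx big1 ?addr0 // => d /negbTE nd.
by rewrite eq_sym nd.
Qed.

(** Two points whose rescalings always have the same image under [f] have the
    same image under its components: compare the coefficients of the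
    polynomials in the scaling factors. *)
Lemma ev_component_eq f x y x' y' :
  (forall t, ev f (fun i => t i * x i) (fun i => t i * y i) =
             ev f (fun i => t i * x' i) (fun i => t i * y' i)) ->
  forall d, ev (component d f) x y = ev (component d f) x' y'.
Proof.
move=> h d; pose P u v : {mpoly K[n]} := \sum_(m <- msupp f) (f@_m * ev 'X_[m] u v) *: 'X_[mweight m].
have eP u v t : (P u v).@[t] = ev f (fun i => t i * u i) (fun i => t i * v i).
  rewrite {1}[f]mpolyE /ev /P !rmorph_sum /=; apply: eq_bigr => m _.
  by rewrite !mevalZ -!/(ev _ _ _) ev_monomial_scale mevalX -mulrA [ev _ _ _ * _]mulrC.
have cP u v : (P u v)@_d = ev (component d f) u v.
  rewrite /P /component /ev !rmorph_sum /= linear_sum /= [RHS]big_mkcond /=.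
  apply: eq_bigr => m _; rewrite mcoeffZ mcoeffX -/(ev _ _ _).
  by case: eqP => _; rewrite ?mulr0 // mulr1 mevalZ.
rewrite -!cP; congr (_@_d); apply: mpoly_fun_inj => t.
by rewrite !eP h.
Qed.

Lemma sl2_inv_component d f : sl2_inv f -> sl2_inv (component d f).
Proof.
move=> fi a b c e det x y; apply: ev_component_eq => t.
rewrite -[RHS](fi _ _ _ _ det); apply: ev_ext => i; by ring.
Qed.

Lemma scale_inv_component d f (s : 'I_n -> K) :
  (forall x y, ev f (fun i => s i * x i) (fun i => s i * y i) = ev f x y) ->
  forall x y, ev (component d f) (fun i => s i * x i) (fun i => s i * y i) = ev (component d f) x y.
Proof.
move=> h x y; apply: ev_component_eq => t; rewrite -[RHS]h.
by apply: ev_ext => i; rewrite mulrCA.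
Qed.

End FFT.

(** * The invariants of two vectors of weight 1, two of weight -1 and one of weight 0 *)

(** An inductive predicate, so that properties of the elements of the subalgebra
    are proved on the generators. *)
Inductive subalg (K : comNzRingType) N (G : {mpoly K[N]} -> Prop) : {mpoly K[N]} -> Prop :=
| subalgC c : subalg G c%:MP
| subalg_gen f : G f -> subalg G f
| subalgD f g : subalg G f -> subalg G g -> subalg G (f + g)
| subalgM f g : subalg G f -> subalg G g -> subalg G (f * g).

Lemma subalg0 (K : comNzRingType) N (G : {mpoly K[N]} -> Prop) : subalg G 0.
Proof. by rewrite -mpolyC0; apply: subalgC. Qed.
Lemma subalg1 (K : comNzRingType) N (G : {mpoly K[N]} -> Prop) : subalg G 1.
Proof. exact: subalgC. Qed.
Lemma subalgN (K : comNzRingType) N (G : {mpoly K[N]} -> Prop) f : subalg G f -> subalg G (- f).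
Proof. by move=> h; rewrite -mulN1r -(mpolyC1 N K) -mpolyCN; apply: subalgM => //; apply: subalgC. Qed.
Lemma subalg_psub (K : comNzRingType) N (G : {mpoly K[N]} -> Prop) n (y : 'I_n -> {mpoly K[N]}) P :
  (forall i, subalg G (y i)) -> subalg G (psub y P).
Proof.
move=> hy; elim/mpoly_ring_ind: P => [c|i|p q hp hq|p q hp hq].
- by rewrite mmapC; apply: subalgC.
- by rewrite mmapXU.
- by rewrite rmorphD; apply: subalgD.
- by rewrite rmorphM; apply: subalgM.
Qed.
Lemma subalg_le (K : comNzRingType) N (G G' : {mpoly K[N]} -> Prop) f :
  (forall g, G g -> subalg G' g) -> subalg G f -> subalg G' f.
Proof.
by move=> h; elim=> [c|g /h //|g g' _ hg _ hg'|g g' _ hg _ hg'];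
  [apply: subalgC | apply: subalgD | apply: subalgM].
Qed.

Lemma I2_cases (k : 'I_2) : k = 0 \/ k = 1.
Proof. by case: k => [[|[|]]] // lt; [left|right]; apply/val_inj. Qed.

Section FiveVectors.
Variable K : closedFieldType.
Local Notation S := {mpoly K[5 + 5]}.
Implicit Types (f g : S).

Definition iv (i : 'I_2) : 'I_5 := lshift 3 i.
Definition iw (i : 'I_2) : 'I_5 := rshift 2 (lshift 1 i).
Definition iz : 'I_5 := rshift 2 (rshift 2 (ord0 : 'I_1)).

Lemma five_cases (k : 'I_5) : [\/ exists i, k = iv i, exists i, k = iw i | k = iz].
Proof.
case: (@split_ordP 2 3 k) => i ->; first by apply: Or31; exists i.
case: (@split_ordP 2 1 i) => j ->; first by apply: Or32; exists j.
by apply: Or33; rewrite /iz (ord1 j).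
Qed.

Definition qq (i j : 'I_2) : S := bracket K (iv i) (iw j).
Definition nv (i : 'I_2) : S := bracket K iz (iv i).
Definition nw (i : 'I_2) : S := bracket K iz (iw i).
Definition NN (i j : 'I_2) : S := nv i * nw j.

Definition genC f := (exists i j, f = qq i j) \/ (exists i j, f = NN i j).
Definition inC := subalg genC.

Lemma inC_q i j : inC (qq i j).
Proof. by apply: subalg_gen; left; exists i, j. Qed.
Lemma inC_N i j : inC (NN i j).
Proof. by apply: subalg_gen; right; exists i, j. Qed.

Lemma bracketN i j : bracket K i j = - bracket K j i :> S.
Proof. by rewrite /bracket; ring. Qed.
Lemma bracket_ii i : bracket K i i = 0 :> S.
Proof. by rewrite /bracket subrr. Qed.
(** The part of weight [k] of the algebra of brackets, as a module over the
    part of weight 0, for two opposite families of vectors. *)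
Section Weights.
Variables a b : 'I_2 -> 'I_5.
Let na i : S := bracket K iz (a i).
Let nb i : S := bracket K iz (b i).
Hypothesis qab : forall i j, inC (bracket K (a i) (b j)).
Hypothesis nab : forall i j, inC (na i * nb j).

Inductive weight : nat -> S -> Prop :=
| weight_C f : inC f -> weight 0 f
| weight0 k : weight k 0
| weightD k f g : weight k f -> weight k g -> weight k (f + g)
| weight_n k i f : weight k f -> weight k.+1 (na i * f)
| weight_p k i j f : weight k f -> weight k.+2 (bracket K (a i) (a j) * f).

Lemma weightZ k c f : inC c -> weight k f -> weight k (c * f).
Proof.
move=> hc; elim=> [g hg|l|l g h _ ihg _ ihh|l i g _ ih|l i j g _ ih].
- by apply: weight_C; apply: subalgM.
- by rewrite mulr0; apply: weight0.
- by rewrite mulrDr; apply: weightD.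
- by rewrite mulrCA; apply: weight_n.
- by rewrite mulrCA; apply: weight_p.
Qed.

Lemma weightB k f g : weight k f -> weight k g -> weight k (f - g).
Proof.
move=> hf hg; apply: weightD hf _; rewrite -mulN1r; apply: weightZ => //.
by apply: subalgN; apply: subalg1.
Qed.

Lemma weight_inC f : weight 0 f -> inC f.
Proof.
move e: 0%N => k h; elim: h e => // [l _|l g h _ ihg _ ihh e]; first exact: subalg0.
by apply: subalgD; [apply: ihg | apply: ihh].
Qed.

Lemma weight_nb k j f : weight k.+1 f -> weight k (nb j * f).
Proof.
move e: k.+1 => l h; elim: h k e => // {l f} [l|l f g _ ihf _ ihg|l i f hf _|l i i' f hf _] k e.
- by rewrite mulr0; apply: weight0.
- by rewrite mulrDr; apply: weightD; [apply: ihf | apply: ihg].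
- by case: e => ->; rewrite mulrA [nb j * _]mulrC; apply: weightZ.
- case: e => ->; rewrite (_ : _ * _ = bracket K (a i) (b j) * (na i' * f) -
      bracket K (a i') (b j) * (na i * f)); last by rewrite /na /nb /bracket; ring.
  by apply: weightB; apply: (weightZ (qab _ _)); apply: weight_n.
Qed.

Lemma weight_pb k j j' f : weight k.+2 f -> weight k (bracket K (b j) (b j') * f).
Proof.
move e: k.+2 => l h; elim: h k e => // {l f} [l|l f g _ ihf _ ihg|l i f hf _|l i i' f hf _] k e.
- by rewrite mulr0; apply: weight0.
- by rewrite mulrDr; apply: weightD; [apply: ihf | apply: ihg].
- case: e => el; rewrite -el in hf *; rewrite (_ : _ * _ = bracket K (a i) (b j') * (nb j * f) -
      bracket K (a i) (b j) * (nb j' * f)); last by rewrite /na /nb /bracket; ring.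
  by apply: weightB; apply: (weightZ (qab _ _)); apply: weight_nb.
- case: e => ->; rewrite (_ : _ * _ = (bracket K (a i) (b j) * bracket K (a i') (b j') -
      bracket K (a i) (b j') * bracket K (a i') (b j)) * f); last by rewrite /bracket; ring.
  by rewrite mulrBl; apply: weightB; apply: weightZ hf; apply: subalgM; apply: qab.
Qed.

End Weights.

Lemma weight_pb1 (a b : 'I_2 -> 'I_5) j j' f :
  (forall i j, inC (bracket K (a i) (b j))) ->
  weight a 1 f -> weight b 1 (bracket K (b j) (b j') * f).
Proof.
move=> qab.
suff main l g : weight a l g -> l = 1%N -> weight b 1 (bracket K (b j) (b j') * g) by move/main; apply.
elim=> // {l g} [l _|l g h _ ihg _ ihh e|l i g hg _ [el]].
- by rewrite mulr0; apply: weight0.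
- by rewrite mulrDr; apply: weightD; [apply: ihg | apply: ihh].
- rewrite el in hg *; have {}hg := weight_inC hg.
  rewrite (_ : _ * _ = bracket K (a i) (b j') * (bracket K iz (b j) * g) -
      bracket K (a i) (b j) * (bracket K iz (b j') * g)); last by rewrite /bracket; ring.
  by apply: weightB; apply: (weightZ (qab _ _)); apply: weight_n; apply: weight_C.
Qed.

Definition wdeg (d : 'X_{1..5}) (a : 'I_2 -> 'I_5) := (d (a ord0) + d (a ord_max))%N.

(** [f] has the possibly negative weight [m - l]. *)
Definition of_weight m l f :=
  (exists2 k, m = (l + k)%N & weight iv k f) \/ (exists2 k, l = (m + k)%N & weight iw k f).

Lemma qvw i j : inC (bracket K (iv i) (iw j)). Proof. exact: inC_q. Qed.
Lemma qwv i j : inC (bracket K (iw i) (iv j)).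
Proof. by rewrite bracketN; apply/subalgN/inC_q. Qed.
Lemma nvw i j : inC (bracket K iz (iv i) * bracket K iz (iw j)). Proof. exact: inC_N. Qed.
Lemma nwv i j : inC (bracket K iz (iw i) * bracket K iz (iv j)).
Proof. by rewrite mulrC; apply: inC_N. Qed.

Lemma of_weightN m l f : of_weight m l f -> of_weight m l (- f).
Proof.
have e : - f = (-1) * f by rewrite mulN1r.
have h1 : inC (-1) by apply/subalgN/subalg1.
by case=> [[k ek h]|[k ek h]]; [left | right]; exists k => //; rewrite e; apply: weightZ.
Qed.

Lemma of_weight0 m l : of_weight m l 0.
Proof.
have [lm|/ltnW ml] := leqP l m.
  by left; exists (m - l)%N; [rewrite subnKC | apply: weight0].
by right; exists (l - m)%N; [rewrite subnKC | apply: weight0].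
Qed.

Lemma of_weight_step (s : seq ('I_5 * 'I_5)) k l :
  of_weight (wdeg (bdeg s) iv) (wdeg (bdeg s) iw) (bmon K s) ->
  of_weight (wdeg (bdeg ((k, l) :: s)) iv) (wdeg (bdeg ((k, l) :: s)) iw) (bmon K ((k, l) :: s)).
Proof.
have -> : bmon K ((k, l) :: s) = bracket K k l * bmon K s by rewrite /bmon big_cons.
have eb : bdeg ((k, l) :: s) = (U_(k) + U_(l) + bdeg s)%MM by rewrite /bdeg big_cons.
have Uvv i : wdeg U_(iv i)%MM iv = 1%N by rewrite /wdeg !mnm1E; case: i => [[|[]]].
have Uvw i : wdeg U_(iv i)%MM iw = 0%N by rewrite /wdeg !mnm1E; case: i => [[|[]]].
have Uwv i : wdeg U_(iw i)%MM iv = 0%N by rewrite /wdeg !mnm1E; case: i => [[|[]]].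
have Uww i : wdeg U_(iw i)%MM iw = 1%N by rewrite /wdeg !mnm1E; case: i => [[|[]]].
have Uzv : wdeg U_(iz)%MM iv = 0%N by rewrite /wdeg !mnm1E.
have Uzw : wdeg U_(iz)%MM iw = 0%N by rewrite /wdeg !mnm1E.
have wD d d' a : wdeg (d + d')%MM a = (wdeg d a + wdeg d' a)%N by rewrite /wdeg !mnmDE; lia.
rewrite eb !wD; set m := wdeg (bdeg s) iv; set r := wdeg (bdeg s) iw; set f := bmon K s => h.
have hq c : inC c -> of_weight m r (c * f).
  by move=> hc; case: h => [[u eu hu]|[u eu hu]]; [left|right]; exists u => //; apply: weightZ.
have hn i : of_weight m.+1 r (bracket K iz (iv i) * f).
  case: h => [[u eu hu]|[[|u] eu hu]].
  - by left; exists u.+1; [rewrite eu addnS | apply: weight_n].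
  - left; exists 1%N; first by rewrite eu; lia.
    by apply: weight_n; apply: weight_C; apply: weight_inC hu.
  - right; exists u; first by rewrite eu; lia.
    exact: (weight_nb qwv nwv).
have hn' i : of_weight m r.+1 (bracket K iz (iw i) * f).
  case: h => [[[|u] eu hu]|[u eu hu]].
  - right; exists 1%N; first by rewrite eu; lia.
    by apply: weight_n; apply: weight_C; apply: weight_inC hu.
  - left; exists u; first by rewrite eu; lia.
    exact: (weight_nb qvw nvw).
  - by right; exists u.+1; [rewrite eu addnS | apply: weight_n].
have hp i j : of_weight m.+2 r (bracket K (iv i) (iv j) * f).
  case: h => [[u eu hu]|[[|[|u]] eu hu]].
  - by left; exists u.+2; [rewrite eu; lia | apply: weight_p].
  - left; exists 2%N; first by rewrite eu; lia.
    by apply: weight_p; apply: weight_C; apply: weight_inC hu.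
  - left; exists 1%N; first by rewrite eu; lia.
    exact: (weight_pb1 _ _ qwv hu).
  - right; exists u; first by rewrite eu; lia.
    exact: (weight_pb qwv nwv).
have hp' i j : of_weight m r.+2 (bracket K (iw i) (iw j) * f).
  case: h => [[[|[|u]] eu hu]|[u eu hu]].
  - right; exists 2%N; first by rewrite eu; lia.
    by apply: weight_p; apply: weight_C; apply: weight_inC hu.
  - right; exists 1%N; first by rewrite eu; lia.
    exact: (weight_pb1 _ _ qvw hu).
  - left; exists u; first by rewrite eu; lia.
    exact: (weight_pb qvw nvw).
  - by right; exists u.+2; [rewrite eu; lia | apply: weight_p].
have hq1 c : inC c -> of_weight m.+1 r.+1 (c * f).
  by move/hq => [[u eu hu]|[u eu hu]]; [left|right]; exists u => //; rewrite eu.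
case: (five_cases k) (five_cases l) => [[i ->]|[i ->]|->] [[j ->]|[j ->]|->];
  rewrite ?(Uvv, Uvw, Uwv, Uww, Uzv, Uzw) //=.
- exact/hq1/inC_q.
- by rewrite bracketN mulNr; apply: of_weightN.
- exact/hq1/qwv.
- by rewrite bracketN mulNr; apply: of_weightN.
- by rewrite bracket_ii mul0r; apply: of_weight0.
Qed.

Lemma bmon_inC s : wdeg (bdeg s) iv = wdeg (bdeg s) iw -> inC (bmon K s).
Proof.
move=> e; suff [] : of_weight (wdeg (bdeg s) iv) (wdeg (bdeg s) iw) (bmon K s).
- move=> [k ek h]; have k0 : k = 0%N by move: ek; rewrite e; lia.
  by rewrite k0 in h; apply: weight_inC h.
- move=> [k ek h]; have k0 : k = 0%N by move: ek; rewrite e; lia.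
  by rewrite k0 in h; apply: weight_inC h.
elim: s {e} => [|[k l] s]; last exact: of_weight_step.
left; exists 0%N; first by rewrite /wdeg /bdeg big_nil !mnm0E.
by rewrite /bmon big_nil; apply: weight_C; apply: subalg1.
Qed.

Definition torus (t : K) (k : 'I_5) : K :=
  match @split 2 3 k with
  | inl _ => t
  | inr j => if @split 2 1 j is inl _ then t^-1 else 1
  end.

Lemma torusE t : [/\ forall i, torus t (iv i) = t, forall i, torus t (iw i) = t^-1 & torus t iz = 1].
Proof.
split=> [i|i|]; rewrite /torus.
- by rewrite -[iv i]/(unsplit (inl i)) unsplitK.
- rewrite -[iw i]/(@unsplit 2 3 (inr (lshift 1 i))) unsplitK.
  by rewrite -[lshift 1 i]/(@unsplit 2 1 (inl i)) unsplitK.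
- rewrite -[iz]/(@unsplit 2 3 (inr (rshift 2 (ord0 : 'I_1)))) unsplitK.
  by rewrite -[rshift 2 ord0]/(@unsplit 2 1 (inr ord0)) unsplitK.
Qed.

(** By the first fundamental theorem a component is a combination of products of
    brackets; rescaling by [torus] kills it unless its weight is zero. *)
Theorem invariants_generated f : sl2_inv f ->
  (forall t, t != 0 -> forall x y,
     ev f (fun k => torus t k * x k) (fun k => torus t k * y k) = ev f x y) ->
  inC f.
Proof.
move=> fi ft; rewrite (component_sum f).
apply: big_ind => [||d _]; [exact: subalg0 | by move=> *; apply: subalgD|].
have hd := multihomog_component d f.
have hs := sl2_first_fundamental hd (sl2_inv_component d fi).
have [e|ne] := eqVneq (wdeg d iv) (wdeg d iw).
  elim: hs => [|s c g es _ ih]; first exact: subalg0.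
  apply: subalgD ih; rewrite -mul_mpolyC; apply: subalgM; first exact: subalgC.
  by apply: bmon_inC; rewrite es.
suff -> : component d f = 0 by apply: subalg0.
have tE t : \prod_k torus t k ^+ d k = t ^+ wdeg d iv * t^-1 ^+ wdeg d iw.
  have [t1 t2 t3] := torusE t.
  have -> : \prod_k torus t k ^+ d k = (\prod_(i < 2) torus t (iv i) ^+ d (iv i)) *
      ((\prod_(i < 2) torus t (iw i) ^+ d (iw i)) * torus t iz ^+ d iz).
    by rewrite (@big_split_ord _ _ _ 2 3) (@big_split_ord _ _ _ 2 1) big_ord1.
  rewrite t3 expr1n mulr1 !big_ord_recl !big_ord0 !mulr1 !t1 !t2 -!exprD /wdeg.
  by congr (_ ^+ (d _ + d (iv _)) * _ ^+ (d _ + d (iw _))); apply/val_inj.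
have [t [t0 t1]] : exists t : K, t != 0 /\ t ^+ wdeg d iv * t^-1 ^+ wdeg d iw != 1.
  have [lt|ge] := ltnP (wdeg d iv) (wdeg d iw).
    have [t [t0 t1]] := @pow_neq1 K (wdeg d iw - wdeg d iv) (ltac:(by rewrite subn_gt0)).
    exists t; split=> //; rewrite -(subnKC (ltnW lt)) exprD mulrA exprVn divff ?expf_neq0 // mul1r.
    by rewrite exprVn invr_eq1.
  have [|t [t0 t1]] := @pow_neq1 K (wdeg d iv - wdeg d iw); first by rewrite subn_gt0 ltn_neqAle eq_sym ne.
  exists t; split=> //; rewrite -(subnKC ge) exprD mulrC exprVn mulKf ?expf_neq0 //.
apply: ev_inj => x y; rewrite [RHS]/ev meval0.
have tn k : torus t k != 0.
  have [e1 e2 e3] := torusE t.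
  by case: (five_cases k) => [[i ->]|[i ->]|->]; rewrite ?e1 ?e2 ?e3 ?invr_eq0 ?oner_eq0.
have := scale_inv_component d (ft t t0) x y; rewrite (hd _ _ _ tn) tE => /eqP.
by rewrite -subr_eq0 -{2}[ev _ x y]mul1r -mulrBl mulf_eq0 subr_eq0 (negbTE t1) => /eqP.
Qed.

End FiveVectors.

(** * Integral dependence *)

Section Integral.
Variables (A T : comNzRingType) (phi : {rmorphism A -> T}).

(** The monomials whose exponents are bounded by the degrees of the integral
    equations. *)
Lemma integral_finite (xs : seq T) :
  (forall x, x \in xs -> integralOver phi x) ->
  exists b : seq T, aspan phi b 1 /\
    forall x y, x \in xs -> y \in b -> aspan phi b (x * y).
Proof.
elim: xs => [|x xs ih] h.
  by exists [:: 1]; split=> //; apply: aspan_mem; rewrite mem_head.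
have [|b [b1 hb]] := ih; first by move=> y hy; apply: h; rewrite inE hy orbT.
have [p mp rp] := h x (mem_head _ _).
pose k := (size p).-1.
have xk : x ^+ k = - \sum_(i < k) phi p`_i * x ^+ i.
  move/rootP: rp; rewrite horner_coef size_map_poly_id0; last first.
    by rewrite (monicP mp) rmorph1 oner_neq0.
  rewrite -[size p]prednK ?size_poly_gt0 ?monic_neq0 // big_ord_recr /= !coef_map /=.
  rewrite -/k -lead_coefE (monicP mp) rmorph1 mul1r addrC => /eqP; rewrite addr_eq0 => /eqP ->.
  by congr (- _); apply: eq_bigr => i _; rewrite coef_map.
pose b' := [seq x ^+ i * y | i <- iota 0 k.+1, y <- b].
have mem i y : (i <= k)%N -> y \in b -> aspan phi b' (x ^+ i * y).
  by move=> hi hy; apply: aspan_mem; apply/allpairsP; exists (i, y); rewrite mem_iota.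
have span i y : (i <= k)%N -> aspan phi b y -> aspan phi b' (x ^+ i * y).
  move=> hi /aspanE [c ->]; rewrite mulr_sumr; apply: aspan_sum => j _.
  by rewrite mulrCA; apply: aspanZ; apply: mem => //; apply: mem_nth.
exists b'; split; first by rewrite -[1]mul1r -(expr0 x); apply: span.
move=> z _ hz /allpairsP [[i y] [hi hy ->]]; rewrite mem_iota add0n ltnS /= in hi hy *.
move: hz; rewrite inE => /orP[/eqP ->|hz]; last by rewrite mulrCA; apply: span => //; apply: hb.
rewrite mulrA -exprS; move: (hi); rewrite leq_eqVlt => /orP[/eqP ei|ltik]; last exact: mem.
rewrite ei exprS xk mulrN mulNr mulr_sumr mulr_suml -sumrN; apply: aspan_sum => j _.
have -> : - (x * (phi p`_j * x ^+ j) * y) = phi (- p`_j) * (x ^+ j.+1 * y).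
  by rewrite rmorphN exprS; ring.
by apply: aspanZ; apply: mem => //; apply: ltn_ord.
Qed.

Lemma integral_of_square x : integralOver phi (x ^+ 2) -> integralOver phi x.
Proof.
move=> h; apply: (@integral_root_monic _ _ _ _ ('X^2 - (x ^+ 2)%:P)).
- exact: monicXnsubC.
- by rewrite rootE !hornerE subrr.
- apply/integral_poly => i; rewrite coefB coefXn coefC.
  by apply: integral_sub; [apply: integral_nat | case: ifP => // _; apply: integral0].
Qed.

Lemma integral_of_sum_prod x y :
  integralOver phi (x + y) -> integralOver phi (x * y) -> integralOver phi x.
Proof.
move=> hs hp; apply: (@integral_root_monic _ _ _ _ (('X - x%:P) * ('X - y%:P))).
- by rewrite monicMl ?monicXsubC.
- by rewrite rootE !hornerE subrr mul0r.
- have -> : ('X - x%:P) * ('X - y%:P) = 'X^2 - (x + y) *: 'X + (x * y)%:P.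
    by rewrite -mul_polyC polyCD polyCM; ring.
  apply/integral_poly => i; rewrite coefD coefB coefXn coefZ coefX coefC.
  apply: integral_add; last by case: ifP => // _; apply: integral0.
  apply: integral_sub; first exact: integral_nat.
  by apply: integral_mul => //; apply: integral_nat.
Qed.

End Integral.

Lemma monicD_small (T : nzRingType) (p q : {poly T}) :
  p \is monic -> (size q < size p)%N -> p + q \is monic.
Proof. by move=> mp lt; rewrite monicE lead_coefDl // -monicE. Qed.

Section Elimination.
Variables (A T : comNzRingType) (phi : {rmorphism A -> T}).

Lemma integral_sum (I : Type) (r : seq I) (F : I -> T) :
  (forall i, integralOver phi (F i)) -> integralOver phi (\sum_(i <- r) F i).
Proof.
move=> h; elim: r => [|i r ih]; first by rewrite big_nil; apply: integral0.
by rewrite big_cons; apply: integral_add.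
Qed.

Definition integral_coefs (p : {poly T}) := forall i, integralOver phi p`_i.

Lemma integral_coefsC c : integralOver phi c -> integral_coefs c%:P.
Proof. by move=> h i; rewrite coefC; case: ifP => // _; apply: integral0. Qed.
Lemma integral_coefsX : integral_coefs 'X.
Proof. by move=> i; rewrite coefX; apply: integral_nat. Qed.
Lemma integral_coefsD p r : integral_coefs p -> integral_coefs r -> integral_coefs (p + r).
Proof. by move=> hp hr i; rewrite coefD; apply: integral_add. Qed.
Lemma integral_coefsB p r : integral_coefs p -> integral_coefs r -> integral_coefs (p - r).
Proof. by move=> hp hr i; rewrite coefB; apply: integral_sub. Qed.
Lemma integral_coefsM p r : integral_coefs p -> integral_coefs r -> integral_coefs (p * r).
Proof.
by move=> hp hr i; rewrite coefM; apply: integral_sum => j; apply: integral_mul.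
Qed.
Lemma integral_coefsXn p k : integral_coefs p -> integral_coefs (p ^+ k).
Proof.
move=> h; elim: k => [|k ih]; first by apply: integral_coefsC; apply: integral1.
by rewrite exprS; apply: integral_coefsM.
Qed.

Lemma integral_monic_root x p : p \is monic -> integral_coefs p -> p.[x] = 0 -> integralOver phi x.
Proof. by move=> mp hp /rootP rp; apply: integral_root_monic mp rp _; apply/integral_poly. Qed.

(** Eliminating [s] by the last hypothesis and then [t] leaves an equation for
    [x] with leading term [x ^ 10]. *)
Lemma integral_elimination u c a4 a5 l0 l1 x t s :
  integralOver phi u -> integralOver phi c -> integralOver phi a4 -> integralOver phi a5 ->
  integralOver phi l0 -> integralOver phi l1 ->
  t ^+ 2 = x ^+ 3 + c -> s ^+ 2 - a4 * s = t ^+ 2 - a5 * t ->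
  (x - u) * s = l0 + l1 * t -> integralOver phi x.
Proof.
move=> iu ic i4 i5 i0 i1 et es el.
pose C := 'X^3 + c%:P : {poly T}; pose L := 'X - u%:P : {poly T}.
pose r := (a4 * l0)%:P * L - (l0 ^+ 2)%:P - (l1 ^+ 2)%:P * C.
pose beta := a5%:P * L ^+ 2 + (2%:R * l0 * l1)%:P - (a4 * l1)%:P * L.
have sC : size C = 4%N by rewrite size_polyDl ?size_polyXn // (leq_ltn_trans (size_polyC_leq1 _)).
have mC : C \is monic by apply: monicD_small; rewrite ?monicXn // size_polyXn (leq_ltn_trans (size_polyC_leq1 _)).
have mL : L \is monic := monicXsubC u.
have sL : size L = 2%N := size_XsubC u.
have sL2 : size (L ^+ 2)%R = 3%N by rewrite expr2 size_Mmonic ?monic_neq0 // sL.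
have mL2 : L ^+ 2 \is monic by rewrite monic_exp.
have sM : size (L ^+ 2 * C)%R = 6%N by rewrite size_Mmonic ?monic_neq0 // sL2 sC.
have mM : L ^+ 2 * C \is monic by rewrite monicMl.
have sCM (d : T) (p : {poly T}) : (size (d%:P * p)%R <= size p)%N by rewrite mul_polyC size_scale_leq.
have sD (p p' : {poly T}) k : (size p <= k)%N -> (size p' <= k)%N -> (size (p + p')%R <= k)%N.
  by move=> h h'; rewrite (leq_trans (size_polyD _ _)) // geq_max h.
have sr : (size r <= 4)%N.
  rewrite /r; apply: (sD); last by rewrite size_polyN (leq_trans (sCM _ _)) // sC.
  apply: sD; first by rewrite (leq_trans (sCM _ _)) // sL.
  by rewrite size_polyN (leq_trans (size_polyC_leq1 _)).
have sb : (size beta <= 3)%N.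
  rewrite /beta; apply: (sD); last by rewrite size_polyN (leq_trans (sCM _ _)) // sL.
  apply: sD; first by rewrite (leq_trans (sCM _ _)) // sL2.
  by rewrite (leq_trans (size_polyC_leq1 _)).
have mMr : L ^+ 2 * C + r \is monic by apply: monicD_small; rewrite // sM ltnS (leq_trans sr).
have sMr : size (L ^+ 2 * C + r)%R = 6%N by rewrite size_polyDl sM // ltnS (leq_trans sr).
apply: (@integral_monic_root _ ((L ^+ 2 * C + r) ^+ 2 + - (C * beta ^+ 2))).
- apply: monicD_small; first by rewrite monic_exp.
  rewrite size_polyN [(_ + r) ^+ 2]expr2 size_Mmonic ?monic_neq0 // sMr /=.
  apply: leq_ltn_trans (size_polyMleq _ _) _; rewrite sC.
  have : (size (beta ^+ 2)%R <= 5)%N.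
    by rewrite expr2; apply: leq_trans (size_polyMleq _ _) _; move: sb; lia.
  by move: (size _) => z hz; rewrite ltnS; apply: leq_trans hz _.
- have iL : integral_coefs L by apply: integral_coefsB; [exact: integral_coefsX | exact: integral_coefsC].
  have iC : integral_coefs C.
    by apply: integral_coefsD; [apply: integral_coefsXn integral_coefsX | exact: integral_coefsC].
  have im := integral_mul.
  apply: integral_coefsB; last first.
    apply: integral_coefsM iC _; apply: integral_coefsXn.
    apply: integral_coefsB; last by apply: integral_coefsM => //; apply/integral_coefsC/im.
    apply: integral_coefsD; first by apply: integral_coefsM; [exact: integral_coefsC | exact: integral_coefsXn].
    by apply/integral_coefsC/im => //; apply: im => //; apply: integral_nat.
  apply: integral_coefsXn; apply: integral_coefsD; first by apply: integral_coefsM => //; apply: integral_coefsXn.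
  apply: integral_coefsB; last by apply: integral_coefsM => //; apply: integral_coefsC; rewrite expr2; apply: im.
  apply: integral_coefsB; last by apply: integral_coefsC; rewrite expr2; apply: im.
  by apply: integral_coefsM => //; apply/integral_coefsC/im.
have eC : C.[x] = t ^+ 2 by rewrite /C !hornerE et.
have eL : L.[x] = x - u by rewrite /L !hornerE.
have e1 : (L ^+ 2 * C + r).[x] = t * beta.[x].
  rewrite /r /beta; move: C L eC eL {sC mC mL sL sL2 mL2 sM mM sr sb mMr sMr r beta} => C L eC eL.
  have e2 : (l0 + l1 * t) ^+ 2 - a4 * (x - u) * (l0 + l1 * t) = (x - u) ^+ 2 * (t ^+ 2 - a5 * t).
    by rewrite -el -es; ring.
  apply/eqP; rewrite -subr_eq0; move/eqP: e2; rewrite -subr_eq0 => /eqP e2.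
  rewrite !(hornerD, hornerN, hornerM, horner_exp, hornerC) eC eL.
  by rewrite -oppr_eq0 -[X in _ == X]e2; apply/eqP; ring.
by rewrite hornerD hornerN horner_exp hornerM horner_exp e1 eC; ring.
Qed.

End Elimination.

Section FiniteC.
Variables (K : closedFieldType) (hK : 2%N \in [pchar K]).
Local Notation S := {mpoly K[5 + 5]}.
Local Notation q := (qq K).
Local Notation N := (NN K).

Lemma pchar2S n : 2%N \in [pchar {mpoly K[n]}].
Proof. by rewrite inE /= -mpolyC_nat (pcharf0 hK) mpolyC0 eqxx. Qed.

Lemma sqrrD2 n (x y : {mpoly K[n]}) : (x + y) ^+ 2 = x ^+ 2 + y ^+ 2.
Proof. by rewrite -!(pFrobenius_autE (pchar2S n)) rmorphD. Qed.

(** A point where these six elements vanish makes all the [q i j] and [N i j]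
    vanish: [N00 ^ 2], [N01 ^ 2], [q10 ^ 3] agree there up to sign with
    [N11 ^ 2], [N10 ^ 2], [N00 ^ 2], and the two relations do the rest. *)
Definition six_params : 6.-tuple S :=
  [tuple q 0 0; q 1 1; q 0 1; N 0 1 ^+ 2 + N 1 0 ^+ 2; N 0 0 ^+ 2 + N 1 1 ^+ 2;
         N 0 0 ^+ 2 + q 1 0 ^+ 3].
Local Notation phi := (psub (tnth six_params)).

Lemma N_det : N 0 0 * N 1 1 = N 0 1 * N 1 0.
Proof. by rewrite /NN; ring. Qed.

Lemma N_trace : q 0 0 * N 1 1 - q 0 1 * N 1 0 - q 1 0 * N 0 1 + q 1 1 * N 0 0 = 0.
Proof. by rewrite /NN /qq /nv /nw /bracket; ring. Qed.

Lemma int_param i : integralOver phi (tnth six_params i).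
Proof. by rewrite -(mmapXU (@mpolyC _ K) (tnth six_params) i); apply: integral_id. Qed.

Lemma int_six : [/\ integralOver phi (q 0 0), integralOver phi (q 1 1), integralOver phi (q 0 1) &
  [/\ integralOver phi (N 0 1 + N 1 0), integralOver phi (N 0 0 + N 1 1) &
      integralOver phi (N 0 0 ^+ 2 + q 1 0 ^+ 3)]].
Proof.
have := int_param (inord 0); have := int_param (inord 1); have := int_param (inord 2).
have := int_param (inord 3); have := int_param (inord 4); have := int_param (inord 5).
rewrite !(tnth_nth 0) !inordK //= => i5 i4 i3 i2 i1 i0.
by do 2!split=> //; apply: integral_of_square; rewrite sqrrD2.
Qed.

(** [N01] is eliminated by the trace relation, in which it has the coefficient
    [q10 - q01], and [N00] by the equation of its square, a cubic in [q10]. *)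
Lemma int_q10 : integralOver phi (q 1 0).
Proof.
have [i0 i1 i2 [i3 i4 i5]] := int_six.
have im := integral_mul; have ib := integral_sub.
apply: (@integral_elimination _ _ _ (q 0 1) (N 0 0 ^+ 2 + q 1 0 ^+ 3) (N 0 1 + N 1 0)
  (N 0 0 + N 1 1) (q 0 0 * (N 0 0 + N 1 1) - q 0 1 * (N 0 1 + N 1 0)) (q 1 1 - q 0 0)
  _ (N 0 0) (N 0 1)) => //.
- by apply: (ib) => //; apply: (im).
- exact: ib.
- by rewrite addrCA addrr_pchar2 ?addr0 //; apply: pchar2S.
- have -> : N 0 1 ^+ 2 - (N 0 1 + N 1 0) * N 0 1 = - (N 0 1 * N 1 0) by ring.
  by rewrite -N_det; ring.
- apply/eqP; rewrite -subr_eq0 -oppr_eq0 -[X in _ == X]N_trace; apply/eqP; ring.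
Qed.

Lemma int_N i j : integralOver phi (N i j).
Proof.
have [i0 i1 i2 [i3 i4 i5]] := int_six; have iq := int_q10.
have h00 : integralOver phi (N 0 0).
  apply: integral_of_square; rewrite -[N 0 0 ^+ 2](addrK (q 1 0 ^+ 3)).
  by apply: integral_sub => //; do 2!apply: integral_mul => //; apply: integral1.
have h11 : integralOver phi (N 1 1).
  by rewrite -[N 1 1](addKr (N 0 0)) addrC; apply: integral_sub.
have h01 : integralOver phi (N 0 1).
  by apply: integral_of_sum_prod i3 _; rewrite -N_det; apply: integral_mul.
have h10 : integralOver phi (N 1 0).
  by rewrite -[N 1 0](addKr (N 0 1)) addrC; apply: integral_sub.
by case: (I2_cases i) (I2_cases j) => [] -> [] ->.
Qed.

Theorem C_finite : exists b : seq S, aspan phi b 1 /\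
  forall f g, inC f -> aspan phi b g -> aspan phi b (f * g).
Proof.
have [|b [b1 hb]] := @integral_finite _ _ phi (q 1 0 :: [seq N i j | i <- enum 'I_2, j <- enum 'I_2]).
  move=> x; rewrite inE => /orP[/eqP ->|/allpairsP [[i j] [_ _ ->]]]; [exact: int_q10 | exact: int_N].
exists b; split=> // f g hf; elim: hf g => [c|h hh|h h' _ ih _ ih'|h h' _ ih _ ih'] g hg.
- by rewrite -(mmapC (tnth six_params) (@mpolyC _ K)); apply: aspanZ.
- have mul x : (forall y, y \in b -> aspan phi b (x * y)) -> aspan phi b (x * g).
    move=> hx; move/aspanE: hg => [c ->]; rewrite mulr_sumr; apply: aspan_sum => k _.
    by rewrite mulrCA; apply/aspanZ/hx/mem_nth.
  have par k : aspan phi b (tnth six_params k * g).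
    by rewrite -(mmapXU (@mpolyC _ K) (tnth six_params) k); apply: aspanZ.
  case: hh => [[i [j ->]]|[i [j ->]]]; last first.
    by apply: mul => y; apply: hb; rewrite inE; apply/orP; right; apply: allpairs_f; rewrite mem_enum.
  case: (I2_cases i) (I2_cases j) => [] -> [] ->.
  + by have := par (inord 0); rewrite (tnth_nth 0) inordK.
  + by have := par (inord 2); rewrite (tnth_nth 0) inordK.
  + by apply: mul => y; apply: hb; rewrite mem_head.
  + by have := par (inord 1); rewrite (tnth_nth 0) inordK.
- by rewrite mulrDl; apply: aspanD; [apply: ih | apply: ih'].
- by rewrite -mulrA; apply: ih; apply: ih'.
Qed.

End FiniteC.

Lemma mulrB_split (A : comPzRingType) (a b a' b' : A) :
  a * a' - b * b' = a * (a' - b') + b' * (a - b).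
Proof. by ring. Qed.

Section MoreC.
Variables (K : closedFieldType).
Local Notation S := {mpoly K[5 + 5]}.
Local Notation q := (qq K).
Local Notation N := (NN K).

(** * The dimension of the algebra *)

Definition six_indep : 6.-tuple S := [tuple q 0 0; q 0 1; q 1 0; q 1 1; N 0 0; N 0 1].

Definition five_fun (v w : 'I_2 -> K) z (k : 'I_5) : K :=
  match @split 2 3 k with
  | inl i => v i
  | inr k' => if @split 2 1 k' is inl j then w j else z
  end.

Lemma five_funE v w z : [/\ forall i, five_fun v w z (iv i) = v i,
  forall i, five_fun v w z (iw i) = w i & five_fun v w z iz = z].
Proof.
split=> [i|i|]; rewrite /five_fun.
- by rewrite -[iv i]/(unsplit (inl i)) unsplitK.
- rewrite -[iw i]/(@unsplit 2 3 (inr (lshift 1 i))) unsplitK.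
  by rewrite -[lshift 1 i]/(@unsplit 2 1 (inl i)) unsplitK.
- rewrite -[iz]/(@unsplit 2 3 (inr (rshift 2 (ord0 : 'I_1)))) unsplitK.
  by rewrite -[rshift 2 ord0]/(@unsplit 2 1 (inr ord0)) unsplitK.
Qed.

(** On the slice [v0 = (1, 0)], [w0 = (0, c)] the six elements are coordinates,
    up to an invertible change of variables. *)
Lemma six_indepP (P : {mpoly K[6]}) : psub (tnth six_indep) P = 0 -> P = 0.
Proof.
move=> e0.
pose c k : 'I_6 := inord k.
pose r : {mpoly K[6]} := 'X_(c 0%N) * 'X_(c 5%N) - 'X_(c 4%N) * 'X_(c 1%N).
have nzr : 'X_(c 0%N) * r != 0.
  apply: mulf_neq0; first exact: mpolyXU_neq0.
  apply/eqP => /(congr1 (meval (fun i => (i != c 4%N)%:R))).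
  rewrite mevalB !mevalM !mevalXU meval0 eqxx mul0r subr0 /c -!(inj_eq val_inj) /= !inordK //= mulr1.
  by move/eqP; rewrite oner_eq0.
apply: (mpoly_fun_dense nzr) => v; rewrite meval0 /r mevalM mevalB !mevalM !mevalXU mulf_eq0 negb_or.
move=> /andP[p0 r0]; set p := v (c 0%N) in p0 r0.
pose dl := v (c 1%N); pose z := v (c 4%N) / p; pose rr := v (c 5%N) - z * dl.
have rr0 : rr != 0.
  apply: contra r0 => /eqP e.
  have -> : p * v (c 5%N) - v (c 4%N) * v (c 1%N) = p * rr.
    by rewrite /rr /z mulrBr -/dl mulrA [p * (_ / _)]mulrC divfK.
  by rewrite e mulr0.
pose x := v (c 2%N) / p; pose y := (x * dl - v (c 3%N)) / rr.
pose two a b (i : 'I_2) : K := if i == 0 then a else b.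
pose px := five_fun (two 1 x) (two 0 rr) z.
pose py := five_fun (two 0 y) (two p dl) (-1).
have [x1 x2 x3] := five_funE (two 1 x) (two 0 rr) z.
have [y1 y2 y3] := five_funE (two 0 y) (two p dl) (-1).
have := congr1 (fun f => ev f px py) e0; rewrite [RHS]/ev meval0 => <-.
rewrite /ev meval_psub; apply: meval_eq => i; rewrite -/(ev _ px py).
have hv k (lt : (k < 6)%N) : v (Ordinal lt) = v (c k).
  by congr v; apply/val_inj; rewrite /= inordK.
rewrite (tnth_nth 0); case: i => [[|[|[|[|[|[|]]]]]]] //= lt; rewrite hv /NN ?evM /qq /nv /nw !ev_bracket /px /py ?x1 ?x2 ?x3 ?y1 ?y2 ?y3 /two /=.
- by rewrite /p; ring.
- by rewrite -/dl; ring.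
- by rewrite /x mulrC mul0r subr0 mulrC divfK.
- by rewrite /y [rr * _]mulrC divfK //; ring.
- by rewrite /z; transitivity (v (c 4%N) / p * p); [rewrite divfK | ring].
- by rewrite /rr -/dl; ring.
Qed.

(** * Dependence modulo the [q i j] *)

Definition inQC (f : S) := exists c : 'I_2 -> 'I_2 -> S,
  (forall i j, inC (c i j)) /\ f = \sum_i \sum_j q i j * c i j.

Lemma inQC0 : inQC 0.
Proof.
exists (fun _ _ => 0); split=> [i j|]; first exact: subalg0.
by rewrite big1 // => i _; rewrite big1 // => j _; rewrite mulr0.
Qed.

Lemma inQCD f g : inQC f -> inQC g -> inQC (f + g).
Proof.
move=> [c [hc ->]] [d [hd ->]]; exists (fun i j => c i j + d i j); split=> [i j|]; first by apply: subalgD; [apply: hc | apply: hd].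
rewrite -big_split; apply: eq_bigr => i _; rewrite -big_split; apply: eq_bigr => j _.
by rewrite mulrDr.
Qed.

Lemma inQCM f g : inC f -> inQC g -> inQC (f * g).
Proof.
move=> hf [c [hc ->]]; exists (fun i j => f * c i j); split=> [i j|]; first by apply: subalgM; [| apply: hc].
rewrite mulr_sumr; apply: eq_bigr => i _; rewrite mulr_sumr; apply: eq_bigr => j _.
by rewrite mulrCA.
Qed.

Lemma inQC_q i j : inQC (q i j).
Proof.
exists (fun k l => if (k == i) && (l == j) then 1 else 0); split=> [k l|].
  by case: ifP => _; [apply: subalg1 | apply: subalg0].
rewrite (bigD1 i) //= (bigD1 j) //= !eqxx mulr1 !big1 ?addr0 // => k /negbTE nk.
  by rewrite big1 // => l _; rewrite nk mulr0.
by rewrite nk andbF mulr0.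
Qed.

Definition genN (f : S) := exists i j, f = N i j.

Lemma genN_inC f : subalg genN f -> inC f.
Proof. by apply: subalg_le => g [i [j ->]]; apply: inC_N. Qed.

Lemma inC_mod_q f : inC f -> exists2 g, subalg genN g & inQC (f - g).
Proof.
elim=> [c|g [[i [j ->]]|[i [j ->]]]|g h _ [g' hg eg] _ [h' hh eh]|g h hg0 [g' hg eg] hh0 [h' hh eh]].
- by exists c%:MP; [apply: subalgC | rewrite subrr; apply: inQC0].
- by exists 0; [apply: subalg0 | rewrite subr0; apply: inQC_q].
- by exists (N i j); [apply: subalg_gen; exists i, j | rewrite subrr; apply: inQC0].
- by exists (g' + h'); [apply: subalgD | rewrite opprD addrACA; apply: inQCD].
- exists (g' * h'); first exact: subalgM.
  by rewrite mulrB_split; apply: inQCD; apply: inQCM => //; apply: genN_inC.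
Qed.

(** The algebra generated by the products [N i j] is that of the quadric cone
    [N00 N11 = N01 N10], of dimension three. *)
Lemma dependent_genN m (y : 'I_m -> S) : (3 < m)%N -> (forall i, subalg genN (y i)) ->
  exists2 P : {mpoly K[m]}, P != 0 & psub y P = 0.
Proof.
move=> hm hy; pose t : 3.-tuple S := [tuple N 0 0; N 1 1; N 0 1 + N 1 0].
pose b : seq S := [:: 1; N 0 1].
have par k g : aspan (psub (tnth t)) b g -> aspan (psub (tnth t)) b (tnth t k * g).
  by move=> hg; rewrite -(mmapXU (@mpolyC _ K) (tnth t) k); apply: aspanZ.
have b1 : aspan (psub (tnth t)) b 1 by apply: aspan_mem; rewrite mem_head.
have h00 g : aspan (psub (tnth t)) b g -> aspan (psub (tnth t)) b (N 0 0 * g).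
  by move/(par (inord 0)); rewrite (tnth_nth 0) inordK.
have h11 g : aspan (psub (tnth t)) b g -> aspan (psub (tnth t)) b (N 1 1 * g).
  by move/(par (inord 1)); rewrite (tnth_nth 0) inordK.
have hs g : aspan (psub (tnth t)) b g -> aspan (psub (tnth t)) b ((N 0 1 + N 1 0) * g).
  by move/(par (inord 2)); rewrite (tnth_nth 0) inordK.
have bN : aspan (psub (tnth t)) b (N 0 1) by apply: aspan_mem; rewrite !inE eqxx orbT.
have h01 g : aspan (psub (tnth t)) b g -> aspan (psub (tnth t)) b (N 0 1 * g).
  move/aspanE => [c ->]; rewrite mulr_sumr; apply: aspan_sum => k _.
  rewrite mulrCA; apply: aspanZ; have := mem_nth 0 (ltn_ord k).
  move: (b`_k) => x; rewrite !inE => /orP[/eqP ->|/eqP ->]; first by rewrite mulr1.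
  have -> : N 0 1 * N 0 1 = (N 0 1 + N 1 0) * N 0 1 - N 0 0 * (N 1 1 * 1).
    by rewrite mulr1 N_det; ring.
  by apply: aspanB; [apply: hs | apply/h00/h11].
have h10 g : aspan (psub (tnth t)) b g -> aspan (psub (tnth t)) b (N 1 0 * g).
  move=> hg; have -> : N 1 0 * g = (N 0 1 + N 1 0) * g - N 0 1 * g by ring.
  by apply: aspanB; [apply: hs | apply: h01].
apply: (dependent_over_fewer (t := tnth t) (b := b)) => // j x hx.
have {hx} : aspan (psub (tnth t)) b x by apply: aspan_mem.
elim: (hy j) x => [c|g [i [k ->]]|g h _ ih _ ih'|g h _ ih _ ih'] x hx.
- by rewrite -(mmapC (tnth t) (@mpolyC _ K)); apply: aspanZ.
- by case: (I2_cases i) (I2_cases k) => [] -> [] ->; [apply: h00|apply: h01|apply: h10|apply: h11].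
- by rewrite mulrDl; apply: aspanD; [apply: ih | apply: ih'].
- by rewrite -mulrA; apply/ih/ih'.
Qed.

Lemma dependent_mod_q m (y : 'I_m -> S) : (3 < m)%N -> (forall i, inC (y i)) ->
  exists2 P : {mpoly K[m]}, P != 0 & inQC (psub y P).
Proof.
move=> hm hy.
have /fin_all_exists [z hz] (i : 'I_m) : exists g, subalg genN g /\ inQC (y i - g).
  by have [g hg e] := inC_mod_q (hy i); exists g.
have [P nz eP] := dependent_genN hm (fun i => (hz i).1); exists P => //.
rewrite -[psub y P]subr0 -eP; elim/mpoly_ring_ind: P {nz eP} => [c|i|p p' hp hp'|p p' hp hp'].
- by rewrite !mmapC subrr; apply: inQC0.
- by rewrite !mmapXU; apply: (hz i).2.
- by rewrite !rmorphD /= opprD addrACA; apply: inQCD.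
rewrite !rmorphM /= mulrB_split; apply: inQCD; apply: inQCM => //; first exact: subalg_psub.
by apply: genN_inC; apply: subalg_psub => i; apply: (hz i).1.
Qed.

(** * Squares *)

Definition genC2 (f : S) := (exists i j, f = q i j ^+ 2) \/ (exists i j, f = N i j ^+ 2).

Lemma inC_square f : 2%N \in [pchar K] -> inC f -> subalg genC2 (f ^+ 2).
Proof.
move=> hK; elim=> [c|g [[i [j ->]]|[i [j ->]]]|g h _ ih _ ih'|g h _ ih _ ih'].
- by rewrite -rmorphXn; apply: subalgC.
- by apply: subalg_gen; left; exists i, j.
- by apply: subalg_gen; right; exists i, j.
- by rewrite sqrrD2 //; apply: subalgD.
- by rewrite exprMn; apply: subalgM.
Qed.

End MoreC.

(** * The action of GL_2 in coordinates *)

Section Action.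
Variables (K : closedFieldType) (hK : 2%N \in [pchar K]).
Local Notation T := {mpoly K[gdim (gdual (V hK))]}.
Local Notation I10 := 'I_(gdim (gdual (V hK))).
Local Notation S := {mpoly K[5 + 5]}.

Lemma two0 : 2%:R = 0 :> K. Proof. exact: (pcharf0 hK). Qed.

Lemma eq_mod2 (x y z : K) : x = y + 2%:R * z -> x = y.
Proof. by rewrite two0 mul0r addr0. Qed.

Lemma sum2 (R : nmodType) (F : 'I_2 -> R) : \sum_i F i = F 0 + F 1.
Proof. by rewrite !big_ord_recl big_ord0 addr0; congr (F _ + F _); apply/val_inj. Qed.

Lemma detE (s : GL2 K) : \det s = s 0 0 * s 1 1 - s 0 1 * s 1 0.
Proof.
rewrite (expand_det_row _ 0) sum2 /cofactor !det_mx11 !mxE.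
have -> : lift (0 : 'I_2) ord0 = 1 by apply/val_inj.
have -> : lift (1 : 'I_2) ord0 = 0 by apply/val_inj.
by rewrite /= expr0 expr1; ring.
Qed.

Lemma invE (s : GL2 K) : [/\ (s^-1)%g 0 0 = (\det s)^-1 * s 1 1, (s^-1)%g 0 1 = - ((\det s)^-1 * s 0 1),
  (s^-1)%g 1 0 = - ((\det s)^-1 * s 1 0) & (s^-1)%g 1 1 = (\det s)^-1 * s 0 0].
Proof.
have e (i j : 'I_2) : (s^-1)%g i j = (\det s)^-1 * ((-1) ^+ (j + i) * s (lift j ord0) (lift i ord0)).
  by rewrite GL2valV /invmx GL2P !mxE /cofactor det_mx11 !mxE.
have l0 : lift (0 : 'I_2) ord0 = 1 by apply/val_inj.
have l1 : lift (1 : 'I_2) ord0 = 0 by apply/val_inj.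
by rewrite !e !l0 !l1 /=; split; ring.
Qed.

Definition w0 (i : 'I_2) : 'I_(gdim (W0 hK)) := mxtens_index (i, 0 : 'I_1).
Definition pZ i : I10 := lshift (gdim (gsum (Wi K) (Wi K))) (w0 i).
Definition pP i (j : 'I_2) : I10 := pos hK i (lshift 2 j).
Definition pD i (j : 'I_2) : I10 := pos hK i (rshift 2 j).

(** A family on the ten variables, from its values [Z] on the basis of [W0] and
    [P i], [D i] on those of the natural module and its dual in the copy [i]. *)
Definition vfam (R : Type) (Z : 'I_2 -> R) (P D : 'I_2 -> 'I_2 -> R) (k : I10) : R :=
  let W (i : 'I_2) (c : 'I_(2 + 2)) :=
    match split c with inl j => P i j | inr j => D i j end in
  match @split (2 * 1) ((2 + 2) + (2 + 2)) k with
  | inl a => Z (@mxtens_unindex 2 1 a).1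
  | inr k' => match @split (2 + 2) (2 + 2) k' with inl c => W 0 c | inr c => W 1 c end
  end.

Lemma w0_unindex (a : 'I_(2 * 1)) : w0 (@mxtens_unindex 2 1 a).1 = a.
Proof.
by case: (@mxtens_indexP 2 1 a) => i j; rewrite mxtens_indexK /w0 (ord1 j).
Qed.

Lemma pPD_cases (k : I10) : [\/ exists i, k = pZ i, exists i j, k = pP i j | exists i j, k = pD i j].
Proof.
case: (@split_ordP (2 * 1) ((2 + 2) + (2 + 2)) k) => [a ->|k' ->].
  by apply: Or31; exists (mxtens_unindex a).1; rewrite /pZ w0_unindex.
case: (@split_ordP (2 + 2) (2 + 2) k') => c ->; case: (@split_ordP 2 2 c) => j ->.
- by apply: Or32; exists 0, j.
- by apply: Or33; exists 0, j.
- by apply: Or32; exists 1, j.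
- by apply: Or33; exists 1, j.
Qed.

Section Values.
Variables (R : Type) (Z : 'I_2 -> R) (P D : 'I_2 -> 'I_2 -> R).

Lemma vfamZ i : vfam Z P D (pZ i) = Z i.
Proof.
rewrite /vfam -[pZ i]/(@unsplit (2 * 1) ((2 + 2) + (2 + 2)) (inl (w0 i))) unsplitK.
by rewrite /w0 mxtens_indexK.
Qed.

Lemma vfamP i j : vfam Z P D (pP i j) = P i j.
Proof.
case: (I2_cases i) => ->; rewrite /vfam.
  rewrite -[pP 0 j]/(@unsplit (2 * 1) ((2 + 2) + (2 + 2)) (inr (@unsplit (2 + 2) (2 + 2) (inl (@unsplit 2 2 (inl j)))))).
  by rewrite !unsplitK.
rewrite -[pP 1 j]/(@unsplit (2 * 1) ((2 + 2) + (2 + 2)) (inr (@unsplit (2 + 2) (2 + 2) (inr (@unsplit 2 2 (inl j)))))).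
by rewrite !unsplitK.
Qed.

Lemma vfamD i j : vfam Z P D (pD i j) = D i j.
Proof.
case: (I2_cases i) => ->; rewrite /vfam.
  rewrite -[pD 0 j]/(@unsplit (2 * 1) ((2 + 2) + (2 + 2)) (inr (@unsplit (2 + 2) (2 + 2) (inl (@unsplit 2 2 (inr j)))))).
  by rewrite !unsplitK.
rewrite -[pD 1 j]/(@unsplit (2 * 1) ((2 + 2) + (2 + 2)) (inr (@unsplit (2 + 2) (2 + 2) (inr (@unsplit 2 2 (inr j)))))).
by rewrite !unsplitK.
Qed.

Lemma vfam_eta (u : I10 -> R) : u =1 vfam (fun i => u (pZ i)) (fun i j => u (pP i j)) (fun i j => u (pD i j)).
Proof.
move=> k; rewrite /vfam; case: (@split_ordP (2 * 1) ((2 + 2) + (2 + 2)) k) => [a ->|k' ->].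
  by rewrite /pZ w0_unindex.
by case: (@split_ordP (2 + 2) (2 + 2) k') => c ->; case: (@split_ordP 2 2 c) => j ->.
Qed.

End Values.

Lemma vfam_ext (R : Type) (Z Z' : 'I_2 -> R) (P P' D D' : 'I_2 -> 'I_2 -> R) :
  Z =1 Z' -> P =2 P' -> D =2 D' -> vfam Z P D =1 vfam Z' P' D'.
Proof.
move=> eZ eP eD k; case: (pPD_cases k) => [[i ->]|[i [j ->]]|[i [j ->]]];
by rewrite ?vfamZ ?vfamP ?vfamD ?eZ ?eP ?eD.
Qed.

Lemma fun_vfam_eq (f g : T) : (forall Z P D, f.@[vfam Z P D] = g.@[vfam Z P D]) -> f = g.
Proof.
by move=> h; apply: mpoly_fun_inj => u; rewrite !(meval_eq _ (vfam_eta u)); apply: h.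
Qed.

Definition actZ (s : GL2 K) (Z : 'I_2 -> K) j := (\det s)^-1 * (s 0 j ^+ 2 * Z 0 + s 1 j ^+ 2 * Z 1).
Definition actP (s : GL2 K) (P : 'I_2 -> 'I_2 -> K) i j := s 0 j * P i 0 + s 1 j * P i 1.
Definition actD (s : GL2 K) (D : 'I_2 -> 'I_2 -> K) i j := (s^-1)%g j 0 * D i 0 + (s^-1)%g j 1 * D i 1.

Lemma sum_w0 (F : 'I_(2 * 1) -> K) : \sum_a F a = F (w0 0) + F (w0 1).
Proof.
rewrite -(sum2 (fun i => F (w0 i))) (reindex w0) //=.
exists (fun a : 'I_(2 * 1) => (@mxtens_unindex 2 1 a).1) => [i _|a _].
  by rewrite /w0 mxtens_indexK.
exact: w0_unindex.
Qed.

Lemma gmatE s j (u : I10 -> K) : \sum_i gmat (gdual (V hK)) s i j * u i =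
  vfam (actZ s (fun i => u (pZ i))) (actP s (fun i j => u (pP i j))) (actD s (fun i j => u (pD i j))) j.
Proof.
under eq_bigr => i _ do rewrite (gdualK (Vstar hK)).
rewrite (@big_split_ord _ _ _ (2 * 1) ((2 + 2) + (2 + 2))) /=.
rewrite (@big_split_ord _ _ _ (2 + 2) (2 + 2)) /= !(@big_split_ord _ _ _ 2 2) /= sum_w0 !sum2.
case: (pPD_cases j) => [[i ->]|[i [k ->]]|[i [k ->]]].
- rewrite vfamZ /actZ /pZ !(block_mxEul, block_mxEur, block_mxEdl, block_mxEdr) !mxE !mul0r !addr0.
  rewrite !mxtens_indexK /= ?mxE /= ?mulr1n; ring.
- rewrite vfamP /actP; case: (I2_cases i) => ->; rewrite /pP /pos /=.
    by rewrite !(block_mxEul, block_mxEur, block_mxEdl, block_mxEdr) !mxE !mul0r !addr0 !add0r.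
  by rewrite !(block_mxEul, block_mxEur, block_mxEdl, block_mxEdr) !mxE !mul0r !addr0 !add0r.
- rewrite vfamD /actD; case: (I2_cases i) => ->; rewrite /pD /pos /=.
    by rewrite !(block_mxEul, block_mxEur, block_mxEdl, block_mxEdr) !mxE !mul0r !addr0 !add0r.
  by rewrite !(block_mxEul, block_mxEur, block_mxEdl, block_mxEdr) !mxE !mul0r !addr0 !add0r.
Qed.

Lemma act_eval s (f : T) Z P D :
  (coord_act s f).@[vfam Z P D] = f.@[vfam (actZ s Z) (actP s P) (actD s D)].
Proof.
rewrite /coord_act /sym_act comp_mpoly_meval; apply: meval_eq => j.
rewrite tnth_mktuple /glin rmorph_sum /=.
transitivity (\sum_i gmat (gdual (V hK)) s i j * vfam Z P D i).
  by apply: eq_bigr => i _; rewrite mevalZ mevalXU !mxE.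
rewrite gmatE; apply: vfam_ext => [i|i k|i k].
- by rewrite /actZ !vfamZ.
- by rewrite /actP !vfamP.
- by rewrite /actD !vfamD.
Qed.

End Action.

(** * The invariant ring inside the algebra generated by the [q i j] and [N i j] *)

Section Invariants.
Variables (K : closedFieldType) (hK : 2%N \in [pchar K]).
Local Notation T := {mpoly K[gdim (gdual (V hK))]}.
Local Notation I10 := 'I_(gdim (gdual (V hK))).
Local Notation S := {mpoly K[5 + 5]}.
Local Notation R := (invariant_ring (V hK)).
Local Notation vZ i := ('X_(pZ hK i) : T).
Local Notation vP i j := ('X_(pP hK i j) : T).
Local Notation vD i j := ('X_(pD hK i j) : T).

Lemma invariantP (f : T) : R f <->
  forall s Z P D, f.@[vfam (actZ s Z) (actP s P) (actD s D)] = f.@[vfam Z P D].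
Proof.
split=> [h s Z P D|h s]; first by rewrite -act_eval (h s).
by apply: fun_vfam_eq => Z P D; rewrite act_eval h.
Qed.

Lemma invariantC c : R c%:MP.
Proof. by apply/invariantP => s Z P D; rewrite !mevalC. Qed.
Lemma invariant0 : R 0.
Proof. by rewrite -mpolyC0; apply: invariantC. Qed.
Lemma invariantD f g : R f -> R g -> R (f + g).
Proof. by move=> /invariantP hf /invariantP hg; apply/invariantP => s Z P D; rewrite !mevalD hf hg. Qed.
Lemma invariantM f g : R f -> R g -> R (f * g).
Proof. by move=> /invariantP hf /invariantP hg; apply/invariantP => s Z P D; rewrite !mevalM hf hg. Qed.
Lemma invariantX f k : R f -> R (f ^+ k).
Proof. by move=> /invariantP hf; apply/invariantP => s Z P D; rewrite !rmorphXn /= hf. Qed.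
Lemma invariant_psub m (y : 'I_m -> T) P : (forall i, R (y i)) -> R (psub y P).
Proof.
move=> h; elim/mpoly_ring_ind: P => [c|i|p p' hp hp'|p p' hp hp'].
- by rewrite mmapC; apply: invariantC.
- by rewrite mmapXU.
- by rewrite rmorphD; apply: invariantD.
- by rewrite rmorphM; apply: invariantM.
Qed.

(** [Mel i j] is the square of [NN i j], and [Uel i j] a primitive of the
    product of [Qel i j] by the cocycle. *)
Definition Qel i j : T := vP i 0 * vD j 0 + vP i 1 * vD j 1.
Definition Uel i j : T := vZ 0 * vP i 1 * vD j 0 + vZ 1 * vP i 0 * vD j 1.
Definition Mel i j : T := (vZ 0 * vP i 1 ^+ 2 + vZ 1 * vP i 0 ^+ 2) *
                          (vZ 0 * vD j 0 ^+ 2 + vZ 1 * vD j 1 ^+ 2).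

Lemma meval_Q i j Z P D : (Qel i j).@[vfam Z P D] = P i 0 * D j 0 + P i 1 * D j 1.
Proof. by rewrite mevalD !mevalM !mevalXU !vfamP !vfamD. Qed.
Lemma meval_U i j Z P D : (Uel i j).@[vfam Z P D] = Z 0 * P i 1 * D j 0 + Z 1 * P i 0 * D j 1.
Proof. by rewrite mevalD !mevalM !mevalXU !vfamP !vfamD !vfamZ. Qed.
Lemma meval_M i j Z P D : (Mel i j).@[vfam Z P D] =
  (Z 0 * P i 1 ^+ 2 + Z 1 * P i 0 ^+ 2) * (Z 0 * D j 0 ^+ 2 + Z 1 * D j 1 ^+ 2).
Proof. by rewrite /Mel !expr2 mevalM !mevalD !mevalM !mevalXU !vfamP !vfamD !vfamZ. Qed.

Lemma det_neq0 (s : GL2 K) : s 0 0 * s 1 1 - s 0 1 * s 1 0 != 0.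
Proof. by rewrite -detE GL2det_neq0. Qed.

Lemma Q_invariant i j : R (Qel i j).
Proof.
apply/invariantP => s Z P D; rewrite !meval_Q /actP /actD.
have [-> -> -> ->] := invE s; have d0 := det_neq0 s; rewrite !detE; field.
exact: d0.
Qed.

(** In characteristic 2 the form [Z0 Y ^ 2 + Z1 X ^ 2] is multiplied by the
    determinant, or by its inverse on dual vectors. *)
Lemma M_invariant i j : R (Mel i j).
Proof.
apply/invariantP => s Z P D; rewrite !meval_M.
have d0 := det_neq0 s.
have e1 : actZ s Z 0 * actP s P i 1 ^+ 2 + actZ s Z 1 * actP s P i 0 ^+ 2 =
    \det s * (Z 0 * P i 1 ^+ 2 + Z 1 * P i 0 ^+ 2).
  rewrite /actZ /actP !detE; move: (s 0 0) (s 0 1) (s 1 0) (s 1 1) d0 => a b c d d0.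
  apply: (eq_mod2 hK (z := (a * d - b * c)^-1 *
    (Z 0 * (a ^+ 2 * b ^+ 2 * P i 0 ^+ 2 + a * b * P i 0 * P i 1 * (a * d + b * c) + a * b * c * d * P i 1 ^+ 2) +
     Z 1 * (a * b * c * d * P i 0 ^+ 2 + c * d * P i 0 * P i 1 * (a * d + b * c) + c ^+ 2 * d ^+ 2 * P i 1 ^+ 2)))).
  by field.
have e2 : actZ s Z 0 * actD s D j 0 ^+ 2 + actZ s Z 1 * actD s D j 1 ^+ 2 =
    (\det s)^-1 * (Z 0 * D j 0 ^+ 2 + Z 1 * D j 1 ^+ 2).
  rewrite /actZ /actD; have [-> -> -> ->] := invE s; rewrite !detE.
  move: (s 0 0) (s 0 1) (s 1 0) (s 1 1) d0 => a b c d d0.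
  apply: (eq_mod2 hK (z := (a * d - b * c)^-1 ^+ 3 *
    (Z 0 * (a * b * c * d * D j 0 ^+ 2 - a * b * D j 0 * D j 1 * (a * d + b * c) + a ^+ 2 * b ^+ 2 * D j 1 ^+ 2) +
     Z 1 * (c ^+ 2 * d ^+ 2 * D j 0 ^+ 2 - c * d * D j 0 * D j 1 * (a * d + b * c) + a * b * c * d * D j 1 ^+ 2)))).
  by field.
by rewrite e1 e2 mulrACA divff ?mul1r // GL2det_neq0.
Qed.

(** * The cocycle *)

(** In [S ^ 2] of the natural module twisted by the inverse of the determinant,
    these are the coordinates of [s (XY) - XY] on the squares. *)
Definition cocycle_g (s : GL2 K) : 'cV[K]_(gdim (W0 hK)) :=
  \col_a ((\det s)^-1 * (s (@mxtens_unindex 2 1 a).1 0 * s (@mxtens_unindex 2 1 a).1 1)).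

Lemma cocycle_gE s i : cocycle_g s (w0 hK i) 0 = (\det s)^-1 * (s i 0 * s i 1).
Proof. by rewrite mxE /w0 mxtens_indexK. Qed.

Lemma meval_inW0 v Z P D : (in_W0 v).@[vfam Z P D] = v (w0 hK 0) 0 * Z 0 + v (w0 hK 1) 0 * Z 1.
Proof.
rewrite /in_W0 /glin rmorph_sum /= (@big_split_ord _ _ _ (2 * 1) ((2 + 2) + (2 + 2))) /=.
rewrite [X in _ + X]big1 ?addr0 => [|i _]; last by rewrite col_mxEd mxE scale0r meval0.
rewrite sum_w0 !col_mxEu !mevalZ !mevalXU.
by rewrite -!/(pZ hK _) !vfamZ.
Qed.

Lemma U_cocycle s i j : coord_act s (Uel i j) - Uel i j = Qel i j * in_W0 (cocycle_g s).
Proof.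
apply: fun_vfam_eq => Z P D; rewrite mevalB mevalM act_eval !meval_U meval_Q meval_inW0.
rewrite !cocycle_gE /actZ /actP /actD; have [-> -> -> ->] := invE s; have d0 := det_neq0 s; rewrite !detE.
move: (s 0 0) (s 0 1) (s 1 0) (s 1 1) d0 => a b c d d0.
apply: (eq_mod2 hK (z := (a * d - b * c)^-1 * (Z 0 * (b * c * P i 1 * D j 0 - a * b * P i 1 * D j 1) +
  Z 1 * (b * c * P i 0 * D j 1 - c * d * P i 0 * D j 0)))).
by field.
Qed.

Lemma act_GL2_invariant s f g : R f -> coord_act s (f * g) = f * coord_act s g.
Proof. by move=> /(_ s) hf; rewrite -{2}hf /coord_act /sym_act rmorphM. Qed.

Lemma coord_actB s f g : coord_act s (f - g) = coord_act s f - coord_act s g :> T.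
Proof. by rewrite /coord_act /sym_act rmorphB. Qed.

Lemma gvecE s (v : 'cV[K]_(gdim (W0 hK))) i : gvec (M := W0 hK) s v (w0 hK i) 0 =
  (\det s)^-1 * (s i 0 ^+ 2 * v (w0 hK 0) 0 + s i 1 ^+ 2 * v (w0 hK 1) 0).
Proof.
rewrite /gvec mxE; transitivity (\sum_(a < 2 * 1) gmat (W0 hK) s (w0 hK i) a * v a 0); first by [].
by rewrite sum_w0 /w0 /= !tensmxE !mxE /= mulr1n; ring.
Qed.

Lemma coord_actD s f g : coord_act s (f + g) = coord_act s f + coord_act s g :> T.
Proof. by rewrite /coord_act /sym_act rmorphD. Qed.

Lemma cocycle_g_cocycle : cocycle (@gvec K (W0 hK)) cocycle_g.
Proof.
split.
  exists (gdim (W0 hK)), (fun i => delta_mx i 0), (fun i s => cocycle_g s i 0); split=> [a|s]; last first.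
    by rewrite {1}[cocycle_g s]matrix_sum_delta; apply: eq_bigr => i _; rewrite big_ord1.
  apply: (@eq_regular _ (fun s : GL2 K => (\det s)^-1 * (s (@mxtens_unindex 2 1 a).1 0 * s (@mxtens_unindex 2 1 a).1 1))).
    by move=> s; rewrite mxE.
  by apply: regularM; [apply: regular_detV | apply: regularM; apply: regular_entry].
move=> s t; apply/colP => a; rewrite -[a](w0_unindex hK); set i := (mxtens_unindex a).1.
rewrite [RHS]mxE gvecE !cocycle_gE GL2valM !mxE.
have ds := det_neq0 s; have dt := det_neq0 t.
rewrite det_mulmx !detE !sum2.
move: (s i 0) (s i 1) => x y.
move: (s 0 0) (s 0 1) (s 1 0) (s 1 1) ds (t 0 0) (t 0 1) (t 1 0) (t 1 1) dt.
move=> a1 b1 c1 d1 ds a2 b2 c2 d2 dt.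
apply: (eq_mod2 hK (z := (a1 * d1 - b1 * c1)^-1 * (a2 * d2 - b2 * c2)^-1 * x * y * b2 * c2)).
field.
by rewrite ds dt.
Qed.

Lemma coord_act_in_W0 s v : coord_act s (in_W0 v) = in_W0 (gvec (M := W0 hK) s v).
Proof.
apply: fun_vfam_eq => Z P D; rewrite act_eval !meval_inW0 !gvecE /actZ.
ring.
Qed.

Lemma in_W0D v w : in_W0 (hK := hK) (v + w) = in_W0 v + in_W0 w.
Proof.
by apply: fun_vfam_eq => Z P D; rewrite mevalD !meval_inW0 !mxE; ring.
Qed.

Lemma in_W0_cocycle : cocycle (@coord_act K (V hK)) (fun s => in_W0 (cocycle_g s)).
Proof.
have [[m [u [f [hf e]]]] hc] := cocycle_g_cocycle; split.
  exists m, (fun i => in_W0 (u i)), f; split=> // s; rewrite e.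
  apply: fun_vfam_eq => Z P D; rewrite meval_inW0 rmorph_sum /= !summxE !mulr_suml -big_split /=.
  by apply: eq_bigr => i _; rewrite mevalZ meval_inW0 !mxE; ring.
by move=> s t; rewrite hc in_W0D -coord_act_in_W0.
Qed.

End Invariants.

Section Nontrivial.
Variables (K : closedFieldType) (hK : 2%N \in [pchar K]).

Definition mx2 (a b c d : K) : 'M[K]_2 :=
  \matrix_(i, j) if i == 0 then (if j == 0 then a else b) else (if j == 0 then c else d).

Lemma mx2_unit a b c d : a * d - b * c != 0 -> mx2 a b c d \in unitmx.
Proof.
move=> h; rewrite unitmxE unitfE (expand_det_row _ 0) sum2 /cofactor !det_mx11 !mxE /=.
by rewrite expr0 mul1r mulN1r mulrN.
Qed.

Definition GL2_of a b c d (h : a * d - b * c != 0) : GL2 K := MkGL2 (mx2_unit h).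

Lemma GL2_ofE a b c d (h : a * d - b * c != 0) :
  [/\ GL2_of h 0 0 = a, GL2_of h 0 1 = b, GL2_of h 1 0 = c & GL2_of h 1 1 = d].
Proof. by rewrite /= !mxE. Qed.

(** A primitive of the cocycle would restrict, on the upper unipotent matrices
    and at [Z = (1, 0)], to a polynomial [p] with [p (t ^ 2) = p 0 + t], which
    has derivative both 0 and 1. *)
Lemma cocycle_g_nontrivial : ~ coboundary (@coord_act K (V hK)) (fun s => in_W0 (cocycle_g hK s)).
Proof.
move=> [f hf]; pose nul (i j : 'I_2) : K := 0.
pose Z0 (i : 'I_2) : K := (i == 0)%:R; pose Z1 (i : 'I_2) : K := (i == 1)%:R.
have [p hp] := line_poly f (vfam (hK := hK) Z0 nul nul) (vfam (hK := hK) Z1 nul nul).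
have eq_t (t : K) : p.[t ^+ 2] = p.[0] + t.
  have h1 : 1 * 1 - t * 0 != 0 :> K by rewrite mulr1 mulr0 subr0 oner_neq0.
  pose s := GL2_of h1; have [s00 s01 s10 s11] := GL2_ofE h1; rewrite -/s in s00 s01 s10 s11.
  have ds : \det s = 1 by rewrite detE s00 s01 s10 s11 mulr1 mulr0 subr0.
  have := congr1 (meval (vfam Z0 nul nul)) (hf s); rewrite mevalB act_eval meval_inW0 !cocycle_gE.
  rewrite ds s00 s01 s10 s11 invr1 /Z0 /= !mul1r mulr1 mul0r mulr0 addr0 => /esym/eqP.
  rewrite subr_eq addrC => /eqP e.
  have -> : p.[0] = f.@[vfam Z0 nul nul].
    by rewrite hp; apply: meval_eq => k; rewrite mul0r addr0.
  rewrite -e hp; apply: meval_eq => k.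
  case: (pPD_cases k) => [[i ->]|[i [j ->]]|[i [j ->]]]; rewrite ?vfamZ ?vfamP ?vfamD.
  - rewrite /actZ ds invr1 mul1r /Z0 /Z1.
    case: (I2_cases i) => ->; rewrite ?s00 ?s01 ?s10 ?s11 /=; ring.
  - by rewrite /actP /nul; ring.
  - by rewrite /actD /nul; ring.
have e : p \Po 'X^2 = p.[0]%:P + 'X.
  apply/eqP; rewrite -subr_eq0; apply/eqP; apply/eqP; apply: contraT => /closed_nonrootP [t].
  by rewrite rootE !(hornerD, hornerN, horner_comp, hornerXn, hornerC, hornerX) eq_t subrr eqxx.
have := congr1 (fun r : {poly K} => r^`()`_0) e.
rewrite deriv_comp derivD derivC derivX derivXn add0r coef1 /=.
rewrite -mulr_natr -polyC_natr (pcharf0 hK) polyC0 !mulr0 coef0 => /esym/eqP.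
by rewrite oner_eq0.
Qed.

End Nontrivial.

(** * Isomorphisms of modules *)

Section Isomorphisms.
Variable K : fieldType.

Lemma giso_refl (M : gmodule K) : giso M M.
Proof.
by exists 1%:M, 1%:M; split=> [||s]; rewrite ?mulmx1 // mul1mx.
Qed.

Lemma giso_sum (M M' N N' : gmodule K) : giso M M' -> giso N N' -> giso (gsum M N) (gsum M' N').
Proof.
move=> [A [B [AB BA hA]]] [C [D [CD DC hC]]].
exists (block_mx A 0 0 C), (block_mx B 0 0 D); split=> [||s].
- by rewrite mulmx_block !(mulmx0, mul0mx, addr0, add0r) AB CD -scalar_mx_block.
- by rewrite mulmx_block !(mulmx0, mul0mx, addr0, add0r) BA DC -scalar_mx_block.
- by rewrite /= !mulmx_block !(mulmx0, mul0mx, addr0, add0r) hA hC.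
Qed.

Lemma giso_Wi_dual : giso (gdual (Wi K)) (Wi K).
Proof.
exists (block_mx 0 1%:M 1%:M 0), (block_mx 0 1%:M 1%:M 0); split=> [||s].
- by rewrite mulmx_block !(mulmx0, mul0mx, mulmx1, addr0, add0r) -scalar_mx_block.
- by rewrite mulmx_block !(mulmx0, mul0mx, mulmx1, addr0, add0r) -scalar_mx_block.
- rewrite /= tr_block_mx !trmx0 trmxK !mulmx_block !(mulmx0, mul0mx, mulmx1, mul1mx, addr0, add0r).
  by rewrite -[invmx (invmx s)]/(GL2val (s^-1^-1)%g) invgK.
Qed.

End Isomorphisms.

Section IsoDual.
Variables (K : closedFieldType) (hK : 2%N \in [pchar K]).

(** In characteristic 2 the symplectic form identifies the dual of the natural
    module with its twist by the inverse of the determinant. *)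
Lemma giso_dual_nat : giso (gdual (gnat K)) (gtens (gnat K) (gdetV K)).
Proof.
pose A : 'M[K]_(2 * 1, 2) := \matrix_(a, j) ((@mxtens_unindex 2 1 a).1 != j)%:R.
have AE i j : A (@mxtens_index 2 1 (i, 0)) j = (i != j)%:R by rewrite mxE mxtens_indexK.
have sw (F : 'I_(2 * 1) -> K) : \sum_a F a = F (@mxtens_index 2 1 (0, 0)) + F (@mxtens_index 2 1 (1, 0)).
  exact: (sum_w0 hK F).
have idx (a : 'I_(2 * 1)) : exists i, a = @mxtens_index 2 1 (i, 0).
  by case: (@mxtens_indexP 2 1 a) => i j; exists i; rewrite (ord1 j).
exists A, A^T; split=> [||s].
- apply/matrixP => a b; case: (idx a) (idx b) => i -> [j ->].
  rewrite mxE sum2 ![A^T _ _]mxE !AE !mxE (can_eq (@mxtens_indexK 2 1)) xpair_eqE eqxx andbT.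
  by case: (I2_cases i) (I2_cases j) => [] -> [] ->; rewrite /= ?mulr0 ?mulr1 ?mul0r ?addr0 ?add0r.
- apply/matrixP => i j; rewrite mxE sw ![A^T _ _]mxE !AE !mxE.
  by case: (I2_cases i) (I2_cases j) => [] -> [] ->; rewrite /= ?mulr0 ?mulr1 ?mul0r ?addr0 ?add0r.
- apply/matrixP => a j; case: (idx a) => i ->.
  rewrite [LHS]mxE [RHS]mxE sum2 sw !AE /= !tensmxE ![(invmx s)^T _ _]mxE -![invmx s]/(GL2val (s^-1)%g).
  have [e00 e01 e10 e11] := invE s; rewrite !mxE /= mulr1n.
  have cN (x : K) : - x = x by rewrite oppr_pchar2.
  by case: (I2_cases i) (I2_cases j) => [] -> [] ->; rewrite /= ?e00 ?e01 ?e10 ?e11 ?cN; ring.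
Qed.

Lemma giso_Vstar : giso (Vstar hK) (Vstar' hK).
Proof.
have h : giso (Wi K) (Wi' K) by apply: giso_sum; [exact: giso_refl | exact: giso_dual_nat].
by apply: giso_sum; [exact: giso_refl | exact: giso_sum].
Qed.

End IsoDual.

(** * Adjoining square roots of the two variables of [W0] *)

Section Iota.
Variables (K : closedFieldType) (hK : 2%N \in [pchar K]).
Local Notation T := {mpoly K[gdim (gdual (V hK))]}.
Local Notation S := {mpoly K[5 + 5]}.
Local Notation R := (invariant_ring (V hK)).

Definition two (A : Type) (a b : A) (i : 'I_2) : A := if i == 0 then a else b.

(** Square roots of the variables of [W0] form a vector of the natural module of
    SL_2, and the dual vectors are rotated so that the pairing becomes a
    bracket. *)
Definition embed : T -> S := psub (vfam (hK := hK)
  (two ('X_(vX iz) ^+ 2) ('X_(vY iz) ^+ 2))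
  (fun i => two 'X_(vX (iv i)) 'X_(vY (iv i)))
  (fun i => two 'X_(vY (iw i)) 'X_(vX (iw i)))).
HB.instance Definition _ := GRing.RMorphism.on embed.

Lemma ev_embed f x y : ev (embed f) x y = f.@[vfam (two (x iz ^+ 2) (y iz ^+ 2))
  (fun i => two (x (iv i)) (y (iv i))) (fun i => two (y (iw i)) (x (iw i)))].
Proof.
rewrite /ev meval_psub; apply: meval_eq => k.
case: (pPD_cases k) => [[i ->]|[i [j ->]]|[i [j ->]]]; rewrite ?vfamZ ?vfamP ?vfamD.
- by case: (I2_cases i) => ->; rewrite /two /= rmorphXn /= -/(ev _ _ _) ?evX ?evY.
- by case: (I2_cases j) => ->; rewrite /two /= -/(ev _ _ _) ?evX ?evY.
- by case: (I2_cases j) => ->; rewrite /two /= -/(ev _ _ _) ?evX ?evY.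
Qed.

Lemma sqrt_exists (a : K) : exists b, b ^+ 2 = a.
Proof.
have : size ('X^2 - a%:P : {poly K}) != 1%N by rewrite size_XnsubC.
case/closed_rootP => b; rewrite rootE !hornerE subr_eq0 => /eqP e; by exists b.
Qed.

Lemma embed_inj : injective embed.
Proof.
suff h f : embed f = 0 -> f = 0.
  by move=> f g e; apply/eqP; rewrite -subr_eq0; apply/eqP/h; rewrite rmorphB /= e subrr.
move=> e; apply: fun_vfam_eq => Z P D; rewrite meval0.
have [z0 ez0] := sqrt_exists (Z 0); have [z1 ez1] := sqrt_exists (Z 1).
have [x1 x2 x3] := five_funE (fun i => P i 0) (fun i => D i 1) z0.
have [y1 y2 y3] := five_funE (fun i => P i 1) (fun i => D i 0) z1.
have := ev_embed f (five_fun (fun i => P i 0) (fun i => D i 1) z0) (five_fun (fun i => P i 1) (fun i => D i 0) z1).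
rewrite e [LHS]/ev meval0 => ->; apply: meval_eq; apply: vfam_ext => [i|i j|i j]; rewrite /two.
- by case: (I2_cases i) => ->; rewrite /= ?x3 ?y3.
- by case: (I2_cases j) => ->; rewrite /= ?x1 ?y1.
- by case: (I2_cases j) => ->; rewrite /= ?x2 ?y2.
Qed.

Lemma sqrD2 (x y : K) : (x + y) ^+ 2 = x ^+ 2 + y ^+ 2.
Proof. by rewrite -!(pFrobenius_autE hK) rmorphD. Qed.

Lemma invariant_inC f : R f -> inC (embed f).
Proof.
move/invariantP => hf; have cN (x : K) : - x = x by rewrite oppr_pchar2.
apply: invariants_generated => [a b c e det x y|t t0 x y]; rewrite !ev_embed.
  have h : a * e - b * c != 0 by rewrite det oner_neq0.
  have [s00 s01 s10 s11] := GL2_ofE h; set s := GL2_of h in s00 s01 s10 s11.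
  have ds : \det s = 1 by rewrite detE s00 s01 s10 s11.
  have [i00 i01 i10 i11] := invE s; rewrite ds invr1 !mul1r ?s00 ?s01 ?s10 ?s11 ?cN in i00 i01 i10 i11.
  rewrite -[RHS](hf s); apply: meval_eq; apply: vfam_ext => [i|i j|i j]; rewrite /two.
  - rewrite /actZ ds invr1 mul1r; case: (I2_cases i) => ->; rewrite /= ?s00 ?s01 ?s10 ?s11 sqrD2; ring.
  - rewrite /actP; case: (I2_cases j) => ->; rewrite /= ?s00 ?s01 ?s10 ?s11; ring.
  - rewrite /actD; case: (I2_cases j) => ->; rewrite /= ?i00 ?i01 ?i10 ?i11; ring.
have h : t * t - 0 * 0 != 0 by rewrite mulr0 subr0 mulf_neq0.
have [s00 s01 s10 s11] := GL2_ofE h; set s := GL2_of h in s00 s01 s10 s11.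
have ds : \det s = t * t by rewrite detE s00 s01 s10 s11 mulr0 subr0.
have [i00 i01 i10 i11] := invE s; rewrite ds ?s00 ?s01 ?s10 ?s11 in i00 i01 i10 i11.
have [t1 t2 t3] := torusE t.
rewrite -[RHS](hf s); apply: meval_eq; apply: vfam_ext => [i|i j|i j]; rewrite /two.
- by rewrite /actZ ds !t3; case: (I2_cases i) => ->; rewrite /= ?s00 ?s01 ?s10 ?s11; field.
- by rewrite /actP !t1; case: (I2_cases j) => ->; rewrite /= ?s00 ?s01 ?s10 ?s11; ring.
- by rewrite /actD !t2; case: (I2_cases j) => ->; rewrite /= ?i00 ?i01 ?i10 ?i11; field.
Qed.

Lemma embed_Q i j : embed (Qel hK i j) = qq K i j.
Proof.
apply: ev_inj => x y; rewrite ev_embed meval_Q ev_bracket /two /=.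
by apply: (eq_mod2 hK (z := x (iw j) * y (iv i))); ring.
Qed.

Lemma embed_M i j : embed (Mel hK i j) = NN K i j ^+ 2.
Proof.
apply: ev_inj => x y; rewrite ev_embed meval_M /NN exprMn evM.
have evX2 f : ev (f ^+ 2) x y = ev f x y ^+ 2 by rewrite /ev rmorphXn.
rewrite !evX2 !ev_bracket /two /=; congr (_ * _).
  by apply: (eq_mod2 hK (z := x iz * y (iv i) * x (iv i) * y iz)); ring.
by apply: (eq_mod2 hK (z := x iz * y (iw j) * x (iw j) * y iz)); ring.
Qed.

Lemma genC2_invariant f : subalg (@genC2 K) f -> exists2 r, R r & embed r = f.
Proof.
elim=> [c|g [[i [j ->]]|[i [j ->]]]|g h _ [g' hg <-] _ [h' hh <-]|g h _ [g' hg <-] _ [h' hh <-]].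
- by exists c%:MP; [apply: invariantC | rewrite /embed mmapC].
- by exists (Qel hK i j ^+ 2); [apply/invariantX/Q_invariant | rewrite rmorphXn /= embed_Q].
- by exists (Mel hK i j); [apply: M_invariant | rewrite embed_M].
- by exists (g' + h'); [apply: invariantD | rewrite rmorphD].
- by exists (g' * h'); [apply: invariantM | rewrite rmorphM].
Qed.

End Iota.

(** * A homogeneous system of parameters *)

(** Finiteness is transitive. *)
Lemma aspan_tower (A A' T : comNzRingType) (phi : {rmorphism A -> T}) (psi : {rmorphism A' -> T})
    (b b1 : seq T) :
  (forall a u, u \in b1 -> aspan psi b1 (phi a * u)) ->
  forall u f, u \in b1 -> aspan phi b f -> aspan psi [seq x * y | x <- b1, y <- b] (u * f).
Proof.
move=> h u f hu /aspanE [c ->]; rewrite mulr_sumr; apply: aspan_sum => i _.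
rewrite mulrCA mulrA; have /aspanE [d ->] := h (c i) u hu.
rewrite mulr_suml; apply: aspan_sum => j _; rewrite -mulrA; apply: aspanZ.
by apply: aspan_mem; apply/allpairsP; exists (b1`_j, b`_i); rewrite !mem_nth.
Qed.

(** By Noether normalization, the algebra generated by [n + 1] algebraically
    dependent elements is finite over one generated by [n] elements. *)
Lemma dependent_finite (K : closedFieldType) N n (s : 'I_n.+1 -> {mpoly K[N]}) P :
  P != 0 -> psub s P = 0 -> exists (y : 'I_n -> {mpoly K[N]}) (b : seq {mpoly K[N]}),
    aspan (psub y) b 1 /\ forall F u, u \in b -> aspan (psub y) b (psub s F * u).
Proof.
move=> nzP eP; have [Psi [Th [c [PsiK ThK PsiC nzc mon]]]] := noether_change nzP.
have [phi phiE0] : exists phi : {rmorphism {mpoly K[n.+1]} -> {mpoly K[N]}}, forall F, phi F = psub s F.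
  by exists (psub s).
have phiC a : phi a%:MP = a%:MP by rewrite phiE0 mmapC.
rewrite -phiE0 in eP.
pose y (j : 'I_n) := phi (Th ('X_j)%:P); pose x := phi (Th 'X).
have ThC a : Th (a%:MP)%:P = a%:MP by rewrite -PsiC PsiK.
have phiTh : phi \o (Th \o @polyC _) =1 psub y.
  apply: mpoly_rmorph_ext => [a|j] /=; first by rewrite ThC mmapC phiC.
  by rewrite mmapXU.
have phiE (p : {poly {mpoly K[n]}}) : phi (Th p) = (map_poly (psub y) p).[x].
  elim/poly_ind: p => [|p a ih]; first by rewrite (rmorph0 Th) (rmorph0 phi) (rmorph0 (map_poly _)) horner0.
  rewrite (rmorphD Th) (rmorphM Th) (rmorphD phi) (rmorphM phi) /= ih -/((phi \o (Th \o @polyC _)) a) phiTh.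
  by rewrite (rmorphD (map_poly _)) (rmorphM (map_poly _)) /= map_polyX map_polyC /= !hornerE.
have ix : integralOver (psub y) x.
  exists (Psi (c%:MP * P)) => //; apply/rootP.
  by rewrite -phiE PsiK (rmorphM phi) eP mulr0.
have [|b [h1 hb]] := @integral_finite _ _ (psub y) [:: x].
  by move=> z; rewrite inE => /eqP ->.
exists y, b; split=> // F u hu.
have hx v : aspan (psub y) b v -> aspan (psub y) b (x * v).
  move/aspanE => [d ->]; rewrite mulr_sumr; apply: aspan_sum => i _; rewrite mulrCA; apply: aspanZ.
  by apply: hb; [rewrite mem_head | apply: mem_nth].
rewrite -phiE0 -[F]PsiK phiE horner_coef mulr_suml; apply: aspan_sum => i _.
rewrite coef_map -mulrA; apply: aspanZ; elim: (i : nat) => [|k ih].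
  by rewrite expr0 mul1r; apply: aspan_mem.
by rewrite exprS -mulrA; apply: hx.
Qed.

Section InvariantHsop.
Variables (K : closedFieldType) (hK : 2%N \in [pchar K]).
Local Notation T := {mpoly K[gdim (gdual (V hK))]}.
Local Notation S := {mpoly K[5 + 5]}.
Local Notation R := (invariant_ring (V hK)).
Local Notation Q := (Qel hK).
Local Notation M := (Mel hK).
Local Notation embed := (@embed K hK).
Local Notation phi := (psub (tnth (six_params K))).

(** Otherwise, by Noether normalization, the algebra of the [q i j] and [N i j]
    would be finite over five elements, but it has dimension at least six. *)
Lemma six_params_indep (P : {mpoly K[6]}) : phi P = 0 -> P = 0.
Proof.
move=> eP; apply/eqP; apply: contraT => nzP.
have [y [b1 [h1 hphi]]] := dependent_finite nzP eP.
have [b [hb hbC]] := C_finite hK.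
have tower := aspan_tower hphi (b := b).
pose b2 := [seq u * v | u <- b1, v <- b].
have [||P' nz' e'] := @dependent_over_fewer _ _ 5 6 y b2 (tnth (six_indep K)) isT.
- rewrite -[1]mul1r; move/aspanE: h1 => [d e1]; rewrite {1}e1 mulr_suml.
  apply: aspan_sum => i _; rewrite -mulrA; apply: aspanZ.
  by apply: tower => //; apply: mem_nth.
- move=> j _ /allpairsP [[u v] /= [hu hv ->]]; rewrite mulrCA; apply: tower => //.
  apply: hbC; last exact: aspan_mem.
  rewrite (tnth_nth 0); case: j => [[|[|[|[|[|[|]]]]]]] //= _; solve [exact: inC_q | exact: inC_N].
by rewrite (six_indepP e') eqxx in nz'.
Qed.

Definition hsop6 : 6.-tuple T :=
  [tuple Q 0 0; Q 1 1; Q 0 1; M 0 1 + M 1 0; M 0 0 + M 1 1; M 0 0 + Q 1 0 ^+ 3].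

Lemma embed_hsop6 i : embed (tnth hsop6 i) = tnth (six_params K) i.
Proof.
rewrite !(tnth_nth 0); case: i => [[|[|[|[|[|[|]]]]]]] //= _.
- exact: embed_Q.
- exact: embed_Q.
- exact: embed_Q.
- by rewrite (rmorphD embed (M 0 1)) /= !embed_M.
- by rewrite (rmorphD embed (M 0 0)) /= !embed_M.
- by rewrite (rmorphD embed (M 0 0)) (rmorphXn embed) /= embed_M embed_Q.
Qed.

Lemma hsop6_invariant i : R (tnth hsop6 i).
Proof.
rewrite (tnth_nth 0); case: i => [[|[|[|[|[|[|]]]]]]] //= _.
- exact: Q_invariant.
- exact: Q_invariant.
- exact: Q_invariant.
- by apply: invariantD; apply: M_invariant.
- by apply: invariantD; apply: M_invariant.
- by apply: invariantD; [apply: M_invariant | apply/invariantX/Q_invariant].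
Qed.

Lemma embed_psub n (y : 'I_n -> T) P : embed (psub y P) = psub (fun i => embed (y i)) P.
Proof. by rewrite /embed psub_comp. Qed.

Lemma embed_psub_hsop6 P : embed (psub (tnth hsop6) P) = phi P.
Proof. by rewrite embed_psub; apply: psub_eq => i; apply: embed_hsop6. Qed.

Lemma hsop6_indep (P : {mpoly K[6]}) : psub (tnth hsop6) P = 0 -> P = 0.
Proof. by move=> e; apply: six_params_indep; rewrite -embed_psub_hsop6 e rmorph0. Qed.

(** The invariants embed in a finite module over the noetherian ring of
    polynomials in the parameters. *)
Lemma invariants_finite : exists b : seq T, (forall x, x \in b -> R x) /\
  forall f, R f -> aspan (psub (tnth hsop6)) b f.
Proof.
have [b [b1 hb]] := C_finite hK.
pose X (g : S) := exists2 f, R f & embed f = g.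
have hX : submodule phi X.
  split.
  - by exists 0; [apply: invariant0 | rewrite rmorph0].
  - by move=> _ _ [f hf <-] [g hg <-]; exists (f + g); [apply: invariantD | rewrite rmorphD].
  - move=> a _ [f hf <-]; exists (psub (tnth hsop6) a * f).
      by apply: invariantM => //; apply: invariant_psub; apply: hsop6_invariant.
    by rewrite rmorphM /= embed_psub_hsop6.
have [|L [hL1 hL2]] := noetherian_submodule (b := b) (@mpoly_noetherian 6 K) hX.
  by move=> _ [f hf <-]; rewrite -[embed f]mulr1; apply: hb => //; apply: invariant_inC.
have [L' [h1 h2]] := list_choice (P := fun g f => R f /\ embed f = g)
  (fun g hg => let: ex_intro2 f hf e := hL1 g hg in ex_intro _ f (conj hf e)).
exists L'; split; first by move=> x /h1 [g _ []].
move=> f hf; have /aspanE [c ec] := hL2 _ (ex_intro2 _ _ f hf erefl).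
suff [g hg eg] : exists2 g, aspan (psub (tnth hsop6)) L' g & embed g = embed f.
  by rewrite -(embed_inj eg).
rewrite ec; apply: (big_ind (fun s => exists2 g, aspan (psub (tnth hsop6)) L' g & embed g = s)).
- by exists 0; [apply: aspan0 | rewrite rmorph0].
- by move=> _ _ [g hg <-] [g' hg' <-]; exists (g + g'); [apply: aspanD | rewrite rmorphD].
- move=> i _; have [g hg [Rg eg]] := h2 _ (mem_nth 0 (ltn_ord i)).
  exists (psub (tnth hsop6) (c i) * g); first by apply/aspanZ/aspan_mem.
  by rewrite rmorphM /= eg embed_psub_hsop6.
Qed.

Lemma Q_homog i j : Q i j \is 2.-homog.
Proof. by apply: rpredD; apply: (@dhomogM _ _ _ 1 _ 1); rewrite dhomogX /= mdeg1. Qed.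

Lemma hsop6_homog f : f \in hsop6 -> exists d, f \is d.-homog.
Proof.
have hZ i : ('X_(pZ hK i) : T) \is 1.-homog by rewrite dhomogX /= mdeg1.
have hP i j : ('X_(pP hK i j) : T) \is 1.-homog by rewrite dhomogX /= mdeg1.
have hD i j : ('X_(pD hK i j) : T) \is 1.-homog by rewrite dhomogX /= mdeg1.
have hQ := Q_homog.
have hM i j : M i j \is 6.-homog.
  have h2 (u : T) : u \is 1.-homog -> u ^+ 2 \is 2.-homog by move/(dhomogMn 2).
  by apply: (@dhomogM _ _ _ 3 _ 3); apply: rpredD; apply: (@dhomogM _ _ _ 1 _ 2) => //; apply: h2.
rewrite !inE => /or4P[/eqP ->|/eqP ->|/eqP ->|/or3P[/eqP ->|/eqP ->|/eqP ->]].
- by exists 2.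
- by exists 2.
- by exists 2.
- by exists 6; apply: rpredD.
- by exists 6; apply: rpredD.
- by exists 6; apply: rpredD => //; apply: (dhomogMn 3 (hQ 1 0)).
Qed.

Lemma hsop6_hsop : hsop R hsop6.
Proof.
split.
- move=> f hf; split; last exact: hsop6_homog.
  by have /tnthP [i ->] := hf; apply: hsop6_invariant.
- move=> P e; apply: hsop6_indep; rewrite -[RHS]e comp_psub; apply: psub_eq => i.
  by rewrite !(tnth_nth 0).
- have [b [hb1 hb2]] := invariants_finite.
  exists (size b), (fun i => b`_i); split=> [i|f /hb2 /aspanE [c e]]; first by apply: hb1; apply: mem_nth.
  exists (fun i => psub (tnth hsop6) (c i)); split=> // i.
  by exists (c i); rewrite comp_psub; apply: psub_eq => k; rewrite !(tnth_nth 0).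
Qed.

End InvariantHsop.

(** * Regular sequences on a free module *)

Section FreeModule.
Variables (A T : comNzRingType) (phi : {rmorphism A -> T}) (M B : T -> Prop).
Hypothesis hM : submodule phi M.
Hypothesis BM : forall f, B f -> M f.
Hypothesis Bspan : forall f, M f -> exists k (b : 'I_k -> T) (c : 'I_k -> A),
  (forall i, B (b i)) /\ f = \sum_i phi (c i) * b i.
Hypothesis Bfree : forall k (b : 'I_k -> T) (c : 'I_k -> A), injective b ->
  (forall i, B (b i)) -> \sum_i phi (c i) * b i = 0 -> forall i, c i = 0.

Lemma regroup k l (b : 'I_k -> T) (c : 'I_k -> A) (b' : 'I_l -> T) :
  injective b' -> (forall i, exists j, b i = b' j) ->
  \sum_i phi (c i) * b i = \sum_j phi (\sum_(i | b i == b' j) c i) * b' j.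
Proof.
move=> inj hb; under [RHS]eq_bigr => j _ do rewrite rmorph_sum mulr_suml.
rewrite [RHS](exchange_big_dep xpredT) //=; apply: eq_bigr => i _.
have [j ej] := hb i; rewrite (big_pred1 j) ?ej // => j' /=.
by rewrite (inj_eq inj) eq_sym.
Qed.

Lemma common_basis f g h : M f -> M g -> M h ->
  exists k (b : 'I_k -> T) (cf cg ch : 'I_k -> A), [/\ injective b, forall i, B (b i),
    f = \sum_i phi (cf i) * b i, g = \sum_i phi (cg i) * b i & h = \sum_i phi (ch i) * b i].
Proof.
move=> /Bspan [k1 [b1 [c1 [hb1 ->]]]] /Bspan [k2 [b2 [c2 [hb2 ->]]]] /Bspan [k3 [b3 [c3 [hb3 ->]]]].
pose L := undup (codom b1 ++ codom b2 ++ codom b3).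
have memL x : x \in codom b1 ++ codom b2 ++ codom b3 -> exists i : 'I_(size L), x = L`_i.
  rewrite -mem_undup => hx; have lt : (index x L < size L)%N by rewrite index_mem.
  by exists (Ordinal lt); rewrite nth_index.
have inj : injective (fun i : 'I_(size L) => L`_i).
  by move=> i j /eqP; rewrite nth_uniq ?undup_uniq // => /eqP /val_inj.
pose coef l (b : 'I_l -> T) (c : 'I_l -> A) (j : 'I_(size L)) := \sum_(i | b i == L`_j) c i.
exists (size L), (fun i => L`_i), (coef _ b1 c1), (coef _ b2 c2), (coef _ b3 c3).
split; [exact: inj | | | | ].
- move=> i; have : L`_i \in L by apply: mem_nth.
  by rewrite mem_undup !mem_cat => /or3P[/codomP [j ->]|/codomP [j ->]|/codomP [j ->]].
- by apply: regroup inj _ => i; apply: memL; rewrite mem_cat codom_f.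
- by apply: regroup inj _ => i; apply: memL; rewrite !mem_cat codom_f orbT.
- by apply: regroup inj _ => i; apply: memL; rewrite !mem_cat codom_f !orbT.
Qed.

Lemma span_basis k (b : 'I_k -> T) (c : 'I_k -> A) :
  (forall i, B (b i)) -> M (\sum_i phi (c i) * b i).
Proof. by case: hM => h0 hD hZ hb; apply: (big_ind M) => // i _; apply/hZ/BM. Qed.

(** An equation between elements of the free module is a system of equations
    between coefficients, one for each basis element. *)
Lemma regular2_free F1 F2 : (forall a b, F1 * a = F2 * b -> exists e, b = F1 * e) ->
  forall f g, M f -> M g -> phi F1 * f = phi F2 * g -> exists2 h, M h & g = phi F1 * h.
Proof.
move=> reg f g hf hg; have [h0 _ _] := hM.
have [k [b [cf [cg [_ [inj hb -> -> _]]]]]] := common_basis hf hg h0.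
rewrite !mulr_sumr => /eqP; rewrite -subr_eq0 -sumrB => /eqP e.
have {}e : \sum_i phi (F1 * cf i - F2 * cg i) * b i = 0.
  by rewrite -[RHS]e; apply: eq_bigr => i _; rewrite rmorphB !rmorphM mulrBl !mulrA.
have /fin_all_exists [E hE] (i : 'I_k) : exists x, cg i = F1 * x.
  by apply: (reg (cf i)); apply/eqP; rewrite -subr_eq0 (Bfree inj hb e).
exists (\sum_i phi (E i) * b i); first exact: span_basis.
by rewrite mulr_sumr; apply: eq_bigr => i _; rewrite hE rmorphM mulrA.
Qed.

Lemma regular3_free F1 F2 F3 :
  (forall c a b, F3 * c = F1 * a + F2 * b -> exists u w, c = F1 * u + F2 * w) ->
  forall f g h, M f -> M g -> M h -> phi F3 * h = phi F1 * f + phi F2 * g ->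
  exists u w, [/\ M u, M w & h = phi F1 * u + phi F2 * w].
Proof.
move=> reg f g h hf hg hh.
have [k [b [cf [cg [ch [inj hb -> -> ->]]]]]] := common_basis hf hg hh.
rewrite !mulr_sumr -big_split => /eqP; rewrite -subr_eq0 -sumrB => /eqP e.
have {}e : \sum_i phi (F3 * ch i - (F1 * cf i + F2 * cg i)) * b i = 0.
  by rewrite -[RHS]e; apply: eq_bigr => i _; rewrite rmorphB rmorphD !rmorphM mulrBl mulrDl !mulrA.
have /fin_all_exists [E hE] (i : 'I_k) : exists x, ch i = F1 * x.1 + F2 * x.2.
  have [|u [w ->]] := reg (ch i) (cf i) (cg i); last by exists (u, w).
  by apply/eqP; rewrite -subr_eq0 (Bfree inj hb e).
exists (\sum_i phi (E i).1 * b i), (\sum_i phi (E i).2 * b i); split; try exact: span_basis.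
rewrite !mulr_sumr -big_split; apply: eq_bigr => i _.
by rewrite hE rmorphD !rmorphM mulrDl !mulrA.
Qed.

End FreeModule.

(** * The invariant ring is not Cohen-Macaulay *)

Section NotCM.
Variables (K : closedFieldType) (hK : 2%N \in [pchar K]).
Local Notation T := {mpoly K[gdim (gdual (V hK))]}.
Local Notation R := (invariant_ring (V hK)).
Local Notation Q := (Qel hK).
Local Notation U := (Uel hK).
Local Notation act := (@coord_act K (V hK)).
Local Notation g s := (in_W0 (cocycle_g hK s)).

Lemma Q_neq0 i j : Q i j != 0.
Proof.
apply/eqP => /(congr1 (meval (vfam (fun=> 0) (fun _ _ => 1) (fun _ k => (k == 0)%:R)))).
by rewrite meval_Q meval0 /= mulr1 mulr0 addr0 => /eqP; rewrite oner_eq0.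
Qed.

Lemma char2_opp (x : T) : - x = x.
Proof. by rewrite oppr_pchar2 //; apply: pchar2S. Qed.

Definition pairing_ideal (f : T) := exists r : 'I_2 -> 'I_2 -> T,
  (forall i j, R (r i j)) /\ f = \sum_i \sum_j Q i j * r i j.

Lemma pairing_ideal_annihilates f : pairing_ideal f -> exists u, forall s, act s u - u = f * g s.
Proof.
move=> [r [hr ->]]; exists (\sum_i \sum_j r i j * U i j) => s.
have actU i j : act s (U i j) = U i j + Q i j * g s by rewrite -U_cocycle addrC subrK.
rewrite !sum2 !coord_actD !act_GL2_invariant // !actU; ring.
Qed.

(** Four invariants are dependent modulo the [q i j] in the larger algebra
    generated by the [q i j] and [N i j]; squaring the dependence relation
    brings it back to the invariants. *)
Lemma dependent_mod_ideal m (y : 'I_m -> T) : (4 <= m)%N -> (forall i, R (y i)) ->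
  exists2 P : {mpoly K[m]}, P != 0 & pairing_ideal (psub y P).
Proof.
move=> hm hy; have [P nz [c [hc e]]] := dependent_mod_q hm (fun i => invariant_inC (hy i)).
exists (P ^+ 2); first by rewrite expf_neq0.
have hc2 (ij : 'I_2 * 'I_2) : exists r, R r /\ embed r = c ij.1 ij.2 ^+ 2.
  by have [r hr er] := genC2_invariant hK (inC_square hK (hc ij.1 ij.2)); exists r.
have [r hr] := fin_all_exists hc2.
exists (fun i j => Q i j * r (i, j)); split=> [i j|].
  by apply: invariantM; [apply: Q_invariant | apply: (hr (i, j)).1].
apply: (@embed_inj K hK); rewrite embed_psub (rmorphXn (psub _)) /= e.
have eq2 i j : embed (Q i j * (Q i j * r (i, j))) = (qq K i j * c i j) ^+ 2.
  by rewrite !(rmorphM (@embed K hK)) /= embed_Q (hr (i, j)).2 mulrA -expr2 exprMn.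
by rewrite !sum2 !(rmorphD (@embed K hK)) /= !eq2 !sqrrD2.
Qed.

(** The two multiples [f f' g] of the cocycle cancel. *)
Lemma cross_invariant f f' u u' : R f -> R f' ->
  (forall s, act s u - u = f * g s) -> (forall s, act s u' - u' = f' * g s) -> R (f * u' - f' * u).
Proof.
move=> hf hf' hu hu' s; rewrite coord_actB !act_GL2_invariant //.
have -> : act s u = u + f * g s by rewrite -hu addrC subrK.
have -> : act s u' = u' + f' * g s by rewrite -hu' addrC subrK.
ring.
Qed.

(** The contradiction is a primitive of the cocycle, obtained as a quotient of
    the primitive of [f1 g] by [f1]. *)
Lemma not_free n (y : 'I_n -> T) (B : T -> Prop) : (6 <= n)%N -> (forall i, R (y i)) ->
  (forall P, psub y P = 0 -> P = 0) -> (forall f, B f -> R f) ->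
  (forall f, R f -> exists k (b : 'I_k -> T) (c : 'I_k -> {mpoly K[n]}),
     (forall i, B (b i)) /\ f = \sum_i psub y (c i) * b i) ->
  (forall k (b : 'I_k -> T) (c : 'I_k -> {mpoly K[n]}), injective b ->
     (forall i, B (b i)) -> \sum_i psub y (c i) * b i = 0 -> forall i, psub y (c i) = 0) -> False.
Proof.
move=> hn hy ind BR Bspan Bfree.
have hR : submodule (psub y) R.
  split; [exact: invariant0 | exact: invariantD |].
  by move=> a f hf; apply: invariantM => //; apply: invariant_psub.
have Bfree' k (b : 'I_k -> T) (c : 'I_k -> {mpoly K[n]}) : injective b ->
    (forall i, B (b i)) -> \sum_i psub y (c i) * b i = 0 -> forall i, c i = 0.
  by move=> inj hb e i; apply/ind/(Bfree _ _ _ inj hb e).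
have [F1 [F2 [F3 [[J1 J2 J3] nz1 reg2 reg3]]]] : exists F1 F2 F3 : {mpoly K[n]},
  [/\ [/\ pairing_ideal (psub y F1), pairing_ideal (psub y F2) & pairing_ideal (psub y F3)], F1 != 0,
    forall a b, F1 * a = F2 * b -> exists e, b = F1 * e &
    forall c a b, F3 * c = F1 * a + F2 * b -> exists u w, c = F1 * u + F2 * w].
  case: n hn y hy ind {Bspan Bfree Bfree' hR} => [|[|m]] // hn y hy ind.
  apply: (@regular_triple K m (fun F => pairing_ideal (psub y F))) => //.
    move=> F a [r [hr e]]; exists (fun i j => psub y a * r i j); split=> [i j|].
      by apply: invariantM => //; apply: invariant_psub.
    rewrite (rmorphM (psub y)) /= e mulr_sumr; apply: eq_bigr => i _.
    by rewrite mulr_sumr; apply: eq_bigr => j _; rewrite mulrCA.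
  move=> r z hr; have [|P nz hP] := @dependent_mod_ideal r (fun i => psub y (z i)) hr.
    by move=> i; apply: invariant_psub.
  by exists P => //; rewrite psub_comp.
have hps F : R (psub y F) by apply: invariant_psub.
set f1 := psub y F1 in J1; set f2 := psub y F2 in J2; set f3 := psub y F3 in J3.
have nzf1 : f1 != 0 by apply: contra nz1 => /eqP /ind ->.
have [u1 hu1] := pairing_ideal_annihilates J1.
have [u2 hu2] := pairing_ideal_annihilates J2.
have [u3 hu3] := pairing_ideal_annihilates J3.
have [R1 R2 R3] : [/\ R f1, R f2 & R f3] by split; apply: hps.
have [h2 [h1 [Rh2 Rh1 e12]]] : exists h2 h1, [/\ R h2, R h1 & f1 * u2 - f2 * u1 = f1 * h2 + f2 * h1].
  apply: (regular3_free hR BR Bspan Bfree' reg3 (f := f3 * u2 - f2 * u3) (g := f1 * u3 - f3 * u1)).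
  - exact: cross_invariant.
  - exact: cross_invariant.
  - exact: cross_invariant.
  - by rewrite -/f1 -/f2 -/f3; ring.
(* [v1], [v2] are again primitives of [f1 g], [f2 g], now with [v2 / v1 = f2 / f1]. *)
pose v1 := u1 + h1; pose v2 := u2 - h2.
have ev : f1 * v2 = f2 * v1.
  by apply/eqP; rewrite -subr_eq0 /v1 /v2; apply/eqP; rewrite -[RHS](subrr (f1 * u2 - f2 * u1)) {2}e12; ring.
have hv1 s : act s v1 - v1 = f1 * g s.
  by rewrite -hu1 /v1 coord_actD (Rh1 s); ring.
have hv2 s : act s v2 - v2 = f2 * g s.
  by rewrite -hu2 /v2 coord_actB (Rh2 s); ring.
have quot i j : exists2 rho, R rho & Q i j * v1 = f1 * (U i j - rho).
  have hQ := Q_invariant hK i j; have hU s := U_cocycle hK s i j.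
  have [rho Rrho e] := regular2_free hR BR Bspan Bfree' reg2
    (cross_invariant R2 hQ hv2 hU) (cross_invariant R1 hQ hv1 hU)
    (ltac:(rewrite -/f1 -/f2; apply/eqP; rewrite -subr_eq0; apply/eqP;
      transitivity (Q i j * (f2 * v1 - f1 * v2)); [ring | by rewrite ev subrr mulr0])).
  exists rho => //; rewrite mulrBr -e -/f1; ring.
have [rho Rrho e0] := quot 0 0; have [rho' Rrho' e1] := quot 1 1.
have e : Q 1 1 * (U 0 0 - rho) = Q 0 0 * (U 1 1 - rho').
  apply: (mulfI nzf1); transitivity (Q 1 1 * (Q 0 0 * v1)); first by rewrite e0; ring.
  by rewrite mulrCA e1; ring.
(* The two pairings have no common factor, so the quotient is a polynomial. *)
have [w ew] : exists w, U 0 0 - rho = Q 0 0 * w.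
  have PD i j k l : pP hK i j != pD hK k l.
    apply/eqP => /(congr1 (vfam (fun=> 0) (fun _ _ => 0) (fun _ _ => 1 : nat))).
    by rewrite vfamP vfamD.
  have PP (j k : 'I_2) : j != k -> pP hK 0 j != pP hK 0 k.
    apply: contra => /eqP /(congr1 (vfam (fun=> ord0) (fun _ j => j) (fun _ _ => ord0))).
    by rewrite !vfamP => ->.
  have DD (i j k l : 'I_2) : (i, j) != (k, l) -> pD hK i j != pD hK k l.
    apply: contra => /eqP /(congr1 (vfam (fun=> (ord0, ord0)) (fun _ _ => (ord0, ord0)) (fun i j => (i, j)))).
    by rewrite !vfamD => ->.
  have [||||||||w hw] := @quadric_dvd K _ (pP hK 0 0) (pD hK 0 0) (pP hK 0 1) (pD hK 0 1)
    (U 0 0 - rho) (Q 1 1).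
  - exact: PD.
  - exact: PD.
  - exact: DD.
  - exact: PP.
  - by rewrite eq_sym PD.
  - exact: Q_neq0.
  - by apply: indepD; apply: indepM; apply: indepX; rewrite ?PD ?DD.
  - move=> v va eq D0; have := congr1 (meval v) e.
    rewrite !mevalM [(Q 0 0).@[v]](_ : _ = 0) ?mul0r => [/eqP|].
      by rewrite mulf_eq0 (negbTE D0) => /eqP.
    by rewrite mevalD !mevalM !mevalXU eq addrr_pchar2.
  exists w; rewrite hw; congr (_ * _).
  by rewrite /Qel char2_opp.
apply: (cocycle_g_nontrivial (hK := hK)); exists w => s.
apply: (mulfI (Q_neq0 0 0)); rewrite -U_cocycle mulrBr -act_GL2_invariant; last exact: Q_invariant.
by rewrite -ew coord_actB (Rrho s); ring.
Qed.

Lemma invariants_not_CM : ~ Cohen_Macaulay R.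
Proof.
move=> [s [[hs ind [k [b [Rb hb]]]] [B [BR Bspan Bfree]]]].
pose y := tnth (in_tuple s).
have hy i : R (y i) by have [+ _] := hs _ (mem_tnth i (in_tuple s)); apply.
have fin f : R f -> aspan (psub y) (codom b) f.
  move=> /hb [c [hc ->]]; apply: aspan_sum => i _.
  have [P ->] := hc i; rewrite comp_psub; apply: aspanZ.
  by apply: aspan_mem; apply: codom_f.
have hn : (6 <= size s)%N.
  rewrite leqNgt; apply/negP => lt.
  have [||P nz eP] := @dependent_over_fewer _ _ _ 6 y (codom b) (tnth (hsop6 hK)) lt.
  - by apply: fin; apply: invariantC.
  - move=> j _ /codomP [i ->]; apply: fin; apply: invariantM => //; exact: hsop6_invariant.
  by rewrite (hsop6_indep eP) eqxx in nz.
apply: (@not_free _ y B hn hy) => //.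
- move=> f /Bspan [l [b' [c [hb' [hc ->]]]]].
  have [P hP] := fin_all_exists hc.
  by exists l, b', P; split=> //; apply: eq_bigr => i _; rewrite hP.
- move=> l b' c inj hb' e i.
  apply: (Bfree l b' (fun i => psub y (c i)) inj hb'); split=> [j|]; last by rewrite e.
  by exists (c j).
Qed.

End NotCM.

Theorem mainTheorem4 (K : closedFieldType) (hK : 2%N \in [pchar K]) :
  let q (i j : 'I_2) : {mpoly K[gdim (gdual (V hK))]} :=
    varX hK i * varXs hK j + varY hK i * varYs hK j in
  let params := [:: q 0 0; q 1 1; q 0 1] in
  [/\ giso (Vstar hK) (Vstar' hK),
      gdim (V hK) = 10%N,
      ~ Cohen_Macaulay (invariant_ring (V hK)),
      exists g : GL2 K -> 'cV[K]_(gdim (W0 hK)),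
        [/\ cocycle (@gvec K (W0 hK)) g,
            H1_nontrivial (@coord_act K (V hK)) (fun s => in_W0 (g s)),
            partial_hsop (invariant_ring (V hK)) params,
            forall f, f \in params -> f \is 2.-homog &
            forall f, f \in params ->
              annihilates f (fun s => in_W0 (g s))] &
      giso (gdual (Wi K)) (Wi K)].
Proof.
move=> q params.
have qE f : f \in params -> exists i j, f = Qel hK i j.
  by rewrite !inE => /or3P[] /eqP ->; [exists 0, 0 | exists 1, 1 | exists 0, 1].
split; [exact: giso_Vstar | by [] | exact: invariants_not_CM | | exact: giso_Wi_dual].
exists (cocycle_g hK); split.
- exact: cocycle_g_cocycle.
- by split; [apply: in_W0_cocycle | apply: cocycle_g_nontrivial].
- exists [:: Mel hK 0 1 + Mel hK 1 0; Mel hK 0 0 + Mel hK 1 1; Mel hK 0 0 + Qel hK 1 0 ^+ 3].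
  exact: hsop6_hsop.
- by move=> f /qE [i [j ->]]; apply: Q_homog.
- by move=> f /qE [i [j ->]]; exists (Uel hK i j) => s; rewrite U_cocycle.
Qed.
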